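(* For all integers $j\ge1$, $\mathcal N_0(6,j)=60^j\frac{(3j)!}{(2j+1)!}$. For all $j\ge2$, $\mathcal N_1(6,j)=\frac{j!\,60^j}{2}\Big[10\binom{3j}{j-2}{}_2F_1(3,2-j;3+2j;-2)+\binom{3j}{j-1}{}_2F_1(3,1-j;2+2j;-2)\Big]$, and $\mathcal N_1(6,1)=30$. For all $j\ge5$, $\mathcal N_2(6,j)=\frac{j!\,60^j}{20}\Big[59\binom{3j}{j-2}{}_2F_1(8,2-j;3+2j;-2)+4011\binom{3j}{j-3}{}_2F_1(8,3-j;4+2j;-2)+27528\binom{3j}{j-4}{}_2F_1(8,4-j;5+2j;-2)+34268\binom{3j}{j-5}{}_2F_1(8,5-j;6+2j;-2)\Big]$, and $\mathcal N_2(6,1)=0$, $\mathcal N_2(6,2)=21240$, $\mathcal N_2(6,3)=355492800$, $\mathcal N_2(6,4)=2543591808\times10^3$.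
   Context: ${}_2F_1(a,b;c;z)=\sum_{k\ge0}\frac{(a)_k(b)_k}{(c)_kk!}z^k$. Labelled graphs: take $j$ vertices labelled $1,\dots,j$, each carrying $6$ half-edges labelled $1,\dots,6$ in counterclockwise cyclic order, together with two additional distinguishable univalent vertices (''legs''), each carrying one half-edge. A 2-legged $6$-valent labelled graph is a perfect matching of all these half-edges. With the prescribed cyclic orders it is a ribbon graph (a graph embedded in a compact oriented surface whose complement is a disjoint union of open cells); its genus is the minimal genus of a compact Riemann surface on which it so embeds. $\mathcal N_g(6,j)$ is the number of such graphs that are connected of minimal genus exactly $g$. *)

(* Defs.v *)
From HB Require Import structures.
From mathcomp Require Import all_boot all_order all_fingroup all_algebra.
From mathcomp Require Import all_classical all_reals all_analysis.

Set Implicit Arguments.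
Unset Strict Implicit.
Unset Printing Implicit Defensive.

Import Order.TTheory GRing.Theory Num.Theory.
Import numFieldNormedType.Exports.

(* [inl v] is the [v]-th nu-valent vertex, [inr l] is the [l]-th leg. *)
Definition vertex (j : nat) : finType := ('I_j + 'I_2)%type.

(* [inl (v, i)] is the half-edge with label [i] at the [v]-th nu-valent vertex,
   [inr l] is the unique half-edge at the [l]-th leg. *)
Definition half_edge (nu j : nat) : finType := ('I_j * 'I_nu + 'I_2)%type.

Definition vertex_of (nu j : nat) (h : half_edge nu j) : vertex j :=
  match h with inl (v, _) => inl v | inr l => inr l end.

Definition next_half_edge (nu j : nat) (h : half_edge nu j) : half_edge nu j :=
  match h with inl (v, i) => inl (v, ordS i) | inr l => inr l end.

Lemma next_half_edge_inj (nu j : nat) : injective (@next_half_edge nu j).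
Proof.
move=> [[v i]|l] [[w k]|l'] //= [-> eq_ik].
by have /ordS_inj -> : ordS i = ordS k by exact: val_inj.
Qed.

(* The cycles of [rotation] are the counterclockwise orders at the vertices. *)
Definition rotation (nu j : nat) : {perm half_edge nu j} :=
  perm (@next_half_edge_inj nu j).

(* A perfect matching [m] sends each half-edge to the one it is matched with. *)
Definition is_matching (nu j : nat) (m : {perm half_edge nu j}) : bool :=
  [forall h, (m h != h) && (m (m h) == h)].

Definition adjacent (nu j : nat) (m : {perm half_edge nu j}) : rel (vertex j) :=
  fun u v => [exists h, (vertex_of h == u) && (vertex_of (m h) == v)].

Definition connected_graph (nu j : nat) (m : {perm half_edge nu j}) : bool :=
  [forall u, forall v, connect (adjacent m) u v].

(* V - E + F for the surface obtained by gluing a disc along each boundary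
   component of the ribbon graph: traversing an edge and then moving to the
   next half-edge around the vertex reached follows a boundary component,
   so the faces are the cycles of the composite permutation. In MathComp
   [(m * rotation nu j) h = rotation nu j (m h)]. *)
Definition euler_char (nu j : nat) (m : {perm half_edge nu j}) : int :=
  (#|vertex j|%:Z - #|porbits m|%:Z + #|porbits (m * rotation nu j)%g|%:Z)%R.

(* For a connected ribbon graph the gluing above is the closed oriented surface
   of least genus in which it embeds, and its complement is a union of cells. *)
Definition has_genus (nu j : nat) (m : {perm half_edge nu j}) (g : nat) : bool :=
  (euler_char m == 2 - 2 * g%:Z)%R.

(* The number of connected 2-legged nu-valent labelled graphs of genus g
   with j vertices of valence nu. *)
Definition Ngraph (g nu j : nat) : nat :=
  #|[set m : {perm half_edge nu j}
      | [&& is_matching m, connected_graph m & has_genus m g]]|.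

Local Open Scope ring_scope.
Local Open Scope classical_set_scope.

Definition pochhammer (R : realType) (a : R) (k : nat) : R :=
  \prod_(0 <= i < k) (a + i%:R).

Definition hyp2F1 (R : realType) (a b c z : R) : R :=
  limn (series (fun k : nat =>
    pochhammer a k * pochhammer b k / (pochhammer c k * k`!%:R) * z ^+ k)).

(* Main.v *)
(** Give each connected matching the weight [N] to the number of its faces.
Deleting the edges one at a time, always at an explored vertex, replaces the
matching [m] by [tperm h h' * m] and the rotation [rho] by [tperm h h' * rho];
the resulting recursion for the weighted sums is the system of loop equations
satisfied by the correlators of power sums in the [N]-dimensional Hankel
determinant of the moments of [exp (- x ^ 2 / 2 + s x ^ 6)]. Hence the
generating function of the 2-legged graphs is the coefficient
[beta_N = h_N / h_(N - 1)] in the three-term recurrence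
[P_(n + 1) = x P_n - beta_n P_(n - 1)] of the orthogonal polynomials, which
satisfies Freud's string equation.

Expanding that equation to relative order [N ^ - 4] determines the generating
functions of genus 0, 1 and 2 as rational functions of the series [u] defined by
[u = 60 w (1 + u) ^ 3], and Lagrange inversion turns their coefficients into
terminating hypergeometric sums at [- 2]. *)

Require Import Defs.
From HB Require Import structures.
From mathcomp Require Import all_boot all_order all_fingroup all_algebra.
From mathcomp Require Import boolp zify ring.

Import Order.TTheory GRing.Theory Num.Theory.

Set Implicit Arguments.
Unset Strict Implicit.
Unset Printing Implicit Defensive.

Local Open Scope ring_scope.

(** No integral occurs: the moments are power series in s, used only through the vanishing of the
    odd ones, the recursion that formal integration by parts would give, and the constant term of
    [mu 0]. Correlators are divided by the Hankel determinant, so the empty one is 1 and an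
    exploration from the legs never sees a component without legs; a parity count identifies
    reaching everything from the legs with connectedness. No uniqueness theorem for the loop
    equations is needed: both sides are unfolded by the same recursion, which consumes unmatched
    half-edges.

    The expansion in 1 / N is exact algebra. For each n the face count is an odd polynomial in N of
    degree at most 2 n + 1, so identities known at the integers N >= 3 hold between polynomials, and
    coefficients may be compared. The number 60 is 6 times the ten products in the string equation.
    The linearised equation at each higher genus has the coefficient (1 + u) - 3 u = 1 - 2 u, whose
    inverse powers are the source of the argument - 2. *)

Definition fps (R : Type) := nat -> R.

HB.instance Definition _ (R : comNzRingType) := gen_eqMixin (fps R).
HB.instance Definition _ (R : comNzRingType) := gen_choiceMixin (fps R).

(** * Formal power series as coefficient functions *)

Section PowerSeries.
Variable R : comNzRingType.
Implicit Types f g h : fps R.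

Definition fps_zero : fps R := fun _ => 0.
Definition fps_opp f : fps R := fun n => - f n.
Definition fps_add f g : fps R := fun n => f n + g n.
Definition fps_one : fps R := fun n => (n == 0)%:R.
Definition fps_mul f g : fps R := fun n => \sum_(i < n.+1) f i * g (n - i)%N.

Fact fps_addA : associative fps_add.
Proof. by move=> f g h; apply/funext => n; rewrite /fps_add addrA. Qed.

Fact fps_addC : commutative fps_add.
Proof. by move=> f g; apply/funext => n; rewrite /fps_add addrC. Qed.

Fact fps_add0 : left_id fps_zero fps_add.
Proof. by move=> f; apply/funext => n; rewrite /fps_add add0r. Qed.

Fact fps_addN : left_inverse fps_zero fps_opp fps_add.
Proof. by move=> f; apply/funext => n; rewrite /fps_add addNr. Qed.

HB.instance Definition _ :=
  GRing.isZmodule.Build (fps R) fps_addA fps_addC fps_add0 fps_addN.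

Definition fps_trunc n f : {poly R} := \poly_(i < n.+1) f i.

Lemma coef_mul_eq (p q p' q' : {poly R}) n :
    (forall i, (i <= n)%N -> p`_i = p'`_i) ->
    (forall i, (i <= n)%N -> q`_i = q'`_i) ->
  (p * q)`_n = (p' * q')`_n.
Proof.
move=> eqp eqq; rewrite !coefM; apply: eq_bigr => i _.
by rewrite eqp ?eqq ?leq_subr // -ltnS.
Qed.

Lemma coef_trunc n f i : (i <= n)%N -> (fps_trunc n f)`_i = f i.
Proof. by move=> le_in; rewrite coef_poly ltnS le_in. Qed.

Lemma fps_mulE_trunc f g n m : (n <= m)%N ->
  fps_mul f g n = (fps_trunc m f * fps_trunc m g)`_n.
Proof.
move=> le_nm; rewrite coefM; apply: eq_bigr => i _.
by rewrite !coef_trunc //; move: (ltn_ord i); lia.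
Qed.

(** Coefficient [n] of a product sees only coefficients up to [n], so associativity is inherited
    from [{poly R}] by truncation. *)
Fact fps_mulA : associative fps_mul.
Proof.
move=> f g h; apply/funext => n.
rewrite !(fps_mulE_trunc _ _ (leqnn n)).
have truncM f1 f2 i : (i <= n)%N ->
    (fps_trunc n (fps_mul f1 f2))`_i = (fps_trunc n f1 * fps_trunc n f2)`_i.
  by move=> le_in; rewrite coef_trunc // -fps_mulE_trunc.
rewrite (coef_mul_eq (fun i _ => erefl) (truncM g h)) mulrA.
by apply: coef_mul_eq => // i le_in; rewrite truncM.
Qed.

Fact fps_mulC : commutative fps_mul.
Proof.
by move=> f g; apply/funext => n; rewrite !(fps_mulE_trunc _ _ (leqnn n)) mulrC.
Qed.

Fact fps_mul1 : left_id fps_one fps_mul.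
Proof.
move=> f; apply/funext => n; rewrite /fps_mul big_ord_recl subn0 mul1r.
by rewrite big1 ?addr0 // => i _; rewrite mul0r.
Qed.

Fact fps_mulD : left_distributive fps_mul fps_add.
Proof.
move=> f g h; apply/funext => n; rewrite /fps_add /fps_mul -big_split /=.
by apply: eq_bigr => i _; rewrite mulrDl.
Qed.

Fact fps_one_neq0 : fps_one != 0.
Proof. by apply/eqP => /(congr1 (@^~ 0)) /eqP; rewrite oner_eq0. Qed.

HB.instance Definition _ := GRing.Zmodule_isComNzRing.Build (fps R)
  fps_mulA fps_mulC fps_mul1 fps_mulD fps_one_neq0.

(** Invertibility is the bare existence of an inverse, which is then chosen, so that the structure
    exists over every [R]; [fps_unitE] supplies the usual criterion over a field. *)
Definition fps_unit : pred (fps R) := fun f => `[< exists g, g * f = 1 >].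
Definition fps_inv f : fps R :=
  if pselect (exists g, g * f = 1) is left ex then projT1 (cid ex) else f.

Fact fps_mulV : {in fps_unit, left_inverse 1 fps_inv *%R}.
Proof.
move=> f /asboolP ex; rewrite /fps_inv; case: pselect => // ex'.
by case: (cid ex').
Qed.

Fact fps_unitP f g : g * f = 1 -> fps_unit f.
Proof. by move=> gf1; apply/asboolP; exists g. Qed.

Fact fps_inv_out : {in [predC fps_unit], fps_inv =1 id}.
Proof.
move=> f /asboolPn nex; rewrite /fps_inv; case: pselect => //.
Qed.

HB.instance Definition _ := GRing.ComNzRing_hasMulInverse.Build (fps R)
  fps_mulV fps_unitP fps_inv_out.

Lemma fps1 n : (1 : fps R) n = (n == 0)%:R. Proof. by []. Qed.
Lemma fpsD f g n : (f + g) n = f n + g n. Proof. by []. Qed.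
Lemma fpsN f n : (- f) n = - f n. Proof. by []. Qed.
Lemma fpsB f g n : (f - g) n = f n - g n. Proof. by []. Qed.
Lemma fpsM f g n : (f * g) n = \sum_(i < n.+1) f i * g (n - i)%N.
Proof. by []. Qed.

Lemma fps_sum I (r : seq I) (P : pred I) (F : I -> fps R) n :
  (\sum_(i <- r | P i) F i) n = \sum_(i <- r | P i) F i n.
Proof. by elim/big_rec2: _ => // i x y _ <-. Qed.

Lemma fpsMn f k n : (f *+ k) n = f n *+ k.
Proof. by elim: k => // k IHk; rewrite !mulrS fpsD IHk. Qed.

Lemma fps_nat k n : (k%:R : fps R) n = (n == 0)%:R * k%:R.
Proof. by rewrite fpsMn fps1 -[LHS]mulr_natr. Qed.

Lemma fpsM0 f g : (f * g) 0 = f 0 * g 0.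
Proof. by rewrite fpsM big_ord1. Qed.

Fact fps_coef0_zmod : zmod_morphism (fun f => f 0%N). Proof. by []. Qed.
Fact fps_coef0_monoid : monoid_morphism (fun f => f 0%N).
Proof. by split => // f g; exact: fpsM0. Qed.

Definition fpsC (c : R) : fps R := fun n => (n == 0)%:R * c.

Lemma fpsCM c f n : (fpsC c * f) n = c * f n.
Proof.
rewrite fpsM big_ord_recl subn0 /fpsC mul1r big1 ?addr0 // => i _.
by rewrite !mul0r.
Qed.

Lemma fpsC_zmod : zmod_morphism fpsC.
Proof. by move=> a b; apply/funext => n; rewrite fpsB /fpsC mulrBr. Qed.

Lemma fpsC_monoid : monoid_morphism fpsC.
Proof.
split=> [|a b]; apply/funext => n; first by rewrite fps1 /fpsC mulr1.
by rewrite fpsCM /fpsC mulrCA.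
Qed.

HB.instance Definition _ := GRing.isZmodMorphism.Build _ _ fpsC fpsC_zmod.
HB.instance Definition _ := GRing.isMonoidMorphism.Build _ _ fpsC fpsC_monoid.

Definition fpsX : fps R := fun n => (n == 1)%:R.

Lemma fpsXM f n : (fpsX * f) n = if n is m.+1 then f m else 0.
Proof.
rewrite fpsM big_ord_recl /fpsX mul0r add0r; case: n => [|n].
  by rewrite big_ord0.
rewrite big_ord_recl big1 => [|i _]; last by rewrite mul0r.
by rewrite addr0 mul1r subSS subn0.
Qed.

Lemma fps_natM k f n : (k%:R * f) n = k%:R * f n.
Proof. by rewrite mulr_natl fpsMn mulr_natl. Qed.

(** The derivation X d/dX. It later turns polynomial factors in the number of vertices into
    differential operators. *)
Definition euler f : fps R := fun n => n%:R * f n.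

Lemma eulerD f g : euler (f + g) = euler f + euler g.
Proof. by apply/funext => n; rewrite fpsD /euler mulrDr. Qed.

Lemma eulerN f : euler (- f) = - euler f.
Proof. by apply/funext => n; rewrite fpsN /euler mulrN. Qed.

Lemma eulerM f g : euler (f * g) = euler f * g + f * euler g.
Proof.
apply/funext => n; rewrite fpsD /euler !fpsM mulr_sumr -big_split /=.
apply: eq_bigr => i _; rewrite mulrA [f i * (_ * _)]mulrCA -!mulrA -mulrDl.
by rewrite -natrD subnKC // -ltnS.
Qed.

Lemma eulerC c : euler (fpsC c) = 0.
Proof. by apply/funext => -[|n]; rewrite /euler /fpsC ?mul0r ?mulr0. Qed.

Lemma euler_nat k : euler k%:R = 0.
Proof. by rewrite -(rmorph_nat fpsC) eulerC. Qed.

Lemma eulerX : euler fpsX = fpsX.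
Proof. by apply/funext => -[|[|n]]; rewrite /euler /fpsX ?mul1r ?mulr0. Qed.

End PowerSeries.

Lemma fps_unitE (F : fieldType) (f : fps F) : f 0%N != 0 -> f \is a GRing.unit.
Proof.
move=> f0.
(* Each coefficient of the inverse depends on all earlier ones, hence [invs n] returns the list of
   the first [n] of them. *)
pose invs := fix invs (n : nat) : seq F :=
  if n is m.+1 then
    rcons (invs m)
      (- (f 0%N)^-1 * \sum_(i < m) f i.+1 * nth 0 (invs m) (m - i.+1)
       + (m == 0)%:R * (f 0%N)^-1)
  else [::].
have size_invs n : size (invs n) = n by elim: n => //= n IHn; rewrite size_rcons IHn.
have nth_invs m n : (n < m)%N -> nth 0 (invs m) n = nth 0 (invs n.+1) n.
  elim: m => // m IHm; rewrite ltnS leq_eqVlt => /orP[/eqP -> //|lt_nm].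
  by rewrite [invs m.+1]/= nth_rcons size_invs lt_nm IHm.
pose g : fps F := fun n => nth 0 (invs n.+1) n.
suff fg1 : f * g = 1 by apply/unitrP; exists g; rewrite mulrC fg1.
apply/funext => n; rewrite fpsM fps1 big_ord_recl subn0.
have -> : g n = - (f 0%N)^-1 * \sum_(i < n) f i.+1 * g (n - i.+1)%N
       + (n == 0)%:R * (f 0%N)^-1.
  rewrite {1}/g /= nth_rcons size_invs ltnn eqxx; congr (_ * _ + _).
  by apply: eq_bigr => i _; rewrite nth_invs //; move: (ltn_ord i); lia.
rewrite mulrDr mulNr mulrN mulVKf // mulrCA divff // mulr1 addrAC.
by rewrite addNr add0r.
Qed.

(** * Power sums and Virasoro vector fields acting on alternating functions of exponents *)

Section ShiftOperators.
Variables (A : comNzRingType) (N : nat).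
Hypothesis double_inj : forall x : A, x + x = 0 -> x = 0.

Local Notation expo := {ffun 'I_N -> nat}.
Implicit Types (e f : expo) (i j : 'I_N) (Phi : expo -> A).

Definition shift_at e i k : expo :=
  [ffun l => if l == i then (e l + k)%N else e l].

Definition lower2_at e i k : expo :=
  [ffun l => if l == i then (e l + k - 2)%N else e l].

Definition staircase : expo := [ffun l => val l].

(* If [Phi e] is [L(x ^ e * vandermonde x)] for a linear form [L], then
   [psum_op k Phi] is [Phi] for the form [L(_ * sum_i x_i ^ k)], and
   [virasoro_op k] comes from the vector field [sum_i x_i ^ (k - 1) d/dx_i]. *)
Definition psum_op k Phi e : A := \sum_i Phi (shift_at e i k).

Definition virasoro_op k Phi e : A := \sum_i (e i)%:R * Phi (lower2_at e i k).

Definition alternates Phi := forall e i j, i != j ->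
  Phi [ffun l => e (tperm i j l)] = - Phi e.

Lemma shift_atC e i j k l :
  shift_at (shift_at e i k) j l = shift_at (shift_at e j l) i k.
Proof. by apply/ffunP => m; rewrite !ffunE; do 2!case: ifP => //; lia. Qed.

Lemma psum_opC k l Phi : psum_op k (psum_op l Phi) = psum_op l (psum_op k Phi).
Proof.
apply/funext => e; rewrite /psum_op exchange_big; apply: eq_bigr => i _.
by apply: eq_bigr => j _; rewrite shift_atC.
Qed.

Lemma psum_op0 Phi e : psum_op 0 Phi e = N%:R * Phi e.
Proof.
rewrite /psum_op (eq_bigr (fun _ => Phi e)) => [|i _].
  by rewrite sumr_const card_ord mulr_natl.
by congr Phi; apply/ffunP => l; rewrite ffunE addn0 if_same.
Qed.

Lemma alternates_psum k Phi : alternates Phi -> alternates (psum_op k Phi).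
Proof.
move=> altPhi e i j neq_ij; rewrite /psum_op -sumrN.
rewrite (reindex_inj (@perm_inj _ (tperm i j))); apply: eq_bigr => l _ /=.
rewrite -(altPhi _ i j neq_ij); congr Phi; apply/ffunP => m; rewrite !ffunE.
by rewrite -(inj_eq (@perm_inj _ (tperm i j)) m) tpermK.
Qed.

Lemma alternates_eq0 Phi e i j :
  alternates Phi -> i != j -> e i = e j -> Phi e = 0.
Proof.
move=> altPhi neq_ij eq_eij; apply: double_inj.
rewrite -[X in X + _]opprK -(altPhi _ _ _ neq_ij).
rewrite (_ : [ffun l => _] = e) ?addNr //.
by apply/ffunP => l; rewrite ffunE; case: tpermP => [->|->|].
Qed.

(* For [a > 0] the row [i + a] collides with a row of the staircase when
   [a < j - i], and the remaining terms cancel in pairs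
   [a <-> k + (j - i) - a] by antisymmetry. *)
Lemma sum_two_shifts Phi k i j : alternates Phi -> (i < j)%N ->
  \sum_(0 <= a < k.+1) Phi (shift_at (shift_at staircase i a) j (k - a))
  = Phi (shift_at staircase j k).
Proof.
move=> altPhi lt_ij; have neq_ij : i != j by rewrite -val_eqE /= ltn_eqF.
have neq_ji : j != i by rewrite eq_sym.
rewrite big_ltn // [X in _ + X](_ : _ = 0) ?addr0; last first.
  set d := (j - i)%N.
  have small a : (0 < a < d)%N ->
      Phi (shift_at (shift_at staircase i a) j (k - a)) = 0.
    move=> /andP[a_gt0 lt_ad].
    have lt_l : (i + a < N)%N by move: (ltn_ord j) lt_ad; rewrite /d; lia.
    apply: (@alternates_eq0 _ _ i (Ordinal lt_l)) => //.
      by rewrite -val_eqE /=; lia.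
    rewrite !ffunE eqxx (negPf neq_ij) -!val_eqE /=.
    by rewrite !ifN //; apply/eqP; move: lt_ad; rewrite /d; lia.
  case: (leqP k.+1 d) => [le_kd|lt_dk].
    by rewrite big_nat big1 // => a /andP[? ?]; apply: small; lia.
  rewrite (@big_cat_nat _ _ _ d) ?subn_gt0 //=; last by lia.
  rewrite big_nat big1 ?add0r => [|a ?]; last exact: small.
  apply: double_inj; rewrite [X in X + _]big_nat_rev -big_split /=.
  rewrite big_nat big1 // => a /andP[le_da lt_ak].
  rewrite addnS subSS.
  rewrite -[X in X + _]opprK -(altPhi _ i j neq_ij) [X in - Phi X + _](_ : _ =
    shift_at (shift_at staircase i a) j (k - a)) ?addNr //.
  apply/ffunP => l; rewrite !ffunE; case: tpermP => [->|->|/eqP ? /eqP ?].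
  - rewrite eqxx (negPf neq_ij) (negPf neq_ji) eqxx /=.
    by move: le_da lt_ak lt_ij; rewrite /d; lia.
  - rewrite eqxx (negPf neq_ij) (negPf neq_ji) eqxx /=.
    by move: le_da lt_ak lt_ij; rewrite /d; lia.
  by do !case: ifP => //; lia.
rewrite subn0; congr (Phi (shift_at _ _ _)); apply/ffunP => l.
by rewrite ffunE addn0 if_same.
Qed.

(** Counterpart of the logarithmic derivative of the Vandermonde along sum_i x_i ^ (k - 1) d/dx_i.
    That derivative is the sum over i < j of (x_i ^ (k - 1) - x_j ^ (k - 1)) / (x_i - x_j), that is,
    of all x_i ^ a x_j ^ (k - 2 - a). Doubling it and adding the diagonal i = j gives all ordered
    pairs. *)
Lemma virasoro_staircase k Phi : (0 < k)%N -> alternates Phi ->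
  virasoro_op k Phi staircase *+ 2 + psum_op (k - 2) Phi staircase *+ (k - 1)
  = \sum_(0 <= a < k - 1)
      psum_op a (psum_op (k - 2 - a) Phi) staircase.
Proof.
move=> k_gt0 altPhi; case: (leqP 2 k) => [k_ge2|]; last first.
  case: k k_gt0 => [|[|]]// _ _; rewrite subnn mulr0n addr0 big_geq //.
  rewrite /virasoro_op big1 ?mul0rn // => i _; rewrite ffunE /=.
  (* For [k = 1] a row i > 0 of the staircase moves down onto row i - 1, so antisymmetry kills its
     term. *)
  case: (posnP i) => [->|i_gt0]; first by rewrite mul0r.
  have lt_i : (i.-1 < N)%N by rewrite (leq_ltn_trans (leq_pred _)).
  rewrite (@alternates_eq0 _ _ i (Ordinal lt_i)) ?mulr0 //.
    by rewrite -val_eqE /=; lia.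
  by rewrite !ffunE eqxx -val_eqE /= ifN; lia.
have [K ->] : exists K, k = K.+2 by exists (k - 2)%N; lia.
rewrite (_ : (K.+2 - 1 = K.+1)%N); last by lia.
rewrite (_ : (K.+2 - 2 = K)%N); last by lia.
pose G a i j := Phi (shift_at (shift_at staircase i a) j (K - a)).
rewrite (eq_bigr (fun a => \sum_i \sum_j G a i j)) //.
rewrite exchange_big /=.
under eq_bigr do rewrite exchange_big /=.
have -> : \sum_i \sum_j \sum_(0 <= a < K.+1) G a i j =
    \sum_(i : 'I_N) \sum_(j : 'I_N | (i < j)%N) \sum_(0 <= a < K.+1) G a i j +
    \sum_(i : 'I_N) \sum_(j : 'I_N | (j < i)%N) \sum_(0 <= a < K.+1) G a i j +
    \sum_i \sum_(0 <= a < K.+1) G a i i.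
  rewrite -!big_split /=; apply: eq_bigr => i _.
  rewrite (bigID (fun j : 'I_N => i < j)%N) /= -addrA; congr (_ + _).
  rewrite (bigD1 i) ?ltnn //= addrC; congr (_ + _).
  by apply: eq_bigl => j; rewrite -val_eqE /=; lia.
have -> : \sum_(i : 'I_N) \sum_(j : 'I_N | (j < i)%N) \sum_(0 <= a < K.+1) G a i j =
          \sum_(i : 'I_N) \sum_(j : 'I_N | (i < j)%N) \sum_(0 <= a < K.+1) G a i j.
  rewrite (exchange_big_dep predT) //=; apply: eq_bigr => i _.
  apply: eq_bigr => j _; rewrite big_nat_rev /=; apply: eq_big_nat => a /andP[_ le_aK].
  by rewrite /G add0n subSS shift_atC subKn.
rewrite -mulr2n; congr (_ *+ 2 + _).
  (* Each of the [j] rows below row [j] contributes the same term; this produces the coefficient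
     [staircase j]. *)
  rewrite (exchange_big_dep predT) //=; apply: eq_bigr => j _.
  under eq_bigr => i lt_ij do rewrite sum_two_shifts //.
  rewrite sumr_const ffunE mulr_natl; congr (_ *+ _).
    by congr Phi; apply/ffunP => l; rewrite !ffunE; case: ifP => //; lia.
  rewrite -sum1_card -(@big_ord_widen _ _ _ _ N (fun=> 1%N) (ltnW (ltn_ord j))).
  by rewrite sum1_card card_ord.
rewrite /psum_op -sumrMnl; apply: eq_bigr => i _.
rewrite (eq_big_nat _ _ (F2 := fun _ => Phi (shift_at staircase i K))).
  by rewrite sumr_const_nat subn0.
move=> a /andP[_ ?]; congr Phi; apply/ffunP => l; rewrite !ffunE /=.
by case: (l == i) => //; lia.
Qed.

(** Leibniz rule: the vector field sends sum_i x_i ^ l to l sum_i x_i ^ (l + k - 2). The hypothesis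
    [0 < k] makes the truncated exponents correct wherever their coefficient is nonzero. *)
Lemma psum_virasoro k l Phi : (0 < k)%N ->
  psum_op l (virasoro_op k Phi) =
  fun e => virasoro_op k (psum_op l Phi) e + l%:R * psum_op (l + k - 2) Phi e.
Proof.
move=> k_gt0; apply/funext => e; rewrite /psum_op /virasoro_op.
rewrite mulr_sumr exchange_big -big_split /=; apply: eq_bigr => i _.
rewrite mulr_sumr (bigD1 i) //= [in RHS](bigD1 i) //= addrAC.
congr (_ + _); last first.
  apply: eq_bigr => j neq_ji; rewrite ffunE eq_sym (negPf neq_ji).
  congr (_ * Phi _); apply/ffunP => m; rewrite !ffunE.
  by case: (eqVneq m i) => [->|_] //; rewrite eq_sym (negPf neq_ji).
rewrite ffunE eqxx natrD mulrDl; congr (_ + _).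
  case: (posnP (e i)) => [->|e_gt0]; first by rewrite !mul0r.
  congr (_ * Phi _); apply/ffunP => m; rewrite !ffunE.
  by case: eqP => [->|] //; lia.
case: (posnP l) => [->|l_gt0]; first by rewrite !mul0r.
congr (_ * Phi _); apply/ffunP => m; rewrite !ffunE.
by case: eqP => [->|] //; lia.
Qed.

Definition psum_ops (ks : seq nat) Phi := foldr psum_op Phi ks.

Lemma psum_opD k Phi Psi :
  psum_op k (fun e => Phi e + Psi e) = fun e => psum_op k Phi e + psum_op k Psi e.
Proof. by apply/funext => e; rewrite /psum_op big_split. Qed.

Lemma psum_opZ k c Phi :
  psum_op k (fun e => c * Phi e) = fun e => c * psum_op k Phi e.
Proof. by apply/funext => e; rewrite /psum_op mulr_sumr. Qed.

Lemma psum_op_sum k (I : Type) (r : seq I) (F : I -> expo -> A) :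
  psum_op k (fun e => \sum_(x <- r) F x e) =
  fun e => \sum_(x <- r) psum_op k (F x) e.
Proof. by apply/funext => e; rewrite /psum_op exchange_big. Qed.

Lemma psum_opsD ks Phi Psi : psum_ops ks (fun e => Phi e + Psi e) =
  fun e => psum_ops ks Phi e + psum_ops ks Psi e.
Proof. by elim: ks => //= k ks ->; rewrite psum_opD. Qed.

Lemma psum_opsZ ks c Phi :
  psum_ops ks (fun e => c * Phi e) = fun e => c * psum_ops ks Phi e.
Proof. by elim: ks => //= k ks ->; rewrite psum_opZ. Qed.

Lemma psum_ops_sum ks (I : Type) (r : seq I) (F : I -> expo -> A) :
  psum_ops ks (fun e => \sum_(x <- r) F x e) =
  fun e => \sum_(x <- r) psum_ops ks (F x) e.
Proof. by elim: ks => //= k ks ->; rewrite psum_op_sum. Qed.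

Lemma psum_ops_op ks k Phi : psum_ops ks (psum_op k Phi) = psum_ops (k :: ks) Phi.
Proof. by elim: ks => //= l ks ->; rewrite psum_opC. Qed.

Lemma psum_ops_perm ks ls Phi :
  perm_eq ks ls -> psum_ops ks Phi = psum_ops ls Phi.
Proof.
elim: ks ls => [|k ks IHks] ls; first by move/perm_size/esym/size0nil ->.
move=> eq_kls; have k_ls : k \in ls by rewrite -(perm_mem eq_kls) mem_head.
rewrite /= (IHks (rem k ls)); last first.
  by rewrite -(perm_cons k) (perm_trans eq_kls) // perm_to_rem.
elim: ls k_ls {IHks eq_kls} => //= l ls IHls; rewrite inE eq_sym.
by case: eqP => [->|_] //= k_ls; rewrite psum_opC IHls.
Qed.

Lemma alternates_psums ks Phi : alternates Phi -> alternates (psum_ops ks Phi).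
Proof. by move=> ?; elim: ks => //= k ks; apply: alternates_psum. Qed.

(** Degree bookkeeping for an edge between the [n]-th vertex and a vertex of degree [k]: each end
    uses up one half-edge and the two vertices fuse. *)
Definition merge_at (ks : seq nat) n k :=
  set_nth 0%N ks n (nth 0%N ks n + k - 2)%N.

Lemma psums_virasoro ks k Phi : (0 < k)%N ->
  psum_ops ks (virasoro_op k Phi) = fun e => virasoro_op k (psum_ops ks Phi) e +
    \sum_(0 <= n < size ks)
      (nth 0%N ks n)%:R * psum_ops (merge_at ks n k) Phi e.
Proof.
move=> k_gt0; elim: ks => [|l ks IHks] /=.
  by apply/funext => e; rewrite big_geq ?addr0.
rewrite IHks (psum_opD _ (virasoro_op k (psum_ops ks Phi))) psum_virasoro //.
rewrite psum_op_sum; apply/funext => e.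
rewrite -addrA; congr (_ + _); rewrite big_nat_recl //=.
congr (_ + _).
  by apply: eq_bigr => n _; rewrite psum_opZ.
Qed.

End ShiftOperators.

Section ReplaceRow.
Variables (A : comNzRingType) (n : nat).
Implicit Types M B : 'M[A]_n.

Lemma det_replace_row M B i :
  \det (\matrix_(a, b) if a == i then B a b else M a b)
  = \sum_j B i j * cofactor M i j.
Proof.
rewrite (expand_det_row _ i); apply: eq_bigr => j _; rewrite mxE eqxx.
congr (_ * _); rewrite /cofactor; congr (_ * \det _); apply/matrixP => a b.
by rewrite !mxE eq_sym (negPf (neq_lift _ _)).
Qed.

Lemma det_replace_col M B j :
  \det (\matrix_(a, b) if b == j then B a b else M a b)
  = \sum_i B i j * cofactor M i j.
Proof.
rewrite (expand_det_col _ j); apply: eq_bigr => i _; rewrite mxE eqxx.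
congr (_ * _); rewrite /cofactor; congr (_ * \det _); apply/matrixP => a b.
by rewrite !mxE eq_sym (negPf (neq_lift _ _)).
Qed.

(** Both sides are the derivative of the determinant at [M] in the direction [B], the sum of all
    [B i j * cofactor M i j]. *)
Lemma sum_det_replace M B :
  \sum_i \det (\matrix_(a, b) if a == i then B a b else M a b)
  = \sum_j \det (\matrix_(a, b) if b == j then B a b else M a b).
Proof.
under eq_bigr do rewrite det_replace_row.
by rewrite exchange_big; apply: eq_bigr => j _; rewrite det_replace_col.
Qed.

End ReplaceRow.

(** * Loop equations for Hankel determinants *)

Section LoopEquation.
Variables (A : comNzRingType) (N : nat) (mu : nat -> A) (s : A).
Hypothesis double_inj : forall x : A, x + x = 0 -> x = 0.
Hypothesis mu_rec : forall n,
  mu n.+1 = n%:R * mu n.-1 + 6%:R * s * mu (n + 5)%N.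

Local Notation expo := {ffun 'I_N -> nat}.
Implicit Types (e f : expo) (i j : 'I_N).

(** By Andreief's identity, this is what the N-fold integral of det (x_i ^ e_j) det (x_i ^ f_j)
    divided by N! would be, if [mu] were the moments of a measure. *)
Definition hankel_minor e f : A := \det (\matrix_(i < N, j < N) mu (e i + f j)%N).

Lemma hankel_minor_sym e f : hankel_minor e f = hankel_minor f e.
Proof.
rewrite /hankel_minor -det_tr; congr (\det _); apply/matrixP => i j.
by rewrite !mxE addnC.
Qed.

Lemma hankel_minor_alternates f : alternates (fun e => hankel_minor e f).
Proof.
move=> e i j neq_ij; rewrite /hankel_minor.
rewrite -[RHS]mulN1r -[- 1](_ : (-1) ^+ (tperm i j) = _); last first.
  by rewrite odd_tperm neq_ij.
rewrite -det_perm -det_mulmx -row_permE; congr (\det _); apply/matrixP => a b.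
by rewrite !mxE ffunE.
Qed.

(** The power sum is a symmetric factor, so either of the two alternants can absorb it. *)
Lemma hankel_minor_psum e f k :
  \sum_i hankel_minor (shift_at e i k) f = \sum_j hankel_minor e (shift_at f j k).
Proof.
pose M := \matrix_(i < N, j < N) mu (e i + f j)%N.
pose B := \matrix_(i < N, j < N) mu (e i + f j + k)%N.
transitivity (\sum_i \det (\matrix_(a, b) if a == i then B a b else M a b)).
  apply: eq_bigr => i _; congr (\det _); apply/matrixP => a b.
  by rewrite !mxE ffunE; case: ifP => // _; rewrite addnAC.
rewrite sum_det_replace; apply: eq_bigr => j _; congr (\det _).
by apply/matrixP => a b; rewrite !mxE ffunE; case: ifP => // _; rewrite addnA.
Qed.

Definition hankel e := hankel_minor e (staircase N).

(** Expand along row [i] and apply [mu_rec] to each entry of it. The factor e_i + (k - 1) + b then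
    splits into a row part and the column index b; the latter is the vector field acting on the
    column exponents. *)
Lemma hankel_by_parts k e : (0 < k)%N ->
  psum_op k hankel e =
    \sum_i (e i + (k - 1))%:R * hankel (lower2_at e i k)
    + virasoro_op k (hankel_minor e) (staircase N)
    + 6%:R * s * psum_op (k + 4) hankel e.
Proof.
move=> k_gt0; pose M := \matrix_(i < N, j < N) mu (e i + j)%N.
have rowE (g : nat -> nat) i :
    hankel [ffun l => if l == i then g (e l) else e l] =
    \sum_(b < N) mu (g (e i) + b)%N * cofactor M i b.
  have := det_replace_row M (\matrix_(a < N, b < N) mu (g (e a) + b)%N) i.
  under eq_bigr do rewrite mxE.
  move=> <-; congr (\det _); apply/matrixP => a b; rewrite !mxE !ffunE.
  by case: ifP.
have colE (g : nat -> nat) j :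
    hankel_minor e [ffun l => if l == j then g (staircase N l) else staircase N l] =
    \sum_a mu (e a + g j)%N * cofactor M a j.
  have := det_replace_col M (\matrix_(a < N, b < N) mu (e a + g b)%N) j.
  under eq_bigr do rewrite mxE.
  move=> <-; congr (\det _); apply/matrixP => a b; rewrite !mxE !ffunE.
  by case: ifP.
rewrite /psum_op /virasoro_op.
under eq_bigr do rewrite (rowE (fun x => x + k)%N).
under [in RHS]eq_bigr do rewrite (rowE (fun x => x + k - 2)%N) mulr_sumr.
under [X in _ + X + _]eq_bigr do
  rewrite (colE (fun x => x + k - 2)%N) ffunE mulr_sumr.
rewrite [X in _ + X + _]exchange_big mulr_sumr -!big_split.
apply: eq_bigr => i _; rewrite (rowE (fun x => x + (k + 4))%N) mulr_sumr.
rewrite -!big_split; apply: eq_bigr => b _ /=.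
move: (cofactor M i b) => C; rewrite !mulrA -!mulrDl; congr (_ * _).
have -> : (e i + k + b = (e i + (k - 1) + b).+1)%N by lia.
rewrite mu_rec natrD mulrDl; congr (_ + _ + _ * mu _); last by lia.
  have [eik|] := posnP (e i + (k - 1)); first by rewrite eik !mul0r.
  by move=> ?; congr (_ * mu _); lia.
have [->|?] := posnP b; first by rewrite !mul0r.
by congr (_ * mu _); lia.
Qed.

Definition correlator (ks : seq nat) : A := psum_ops ks hankel (staircase N).

Lemma psum_hankel_minor k e f :
  psum_op k (hankel_minor e) f = psum_op k (hankel_minor^~ f) e.
Proof. by rewrite /psum_op hankel_minor_psum. Qed.

Lemma virasoro_hankel k e : (0 < k)%N ->
  2%:R * psum_op k hankel e =
    2%:R * virasoro_op k hankel e
    + \sum_(0 <= a < k - 1) psum_op a (psum_op (k - 2 - a) hankel) e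
    + (k - 1)%:R * psum_op (k - 2) hankel e
    + 12%:R * s * psum_op (k + 4) hankel e.
Proof.
move=> k_gt0; rewrite hankel_by_parts //.
have colsE : virasoro_op k (hankel_minor e) (staircase N) *+ 2
    + psum_op (k - 2) hankel e *+ (k - 1)
    = \sum_(0 <= a < k - 1) psum_op a (psum_op (k - 2 - a) hankel) e.
  have altD : alternates (hankel_minor e).
    move=> f i j neq_ij; rewrite ![hankel_minor e _]hankel_minor_sym.
    exact: hankel_minor_alternates.
  have := virasoro_staircase double_inj k_gt0 altD.
  rewrite psum_hankel_minor => ->; apply: eq_bigr => a _.
  rewrite [RHS](congr1 (@^~ e) (psum_opC _ _ _)) [LHS]/psum_op [RHS]/psum_op.
  under eq_bigr do rewrite psum_hankel_minor.
  under [RHS]eq_bigr do rewrite -(psum_hankel_minor _ _ (staircase N)).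
  by rewrite exchange_big.
rewrite -colsE; have -> : \sum_i (e i + (k - 1))%:R * hankel (lower2_at e i k)
    = virasoro_op k hankel e + (k - 1)%:R * psum_op (k - 2) hankel e.
  under eq_bigr do rewrite natrD mulrDl; rewrite big_split /= -mulr_sumr.
  congr (_ + _); have [->|k1_gt0] := posnP (k - 1); first by rewrite !mul0r.
  congr (_ * _); apply: eq_bigr => i _; congr hankel; apply/ffunP => l.
  by rewrite !ffunE; case: ifP => //; lia.
rewrite -[_ *+ (k - 1)]mulr_natl; ring.
Qed.

(** Apply [psum_ops ks] to [virasoro_hankel]. Half of the splitting sum is already there, coming
    from the columns; the other half comes from [virasoro_staircase] on the row side, after the
    vector field has been moved past [ks] at the price of the merging terms. Everything is thus
    doubled until [double_inj] is used. *)
Lemma loop_equation k ks : (0 < k)%N ->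
  correlator (k :: ks) =
    \sum_(0 <= a < k - 1) correlator [:: a, (k - 2 - a)%N & ks]
    + \sum_(0 <= n < size ks) (nth 0%N ks n)%:R * correlator (merge_at ks n k)
    + 6%:R * s * correlator ((k + 4)%N :: ks).
Proof.
move=> k_gt0; apply/eqP; rewrite -subr_eq0; apply/eqP/double_inj.
rewrite -mulr2n -[_ *+ 2]mulr_natl mulrBr; apply/eqP; rewrite subr_eq0; apply/eqP.
have /(congr1 (fun F => psum_ops ks F (staircase N))) :=
  funext (fun e => virasoro_hankel e k_gt0).
rewrite psum_opsZ psum_ops_op => ->; rewrite !psum_opsD !psum_opsZ.
rewrite (psum_ops_sum ks (index_iota 0 (k - 1))) psums_virasoro //.
rewrite !psum_ops_op.
have := virasoro_staircase double_inj k_gt0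
  (alternates_psums ks (hankel_minor_alternates (staircase N))).
rewrite -[_ *+ 2]mulr_natl -[_ *+ (k - 1)]mulr_natl => vir.
rewrite mulrDr !mulrDr.
have -> : \sum_(0 <= a < k - 1)
    psum_ops ks (psum_op a (psum_op (k - 2 - a) hankel)) (staircase N) =
    \sum_(0 <= a < k - 1) correlator [:: a, (k - 2 - a)%N & ks].
  apply: eq_bigr => a _; by rewrite psum_ops_op /= psum_ops_op.
rewrite [X in X = _](_ : _ = (2%:R * virasoro_op k (psum_ops ks hankel) (staircase N)
  + (k - 1)%:R * correlator ((k - 2)%N :: ks)) + 
  (2%:R * (\sum_(0 <= n < size ks) (nth 0%N ks n)%:R * correlator (merge_at ks n k))
  + \sum_(0 <= a < k - 1) correlator [:: a, (k - 2 - a)%N & ks]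
  + 12%:R * s * correlator ((k + 4)%N :: ks))).
  by rewrite [X in X + _]vir /correlator /=; ring.
by rewrite /correlator /=; ring.
Qed.

End LoopEquation.

(** * How a transposition merges or splits the cycles of a permutation *)

Section OrbitSurgery.
Variable T : finType.
Implicit Types (s m : {perm T}) (x y z : T) (C : {set T}).

Definition stable s C := [forall x in C, s x \in C].

Lemma stableP s C : reflect {in C, forall x, s x \in C} (stable s C).
Proof. exact: forall_inP. Qed.

Lemma mem_porbit_iter s x i : iter i s x \in porbit s x.
Proof. by rewrite -permX mem_porbit. Qed.

Lemma stable_iter s C x i : stable s C -> x \in C -> iter i s x \in C.
Proof. by move=> /stableP stC xC; elim: i => //= i; apply: stC. Qed.

Lemma stable_porbit s C x : stable s C -> x \in C -> porbit s x \subset C.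
Proof.
move=> stC xC; apply/subsetP => y /porbitP[i ->].
by rewrite permX; apply: stable_iter.
Qed.

Lemma porbit_stable s x : stable s (porbit s x).
Proof.
apply/stableP => y; rewrite ![_ \in porbit s x]porbit_sym => xy.
by have := porbit_perm s 1 y; rewrite expg1 => ->.
Qed.

Lemma porbit_eq s x y : y \in porbit s x -> porbit s y = porbit s x.
Proof. by move=> yx; apply/eqP; rewrite eq_porbit_mem. Qed.

Lemma stable_perm s C x : stable s C -> (s x \in C) = (x \in C).
Proof.
move=> stC; apply/idP/idP => [sxC|]; last exact: (stableP _ _ stC).
apply: (subsetP (stable_porbit stC sxC)); rewrite porbit_sym.
exact: (mem_porbit_iter s x 1).
Qed.

Lemma porbit_iter_inj s x i j : (i < #|porbit s x|)%N -> (j < #|porbit s x|)%N ->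
  iter i s x = iter j s x -> i = j.
Proof.
move=> lti ltj eq_ij; apply/eqP.
rewrite -(nth_uniq x _ _ (uniq_traject_porbit s x)) ?size_traject //.
by rewrite !nth_traject // eq_ij.
Qed.

(** The product sends [y] to [s x] and then agrees with [s] until it meets [x] or [y]. *)
Lemma iter_tperm_mul s x y i : (0 < i)%N ->
    (forall l, (0 < l < i)%N -> iter l s x != x /\ iter l s x != y) ->
  iter i (tperm x y * s)%g y = iter i s x.
Proof.
elim: i => // -[|i] IHi _ avoid; first by rewrite /= permM tpermR.
rewrite iterS IHi // => [|l ltl]; last by apply: avoid; lia.
have [ne_x ne_y] := avoid i.+1 (leqnn _).
by rewrite permM tpermD 1?eq_sym.
Qed.

Lemma porbit_tperm_off s x y z : z \notin porbit s x -> z \notin porbit s y ->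
  porbit (tperm x y * s)%g z = porbit s z.
Proof.
move=> zx zy; have iterE i : iter i (tperm x y * s)%g z = iter i s z.
  elim: i => //= i ->; rewrite permM tpermD //.
    by apply: contraNneq zx => ->; rewrite porbit_sym mem_porbit_iter.
  by apply: contraNneq zy => ->; rewrite porbit_sym mem_porbit_iter.
apply/setP => u; apply/porbitP/porbitP => -[i ->]; exists i.
  by rewrite !permX iterE.
by rewrite !permX iterE.
Qed.

Lemma porbit_merge_sub s x y : y \notin porbit s x ->
  porbit s x \subset porbit (tperm x y * s)%g y.
Proof.
move=> yx; set n := #|porbit s x|.
have n_gt0 : (0 < n)%N by rewrite lt0n card_porbit_neq0.
have iterE i : (0 < i <= n)%N -> iter i (tperm x y * s)%g y = iter i s x.
  move=> /andP[i_gt0 le_in]; apply: iter_tperm_mul => // l /andP[l_gt0 lt_li].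
  split; last by apply: contraNneq yx => <-; apply: mem_porbit_iter.
  apply/eqP => /(@porbit_iter_inj s x l 0); rewrite -/n => eql; have := eql; lia.
apply/subsetP => u; rewrite porbit_traject => /trajectP[i lt_in ->].
case: (posnP i) => [->|i_gt0]; last by rewrite -iterE ?mem_porbit_iter //; lia.
rewrite /= -[X in X \in _](iter_porbit s x) -/n -iterE ?mem_porbit_iter //; lia.
Qed.

(** Entering at [y], the new cycle runs through the whole old cycle of [x], and conversely; the
    union of the two old cycles is stable, so nothing else is added. *)
Lemma porbit_merge s x y : y \notin porbit s x ->
  porbit (tperm x y * s)%g x = porbit s x :|: porbit s y.
Proof.
move=> yx; have xy : x \notin porbit s y by rewrite porbit_sym.
have sub_y := porbit_merge_sub yx; have := porbit_merge_sub xy.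
rewrite tpermC => sub_x; have eq_xy : porbit (tperm x y * s)%g y =
    porbit (tperm x y * s)%g x.
  by apply: porbit_eq; apply: (subsetP sub_x); rewrite porbit_id.
apply/eqP; rewrite eqEsubset subUset -{2}eq_xy sub_x sub_y !andbT.
apply: stable_porbit; last by rewrite inE porbit_id.
apply/stableP => u; rewrite permM !inE.
have stx := porbit_stable s x; have sty := porbit_stable s y.
by case: tpermP => [->|->|_ _]; rewrite !(stable_perm _ stx) !(stable_perm _ sty)
  ?porbit_id ?orbT.
Qed.

(** With y = s ^ i x, the product jumps from [y] back to [s x] and follows [s] up to [y] again,
    closing the cycle after [i] steps. *)
Lemma porbit_split s x i : (0 < i < #|porbit s x|)%N ->
  porbit (tperm x (iter i s x) * s)%g (iter i s x) = [set z in traject s (s x) i].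
Proof.
move=> /andP[i_gt0 lt_in]; set y := iter i s x; set t := (_ * s)%g.
have iterE l : (0 < l <= i)%N -> iter l t y = iter l s x.
  move=> /andP[l_gt0 le_li]; apply: iter_tperm_mul => // k /andP[k_gt0 lt_kl].
  split; apply/eqP.
    move/(@porbit_iter_inj s x k 0) => eqk; have := eqk; lia.
  move/(@porbit_iter_inj s x k i) => eqk; have := eqk; lia.
apply/setP => u; rewrite inE; apply/idP/idP => [|/trajectP[l lt_li ->]]; last first.
  by rewrite -iterSr -iterE ?mem_porbit_iter.
have sub : porbit t y \subset [set z in traject s (s x) i].
  apply: stable_porbit; last first.
    rewrite inE; apply/trajectP; exists i.-1; rewrite -?iterSr prednK //.
  apply/stableP => z; rewrite !inE => /trajectP[l lt_li ->].
  rewrite -iterSr -iterE // -iterS.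
  case: (ltnP l.+1 i) => [lt_li'|le_il].
    by rewrite iterE //; apply/trajectP; exists l.+1; rewrite // -iterSr.
  have -> : l.+1 = i by lia.
  rewrite iterS iterE ?leqnn ?i_gt0 // -/y permM tpermR.
  by apply/trajectP; exists 0%N.
by move=> /(subsetP sub); rewrite inE.
Qed.

End OrbitSurgery.

Section OrbitSplit.
Variable T : finType.
Implicit Types (s m : {perm T}) (x y z : T) (S : {set T}).

Lemma porbit_split_partition s x y : y \in porbit s x -> y != x ->
  let t := (tperm x y * s)%g in
  porbit t x :|: porbit t y = porbit s x /\ [disjoint porbit t x & porbit t y].
Proof.
rewrite porbit_traject => /trajectP[i lt_in def_y] neq_yx t.
set n := #|porbit s x| in lt_in.
have i_gt0 : (0 < i)%N by case: i def_y {lt_in} neq_yx => // ->; rewrite eqxx.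
have def_c : porbit s y = porbit s x by rewrite def_y; apply/porbit_eq/mem_porbit_iter.
(* The situation is symmetric: [x] lies [n - i] steps after [y], so [porbit_split] also describes
   the other new cycle. *)
have def_x : x = iter (n - i) s y.
  by rewrite def_y -iterD subnK ?iter_porbit // ltnW.
have ty : porbit t y = [set z in traject s (s x) i].
  by rewrite /t def_y porbit_split ?i_gt0.
have tx : porbit t x = [set z in traject s (s y) (n - i)].
  rewrite /t tpermC {1 2}def_x porbit_split // def_c -/n; lia.
have trajE : traject s (s x) n = traject s (s x) i ++ traject s (s y) (n - i).
  by rewrite -{1}(subnKC (ltnW lt_in)) trajectD -iterSr iterS -def_y.
have csx : porbit s (s x) = porbit s x by apply/porbit_eq/(mem_porbit_iter s x 1).
split.
  apply/setP => z; rewrite tx ty -csx porbit_traject csx -/n trajE !inE mem_cat.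
  by rewrite orbC.
have := uniq_traject_porbit s (s x); rewrite csx -/n trajE cat_uniq.
case/and3P => _ /hasPn disj _; rewrite disjoint_subset; apply/subsetP => z.
by rewrite tx ty !inE => /disj.
Qed.

Lemma index_filter_mem S (l : seq T) y : y \in S ->
  index y [seq z <- l | z \in S] = count [in S] (take (index y l) l).
Proof.
move=> yS; elim: l => //= z l IHl; case: (eqVneq z y) => [->|ne].
  by rewrite yS /= eqxx.
by case: ifP => zS //=; rewrite ?zS ?(negPf ne) IHl.
Qed.

Lemma card_split_orbit s S x y : y \in porbit s x -> y != x ->
  y \in S -> x \in S ->
  let t := (tperm x y * s)%g in
  #|porbit t y :&: (S :\ x :\ y)| =
    index y [seq z <- traject s (s x) #|porbit s x|.-1 | z \in S].
Proof.
move=> yc neq_yx yS xS t; rewrite index_filter_mem //.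
have n_gt0 : (0 < #|porbit s x|)%N by rewrite lt0n card_porbit_neq0.
have : uniq (traject s x #|porbit s x|) by apply: uniq_traject_porbit.
have yL : y \in traject s (s x) #|porbit s x|.-1.
  by move: yc; rewrite porbit_traject -(prednK n_gt0) /= inE (negPf neq_yx).
rewrite -{1}(prednK n_gt0) /=; set L := traject _ _ _ in yL * => /andP[xL uL].
have ltL : (index y L < #|porbit s x|.-1)%N.
  by rewrite -[X in (_ < X)%N](size_traject s (s x)) index_mem.
set i' := index y L in ltL *.
have def_y : y = iter i'.+1 s x.
  by rewrite -(nth_index (s x) yL) nth_traject // iterSr.
have ty : porbit t y = [set z in rcons (take i' L) y].
  rewrite /t def_y porbit_split; last by lia.
  by rewrite take_traject ?trajectSr -?iterSr // ltnW.
rewrite ty -size_filter -(card_uniqP (filter_uniq _ (take_uniq _ uL))).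
apply: eq_card => z; rewrite !inE mem_rcons mem_filter inE.
case: (eqVneq z y) => [->|_] /=; first by rewrite in_take // ltnn andbF.
case: (eqVneq z x) => [->|_] /=; last by rewrite andbC.
by rewrite andbF; apply/esym/negbTE; apply: contra xL => /andP[_ /mem_take].
Qed.

(** If [y] is at position [a] among the marked elements met after [x], its new cycle keeps the [a]
    marked elements before it and the other one keeps the rest. As [y] varies, [a] takes each value
    once. *)
Lemma sum_split_orbit (A : nmodType) (g : nat -> nat -> A) s S x : x \in S ->
  \sum_(y in porbit s x :&: S :\ x)
     g #|porbit (tperm x y * s)%g y :&: (S :\ x :\ y)|
       #|porbit (tperm x y * s)%g x :&: (S :\ x :\ y)|
  = \sum_(0 <= a < #|porbit s x :&: S| - 1) g a (#|porbit s x :&: S| - 2 - a)%N.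
Proof.
move=> xS; set k := #|_ :&: S|.
pose LS := [seq z <- traject s (s x) #|porbit s x|.-1 | z \in S].
have n_gt0 : (0 < #|porbit s x|)%N by rewrite lt0n card_porbit_neq0.
have /= := uniq_traject_porbit s x; rewrite -{1}(prednK n_gt0) /= => /andP[xL uL].
have memLS : LS =i porbit s x :&: S :\ x.
  move=> z; rewrite mem_filter !inE porbit_traject -{2}(prednK n_gt0) /= inE.
  case: (eqVneq z x) => [->|_] /=; first by rewrite (negPf xL) andbF.
  by rewrite andbC.
have uLS : uniq LS by apply: filter_uniq.
have sizeLS : size LS = (k - 1)%N.
  rewrite -(card_uniqP uLS) (eq_card memLS) /k (cardsD1 x (_ :&: S)) !inE porbit_id xS.
  by rewrite add1n subn1.
transitivity (\sum_(y <- LS) g (index y LS) (k - 2 - index y LS)%N).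
  rewrite (big_uniq _ uLS) /=; rewrite (eq_bigl _ _ memLS).
  apply: eq_bigr => y; rewrite !inE => /and3P[neq_yx yc yS].
  rewrite card_split_orbit // -/LS; congr g.
  have [tU tD] := porbit_split_partition yc neq_yx.
  have <- : #|porbit (tperm x y * s)%g y :&: (S :\ x :\ y)| = index y LS.
    by rewrite card_split_orbit.
  have -> : k = (#|porbit s x :&: (S :\ x :\ y)| + 2)%N.
    rewrite /k (cardsD1 x) !inE porbit_id xS (cardsD1 y) !inE neq_yx yc yS.
    rewrite addnA addnC; congr (_ + _)%N; apply: eq_card => z; rewrite !inE.
    by do !case: (_ == _) => //=; rewrite ?andbF.
  rewrite addnK -tU setIUl cardsU setIACA (disjoint_setI0 tD) set0I.
  by rewrite cards0 subn0 addnK.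
rewrite (big_nth x) sizeLS; apply: eq_big_nat => a /andP[_ lt_a].
by rewrite index_uniq // sizeLS.
Qed.

End OrbitSplit.

(** * Deleting edges at an explored vertex *)

Section Exploration.
Variable H : finType.
Implicit Types (s m rho : {perm H}) (x y h : H) (S K C c d : {set H}).

Lemma stable_tperm s x y C : x \in C -> y \in C ->
  stable (tperm x y * s)%g C = stable s C.
Proof.
move=> xC yC; have tC z : (tperm x y z \in C) = (z \in C).
  by case: tpermP => [->|->|] //; rewrite xC yC.
apply/stableP/stableP => stC z zC; last by rewrite permM stC ?tC.
by rewrite -(tpermK x y z) -permM stC ?tC.
Qed.

(** A matching of [S] is extended by the identity to all of [H], so that deleting an edge does not
    change the type. *)
Definition pairings S : {set {perm H}} :=
  [set m : {perm H} | [forall x, (m (m x) == x) && ((m x != x) == (x \in S))]].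

Lemma pairingsP S m :
  reflect ((forall x, m (m x) = x) /\ (forall x, (m x != x) = (x \in S)))
          (m \in pairings S).
Proof.
rewrite inE; apply: (iffP forallP) => [ok|[invol supp] x].
  by split=> x; have /andP[/eqP ? /eqP ?] := ok x.
by rewrite invol supp !eqxx.
Qed.

Lemma pairings_tperm S m x y : x \in S -> y \in S -> x != y ->
  ((tperm x y * m)%g \in pairings S) && ((tperm x y * m)%g x == y)
  = (m \in pairings (S :\ x :\ y)).
Proof.
move=> xS yS neq_xy; apply/andP/idP => [[/pairingsP[invol supp] /eqP tm_x]|].
  have my : m y = y by move: tm_x; rewrite permM tpermL.
  have mx : m x = x by have := invol x; rewrite tm_x permM tpermR.
  have mE z : z != x -> z != y -> m z = (tperm x y * m)%g z.
    by move=> zx zy; rewrite permM tpermD 1?eq_sym.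
  apply/pairingsP; split=> z; rewrite ?inE;
      case: (eqVneq z y) => [->|neq_zy] /=; rewrite ?my ?eqxx //;
      case: (eqVneq z x) => [->|neq_zx] /=; rewrite ?mx ?eqxx //.
    have mzx : m z != x by rewrite -mx (inj_eq perm_inj).
    have mzy : m z != y by rewrite -my (inj_eq perm_inj).
    by rewrite (mE (m z)) // mE.
  by rewrite mE // supp.
move=> /pairingsP[invol supp].
have my : m y = y by apply/eqP/negbNE; rewrite supp !inE eqxx.
have mx : m x = x by apply/eqP/negbNE; rewrite supp !inE eqxx andbF.
rewrite permM tpermL my; split=> //; apply/pairingsP; split=> z; rewrite !permM.
  case: (tpermP x y z) => [->|->|/eqP zx /eqP zy]; rewrite ?my ?mx ?tpermL ?tpermR //.
  have mzx : m z != x by rewrite -mx (inj_eq perm_inj).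
  have mzy : m z != y by rewrite -my (inj_eq perm_inj).
  by rewrite tpermD 1?eq_sym.
case: (tpermP x y z) => [->|->|/eqP zx /eqP zy]; rewrite ?my ?mx ?xS ?yS //.
  by rewrite eq_sym.
by rewrite supp !inE zx zy.
Qed.

(* Every vertex, that is cycle of [rho], is connected by edges of [m] to the
   set [K] of the half-edges already explored. *)
Definition reaches rho m K :=
  [forall C : {set H}, [&& K \subset C, stable rho C & stable m C] ==> (C == setT)].

(** The deleted edge made the vertex of [y] reachable, so that vertex must join the explored set.
    For sets containing both [x] and [y] the transposition affects neither stability condition. *)
Lemma reaches_tperm rho m K x y : x \in K -> m y = y ->
  reaches rho (tperm x y * m)%g K
  = reaches (tperm x y * rho)%g m (K :|: porbit rho y).
Proof.
move=> xK my; apply: eq_forallb => C; congr (_ ==> _).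
apply/and3P/and3P => -[KC strho stm].
  have xC := subsetP KC _ xK.
  have yC : y \in C by have := stableP _ _ stm _ xC; rewrite permM tpermL my.
  rewrite stable_tperm // in stm; rewrite stable_tperm // subUset KC.
  by rewrite stable_porbit.
move: KC; rewrite subUset => /andP[KC /subsetP/(_ _ (porbit_id _ _)) yC].
have xC := subsetP KC _ xK.
by rewrite stable_tperm // in strho; rewrite stable_tperm.
Qed.

Definition explored_sum (R : nzRingType) (q : R) rho S K : R :=
  \sum_(m in pairings S | reaches rho m K) q ^+ #|porbits (m * rho)%g|.

(** Sort the matchings by the partner [y] of [x] and delete that edge. The remaining matching fixes
    [x] and [y], hence commutes with [tperm x y]; the transposition can be passed from the matching
    to the rotation, and the face permutation is unchanged. *)
Lemma explored_sum_step (R : nzRingType) (q : R) rho S K x :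
    x \in K -> x \in S ->
  explored_sum q rho S K = \sum_(y in S :\ x)
    explored_sum q (tperm x y * rho)%g (S :\ x :\ y) (K :|: porbit rho y).
Proof.
move=> xK xS; rewrite /explored_sum.
rewrite (partition_big (fun m : {perm H} => m x) [in S :\ x]) => [|m]; last first.
  move=> /andP[/pairingsP[invol supp] _] /=.
  by rewrite !inE supp xS -supp invol eq_sym supp xS.
apply: eq_bigr => y; rewrite !inE => /andP[neq_yx yS].
rewrite (reindex_inj (mulgI (tperm x y))) /=.
apply: eq_big => [m|m /andP[/andP[mS _] tmx]].
  rewrite andbAC pairings_tperm //; last by rewrite eq_sym.
  apply: andb_id2l => /pairingsP[_ supp]; rewrite reaches_tperm //.
  by apply/eqP/negbNE; rewrite supp !inE eqxx.
have : m \in pairings (S :\ x :\ y) by rewrite -pairings_tperm ?mS // eq_sym.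
move=> /pairingsP[_ supp]; rewrite mulgA; congr (_ ^+ #|porbits (_ * _)%g|).
have my : m y = y by apply/eqP/negbNE; rewrite supp !inE eqxx.
have mx : m x = x by apply/eqP/negbNE; rewrite supp !inE eqxx andbF.
by rewrite conjgC tpermJ mx my.
Qed.

Definition cycles_in rho K := [set c in porbits rho | c \subset K].

Lemma mem_cycles_in rho K x : stable rho K ->
  (porbit rho x \in cycles_in rho K) = (x \in K).
Proof.
move=> stK; rewrite inE imset_f //=; apply/idP/idP => [/subsetP|].
  by apply; apply: porbit_id.
exact: stable_porbit.
Qed.

Lemma cycles_inP rho K c : stable rho K ->
  reflect (exists2 x, x \in K & c = porbit rho x) (c \in cycles_in rho K).
Proof.
move=> stK; apply: (iffP idP) => [|[x xK ->]]; last by rewrite mem_cycles_in.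
rewrite inE => /andP[/imsetP[x _ ->] sub]; exists x => //.
by apply: (subsetP sub); apply: porbit_id.
Qed.

Lemma cycles_in_split rho K x y : stable rho K -> x \in K ->
    y \in porbit rho x -> y != x ->
  let t := (tperm x y * rho)%g in
  cycles_in t K = porbit t y |: (porbit t x |: (cycles_in rho K :\ porbit rho x)).
Proof.
move=> stK xK yc neq_yx t.
have yK : y \in K by apply: (subsetP (stable_porbit stK xK)).
have stK' : stable t K by rewrite stable_tperm.
have [tU tD] := porbit_split_partition yc neq_yx.
have off z : z \notin porbit rho x -> porbit t z = porbit rho z.
  by move=> zx; rewrite porbit_tperm_off ?(porbit_eq yc).
apply/setP => c; apply/cycles_inP/idP => // [[z zK ->]|].
  rewrite !inE; case: (boolP (z \in porbit rho x)) => [|zx].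
    by rewrite -tU inE => /orP[] /porbit_eq ->; rewrite eqxx ?orbT.
  rewrite off // imset_f // stable_porbit // andbT eq_porbit_mem zx.
  by rewrite !orbT.
case/setU1P=> [->|/setU1P[->|]]; [by exists y|by exists x|].
case/setD1P=> neq_c /cycles_inP -/(_ stK) [z zK def_c]; exists z => //.
by rewrite off // -eq_porbit_mem -def_c.
Qed.

Lemma cycles_in_merge rho K x y : stable rho K -> x \in K ->
    y \notin porbit rho x ->
  cycles_in (tperm x y * rho)%g (K :|: porbit rho y) =
  (porbit rho x :|: porbit rho y)
    |: (cycles_in rho K :\ porbit rho x :\ porbit rho y).
Proof.
move=> stK xK yx; set t := (_ * rho)%g.
have stKy : stable rho (K :|: porbit rho y).
  apply/stableP => z; rewrite !inE (stable_perm _ stK).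
  by rewrite (stable_perm _ (porbit_stable _ _)).
have stK' : stable t (K :|: porbit rho y).
  by rewrite stable_tperm // inE ?xK ?porbit_id ?orbT.
have tx := porbit_merge yx; rewrite -/t in tx.
have off z : z \notin porbit rho x -> z \notin porbit rho y ->
    porbit t z = porbit rho z by apply: porbit_tperm_off.
apply/setP => c; apply/cycles_inP/idP => // [[z zK ->]|].
  rewrite !inE; case: (boolP (z \in porbit t x)) => [zt|].
    by rewrite (porbit_eq zt) tx eqxx.
  rewrite tx inE negb_or => /andP[zx zy]; rewrite off // !eq_porbit_mem zx zy.
  rewrite imset_f // stable_porbit ?orbT //.
  by move: zK; rewrite inE (negPf zy) orbF.
case/setU1P=> [->|]; first by exists x; rewrite // inE xK.
case/setD1P=> neq_y /setD1P[neq_x /cycles_inP -/(_ stK) [z zK def_c]].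
exists z; first by rewrite inE zK.
by rewrite off // -eq_porbit_mem -def_c.
Qed.

End Exploration.

(** * The loop equations compute the weighted sum over matchings *)

Section ExplorationSum.
Variables (H : finType) (R : comNzRingType) (q : R) (E : seq nat -> fps R).
Hypothesis E_nil : E [::] = 1.
Hypothesis E_perm : forall ks ls, perm_eq ks ls -> E ks = E ls.
Hypothesis E_zero : forall ks, E (0%N :: ks) = fpsC q * E ks.
Hypothesis E_loop : forall k ks, (0 < k)%N ->
  E (k :: ks) = \sum_(0 <= a < k - 1) E [:: a, (k - 2 - a)%N & ks]
    + \sum_(0 <= n < size ks) (nth 0%N ks n)%:R * E (merge_at ks n k)
    + 6%:R * fpsX R * E ((k + 4)%N :: ks).
Implicit Types (rho : {perm H}) (x y : H) (S K c d : {set H}) (X : {set {set H}}).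

(** The numbers of half-edges still unmatched at the vertices in [X]; the exploration sum turns out
    to depend on nothing else of the explored part. *)
Definition degrees S X := [seq #|c :&: S| | c <- enum X].

Lemma degrees_setU1 S X c : c \notin X ->
  perm_eq (degrees S (c |: X)) (#|c :&: S| :: degrees S X).
Proof.
move=> cX; rewrite -[_ :: _]/(map (fun d => #|d :&: S|) (c :: enum X)).
apply: perm_map; apply: uniq_perm; rewrite /= ?enum_uniq ?mem_enum ?cX //.
by move=> d; rewrite mem_enum !inE mem_enum.
Qed.

Lemma degrees_setD1 S X c : c \in X ->
  perm_eq (degrees S X) (#|c :&: S| :: degrees S (X :\ c)).
Proof.
move=> cX; rewrite -{1}(setD1K cX) perm_sym; rewrite perm_sym.
by apply: degrees_setU1; rewrite !inE eqxx.
Qed.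

Lemma degrees_eq S S' X : (forall c, c \in X -> c :&: S = c :&: S') ->
  degrees S X = degrees S' X.
Proof.
by move=> eqS; apply/eq_in_map => c; rewrite mem_enum => /eqS ->.
Qed.

Lemma perm_set_nth (r : seq nat) n v : (n < size r)%N ->
  perm_eq (nth 0%N r n :: set_nth 0%N r n v) (v :: r).
Proof.
elim: r n => // w r IHr [|n] lt_n /=; apply/seq.permP => a /=; first by lia.
by have /seq.permP/(_ a) /= := IHr n lt_n; lia.
Qed.

Lemma sum_merge_degrees S X k :
  \sum_(0 <= n < size (degrees S X))
     (nth 0%N (degrees S X) n)%:R * E (merge_at (degrees S X) n k)
  = \sum_(d in X) #|d :&: S|%:R * E ((#|d :&: S| + k - 2)%N :: degrees S (X :\ d)).
Proof.
rewrite -[in RHS]big_enum (big_nth set0) size_map; apply: eq_big_nat => n /andP[_ ltn].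
have nthE : nth 0%N (degrees S X) n = #|nth set0 (enum X) n :&: S|.
  by rewrite (nth_map set0).
set d : {set H} := nth set0 (enum X) n in nthE *.
rewrite nthE; congr (_ * _); apply: E_perm.
have dX : d \in X by rewrite -mem_enum mem_nth.
rewrite /merge_at nthE -(perm_cons #|d :&: S|) -{1}nthE.
rewrite (perm_trans (perm_set_nth _ _)) ?size_map //.
have /seq.permP eqd := degrees_setD1 S dX.
apply/seq.permP => a; by rewrite /= eqd /= addnCA.
Qed.

(** No unmatched half-edge is left in [K]. If [K] is everything, only the empty matching remains and
    the faces are the cycles of [rho]. Otherwise the rest cannot be reached and the sum is 0, as is
    a coefficient of positive index of a constant series. *)
Lemma explored_sum_base rho S K (n : nat) : stable rho K ->
    (forall x, x \in K -> x \notin S) -> (forall x, x \notin K -> x \in S) ->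
    #|~: K| = (6 * n)%N ->
  explored_sum q rho S K = n`!%:R * E (degrees S (cycles_in rho K)) n.
Proof.
move=> stK KS SK cardK.
have -> : degrees S (cycles_in rho K) = nseq #|cycles_in rho K| 0%N.
  rewrite /degrees cardE; have : {in enum (cycles_in rho K), forall c, #|c :&: S| = 0%N}.
    move=> c; rewrite mem_enum inE => /andP[_ /subsetP cK].
    apply/eqP; rewrite cards_eq0; apply/eqP/setP => x; rewrite !inE.
    by apply/andP => -[/cK /KS /negPf ->].
  by elim: (enum _) => //= c l IHl cl; rewrite cl ?mem_head // IHl // => d dl;
     apply: cl; rewrite inE dl orbT.
have -> p : E (nseq p 0%N) = fpsC (q ^+ p).
  by elim: p => [|p IHp] /=; rewrite ?rmorph1 // E_zero IHp -rmorphM exprS.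
have [KT|neqK] := eqVneq K setT.
  have -> : n = 0%N.
    by move: cardK; rewrite KT setCT cards0; case: n => // n; lia.
  rewrite mul1r /fpsC mul1r /explored_sum (big_pred1 1%g) => [|m].
    rewrite mul1g; congr (_ ^+ #|pred_of_set _|); apply/setP => c; rewrite inE KT subsetT.
    by rewrite andbT.
  rewrite /=; apply/andP/eqP => [[/pairingsP[_ supp] _]|->].
    apply/permP => x; rewrite perm1; apply/eqP/negbNE; rewrite supp.
    by rewrite KS // KT inE.
  split; last by apply/forallP => C; apply/implyP => /andP[]; rewrite KT subTset.
  by apply/pairingsP; split=> x; rewrite !perm1 // eqxx (negPf (KS x _)) ?KT.
rewrite /explored_sum big_pred0 => [|m].
  case: n cardK => [|n _]; last by rewrite /fpsC mul0r mulr0.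
  move/eqP; rewrite muln0 cards_eq0 => /eqP /(congr1 (@setC H)).
  by rewrite setCK setC0 => KT; rewrite KT eqxx in neqK.
apply/negP => /andP[/pairingsP[_ supp] /forallP/(_ K)].
rewrite subxx stK (negPf neqK) implybF => /negP; apply; apply/stableP => x xK.
have /eqP -> // : m x == x by apply/negbNE; rewrite supp KS.
Qed.

(** Induction on the number of unmatched half-edges. The partners of one unmatched [x] in [K], at a
    vertex of degree [k], correspond to the terms of [E_loop]: a partner at the same vertex splits
    it, one at another explored vertex merges the two, and one at a fresh vertex brings in six
    half-edges and uses up two, which gives [k + 4]. *)
Lemma explored_sumE rho S K (n : nat) : stable rho K ->
    (forall x, x \notin K -> x \in S /\ #|porbit rho x| = 6%N) ->
    #|~: K| = (6 * n)%N ->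
  explored_sum q rho S K = n`!%:R * E (degrees S (cycles_in rho K)) n.
Proof.
have [p] := ubnP #|S|; elim: p rho S K n => // p IHp rho S K n ltSp stK SK cardK.
have [/exists_inP[x xK xS]|/exists_inPn noKS] := boolP [exists x in K, x \in S]; last first.
  by apply: explored_sum_base => // x /SK[].
rewrite (explored_sum_step q rho xK xS).
set c := porbit rho x; pose X := cycles_in rho K :\ c.
have cX : c \in cycles_in rho K by rewrite mem_cycles_in.
set k := #|c :&: S|; have k_gt0 : (0 < k)%N.
  by rewrite card_gt0; apply/set0Pn; exists x; rewrite inE porbit_id.
rewrite (E_perm (degrees_setD1 _ cX)) -/X -/k E_loop // sum_merge_degrees.
rewrite !fpsD !mulrDr (bigID [in c]) /= -addrA.
have cK : c \subset K by apply: stable_porbit.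
have ltS2 y : y \in S :\ x -> (#|S :\ x :\ y| < p)%N.
  move=> yS; move: ltSp; rewrite (cardsD1 x) xS (cardsD1 y (S :\ x)) yS; lia.
have avoid (y : H) d : d \in X -> y \in c -> y \notin d.
  move=> /setD1P[neq_d /cycles_inP-/(_ stK)[z _ def_d]] yc.
  apply: contra neq_d; rewrite def_d => /porbit_eq <-; apply/eqP.
  exact: porbit_eq.
have SX y d : d \in X -> y \notin d -> d :&: (S :\ x :\ y) = d :&: S.
  move=> dX yd; apply/setP => z; rewrite !inE; case: (eqVneq z y) => [->|_] /=.
    by rewrite (negPf yd).
  by case: (eqVneq z x) => [->|_] //=; rewrite (negPf (avoid _ _ dX _)) ?porbit_id.
have mergedS y : y \in S :\ x -> y \notin c ->
    perm_eq (degrees (S :\ x :\ y)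
              (cycles_in (tperm x y * rho)%g (K :|: porbit rho y)))
            ((#|porbit rho y :&: S| + k - 2)%N :: degrees S (X :\ porbit rho y)).
  move=> ySx yc; set d := porbit rho y; have [neq_yx yS] := setD1P ySx.
  rewrite cycles_in_merge // -/c -/d -/X; have cdX : c :|: d \notin X :\ d.
    apply/negP => /setD1P[_ /avoid/(_ (porbit_id rho x))].
    by rewrite inE porbit_id.
  apply: perm_trans (degrees_setU1 _ cdX) _.
  rewrite (@degrees_eq _ S) => [|e /setD1P[neq_e eX]]; last first.
    apply: SX => //; apply: contra neq_e.
    have /setD1P[_ /cycles_inP-/(_ stK)[z _ ->]] := eX.
    by move/porbit_eq => <-.
  suff -> : #|(c :|: d) :&: (S :\ x :\ y)| = (#|d :&: S| + k - 2)%N by rewrite perm_refl.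
  have -> : (#|d :&: S| + k = #|(c :|: d) :&: S|)%N.
    rewrite addnC setIUl cardsU.
    rewrite [X in (_ - #|pred_of_set X|)%N](_ : _ = set0) ?cards0 ?subn0 //.
    apply/setP => z; rewrite !inE; apply/negP => /andP[/andP[zc _] /andP[zd _]].
    by case/negP: yc; rewrite /c -(porbit_eq zc) (porbit_eq zd) porbit_id.
  rewrite (cardsD1 x (_ :&: S)) (cardsD1 y (_ :\ x)) !inE neq_yx yS xS !porbit_id.
  rewrite orbT addnA addKn; apply: eq_card => z; rewrite !inE.
  by do !case: (_ == _) => //=; rewrite ?andbF.
have stKU y : stable rho (K :|: porbit rho y).
  apply/stableP => z; rewrite !inE (stable_perm _ stK).
  by rewrite (stable_perm _ (porbit_stable _ _)).
have mergedK y : y \in S :\ x -> y \notin c ->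
    stable (tperm x y * rho)%g (K :|: porbit rho y) /\
    forall z, z \notin K :|: porbit rho y ->
      z \in S :\ x :\ y /\ #|porbit (tperm x y * rho)%g z| = 6%N.
  move=> ySx yc; split.
    by rewrite stable_tperm ?stKU // !inE ?xK ?porbit_id ?orbT.
  move=> z; rewrite inE negb_or => /andP[zK zd]; have [zS <-] := SK z zK.
  split; last by rewrite porbit_tperm_off //; apply: contra zK; apply: subsetP.
  rewrite !inE zS andbT; apply/andP; split.
    by apply: contraNneq zd => ->; apply: porbit_id.
  by apply: contraNneq zK => ->.
(* The goals are, in this order, a partner [y] in the cycle [c] of [x], a partner in [K] outside
   [c], and a partner outside [K]. *)
congr (_ + _); last rewrite (bigID [in K]) /=; last congr (_ + _).
- rewrite fps_sum mulr_sumr.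
  apply: etrans (sum_split_orbit
    (fun a b => n`!%:R * E [:: a, b & degrees S X] n) rho xS).
  apply: eq_big => [y|y /andP[/setD1P[neq_yx yS] yc]].
    by rewrite !inE; do !case: (_ \in _) => //=; rewrite ?andbF ?andbT.
  have yK := subsetP cK _ yc; have [tU tD] := porbit_split_partition yc neq_yx.
  have KE : K :|: porbit rho y = K.
    by apply/setUidPl; apply: stable_porbit.
  have ySx : y \in S :\ x by rewrite !inE neq_yx.
  rewrite KE (IHp _ _ _ n) ?ltS2 // ?stable_tperm //; last first.
    move=> z zK; have [zS <-] := SK z zK; split.
      by rewrite !inE zS andbT; apply/andP; split; apply: contraNneq zK => ->.
    rewrite porbit_tperm_off // ?(porbit_eq yc).
      by apply: contra zK; apply: (subsetP cK).
    by apply: contra zK; apply: (subsetP cK).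
  rewrite cycles_in_split // -/c -/X.
  rewrite (@E_perm _ [:: #|porbit (tperm x y * rho)%g y :&: (S :\ x :\ y)|,
      #|porbit (tperm x y * rho)%g x :&: (S :\ x :\ y)| & degrees S X]) //.
  have xX : porbit (tperm x y * rho)%g x \notin X.
    by apply/negP => /avoid/(_ (porbit_id rho x)); rewrite porbit_id.
  have yX : porbit (tperm x y * rho)%g y \notin porbit (tperm x y * rho)%g x |: X.
    rewrite in_setU1 negb_or; apply/andP; split.
      apply/eqP => eq_xy; have := disjointFr tD (porbit_id _ x).
      by rewrite eq_xy porbit_id.
    by apply/negP => /avoid/(_ yc); rewrite porbit_id.
  apply: perm_trans (degrees_setU1 _ yX) _; rewrite perm_cons.
  apply: perm_trans (degrees_setU1 _ xX) _; rewrite perm_cons.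
  by rewrite (@degrees_eq _ S) // => e eX; apply: SX => //; apply: avoid eX yc.
- rewrite fps_sum mulr_sumr (partition_big (porbit rho) [in X]) => [|y] /=; last first.
    case/andP=> /andP[_ yc] yK; rewrite inE mem_cycles_in // yK andbT inE.
    by rewrite eq_porbit_mem.
  apply: eq_bigr => d dX; rewrite fps_natM.
  have /setD1P[neq_dc /cycles_inP-/(_ stK)[z zK def_d]] := dX.
  rewrite (eq_bigl [in d :&: S]) => [|y].
    rewrite mulrCA mulr_natl -sumr_const; apply: eq_bigr => y /setIP[yd yS].
    have def_d' : porbit rho y = d by rewrite def_d; apply: porbit_eq; rewrite -def_d.
    have yc : y \notin c by apply: contraL yd; apply: avoid.
    have ySx : y \in S :\ x.
      by rewrite !inE yS andbT; apply: contraNneq yc => ->; apply: porbit_id.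
    have [stT outT] := mergedK y ySx yc.
    rewrite (IHp _ _ _ n) ?ltS2 // => [|].
      by rewrite (E_perm (mergedS y ySx yc)) def_d'.
    rewrite -cardK def_d'; apply: eq_card => u; rewrite !inE negb_or.
    rewrite andbC; case: (boolP (u \in K)) => [|uK]; rewrite ?andbF //= andbT.
    by apply: contra uK; rewrite def_d; apply/subsetP/stable_porbit.
  rewrite in_setI; apply/idP/andP => [/andP[/andP[/andP[/setD1P[_ ->] _] _] /eqP <-]|].
    by rewrite porbit_id.
  case=> yd yS; have def_d' : porbit rho y = d.
    by rewrite def_d; apply: porbit_eq; rewrite -def_d.
  have yc : y \notin c by apply: contraL yd; apply: avoid.
  rewrite def_d' eqxx andbT yc !inE yS !andbT; apply/andP; split.
    by apply: contraNneq yc => ->; apply: porbit_id.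
  by move: yd; rewrite def_d; apply/subsetP/stable_porbit.
rewrite -mulrA fps_natM fpsXM.
rewrite (eq_bigl [in ~: K]) => [|y]; last first.
  rewrite !inE; case: (boolP (y \in K)) => yK; rewrite ?andbF ?andbT //=.
  have [-> _] := SK y yK; rewrite andbT; apply/andP; split.
    by apply: contraNneq yK => ->.
  by apply: contra yK; apply: subsetP.
case: n cardK => [|n] cardK.
  by rewrite big_pred0 ?mulr0 // => y; move/cards0_eq: cardK => ->; rewrite inE.
(* There are 6 (n + 1) choices of [y], and 6 (n + 1) n! = 6 (n + 1)!; the factor [fpsX] of the loop
   equation accounts for the index dropping from n + 1 to n. *)
transitivity (\sum_(y in ~: K) n`!%:R * E ((k + 4)%N :: degrees S X) n); last first.
  rewrite sumr_const cardK -mulr_natl factS !natrM; ring.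
apply: eq_bigr => y; rewrite inE => yK.
have [yS card_y] := SK y yK; have yc : y \notin c by apply: contra yK; apply: subsetP.
have ySx : y \in S :\ x by rewrite !inE yS andbT; apply: contraNneq yK => ->.
have [stT outT] := mergedK y ySx yc.
have dK : porbit rho y \subset ~: K.
  apply: stable_porbit; last by rewrite inE.
  by apply/stableP => z; rewrite !inE (stable_perm _ stK).
rewrite (IHp _ _ _ n) ?ltS2 // => [|].
  rewrite (E_perm (mergedS y ySx yc)) (_ : porbit rho y :&: S = porbit rho y).
    rewrite card_y (_ : X :\ porbit rho y = X); last first.
      apply/setDidPl; rewrite disjoint_sym disjoints1; apply/negP => /setD1P[_].
      by rewrite mem_cycles_in // (negPf yK).
    by rewrite addnC -addnBA.
  by apply/setIidPl/subsetP => z /(subsetP dK); rewrite inE => /SK[].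
have := cardsID (porbit rho y) (~: K); rewrite (setIidPr dK) card_y cardK.
by rewrite setDE -setCU mulnS => /eqP; rewrite eqn_add2l => /eqP.
Qed.

End ExplorationSum.

(** * Orthogonal polynomials for an even moment functional, and Freud's equation *)

Section OrthogonalPolynomials.
Variables (A : comUnitRingType) (mu : nat -> A).
Hypothesis mu_odd : forall n, odd n -> mu n = 0.
Implicit Types (p q : {poly A}) (i j k n : nat).

Definition moment p : A := \sum_(i < size p) p`_i * mu i.

Lemma moment_widen p n : (size p <= n)%N -> moment p = \sum_(i < n) p`_i * mu i.
Proof.
move=> le_pn; rewrite /moment (big_ord_widen _ (fun i => p`_i * mu i) le_pn).
rewrite big_mkcond; apply: eq_bigr => i _; case: ltnP => // le_pi.
by rewrite nth_default ?mul0r.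
Qed.

Fact moment_linear : scalar moment.
Proof.
move=> a p q; set n := maxn (size p) (size q).
rewrite !(@moment_widen _ n) ?leq_maxl ?leq_maxr //; last first.
  by rewrite (leq_trans (size_polyD _ _)) // geq_max leq_maxr
    (leq_trans (size_scale_leq _ _)) ?leq_maxl.
rewrite mulr_sumr -big_split; apply: eq_bigr => i _ /=.
by rewrite coefD coefZ mulrDl mulrA.
Qed.

HB.instance Definition _ :=
  GRing.isLinear.Build A {poly A} A *%R moment moment_linear.

Lemma momentXn n : moment 'X^n = mu n.
Proof.
rewrite (@moment_widen _ n.+1) ?size_polyXn // big_ord_recr /= coefXn eqxx mul1r.
by rewrite big1 ?add0r // => i _; rewrite coefXn ltn_eqF ?mul0r.
Qed.

Definition has_parity n p := forall i, odd (i + n) -> p`_i = 0.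

Lemma has_parityM m n p q :
  has_parity m p -> has_parity n q -> has_parity (m + n) (p * q).
Proof.
move=> parp parq i odd_i; rewrite coefM big1 // => j _.
have [odd_jm|even_jm] := boolP (odd (j + m)); first by rewrite parp ?mul0r.
rewrite parq ?mulr0 //; move: odd_i.
have -> : (i + (m + n) = j + m + (i - j + n))%N by have := leq_ord j; lia.
by rewrite oddD (negPf even_jm).
Qed.

Lemma has_parityX k : has_parity k ('X^k : {poly A}).
Proof.
move=> i; rewrite coefXn; case: eqP => // ->.
by rewrite addnn odd_double.
Qed.

Lemma moment_parity n p : odd n -> has_parity n p -> moment p = 0.
Proof.
move=> odd_n parp; rewrite /moment big1 // => i _.
have [odd_i|even_i] := boolP (odd i); first by rewrite mu_odd ?mulr0.
by rewrite parp ?mul0r // oddD odd_n (negPf even_i).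
Qed.

(** The three-term recurrence is the definition, and orthogonality is derived from it. There is no
    multiple of the middle polynomial because the odd moments vanish. *)
Definition orthopoly_step (pq : {poly A} * {poly A}) :=
  (pq.2, 'X * pq.2 - (moment (pq.2 ^+ 2) / moment (pq.1 ^+ 2)) *: pq.1).

Definition orthopoly n : {poly A} := (iter n orthopoly_step (1, 'X)).1.

Local Notation P := orthopoly.

Definition sqnorm n : A := moment (P n ^+ 2).
Definition recur n : A := if n is m.+1 then sqnorm n / sqnorm m else 0.

Lemma orthopoly_rec n : P n.+2 = 'X * P n.+1 - recur n.+1 *: P n.
Proof. by []. Qed.

Lemma orthopoly_rec0 n : 'X * P n.+1 = P n.+2 + recur n.+1 *: P n.
Proof. by rewrite orthopoly_rec subrK. Qed.

Lemma orthopoly_monic_size n :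
  [/\ P n \is monic, size (P n) = n.+1, P n.+1 \is monic & size (P n.+1) = n.+2].
Proof.
elim: n => [|n [_ sz_n mon sz]].
  by rewrite monic1 size_poly1 monicX size_polyX.
have szX : size ('X * P n.+1) = n.+3.
  by rewrite mulrC size_mulX ?monic_neq0 // sz.
have lt_sz : (size (- (recur n.+1 *: P n)) < size ('X * P n.+1)%R)%N.
  by rewrite szX size_polyN (leq_ltn_trans (size_scale_leq _ _)) // sz_n; lia.
split=> //; last by rewrite orthopoly_rec size_polyDl.
rewrite orthopoly_rec monicE lead_coefDl //.
by rewrite -monicE monicMl ?monicX.
Qed.

Lemma orthopoly_monic n : P n \is monic.
Proof. by case: (orthopoly_monic_size n). Qed.

Lemma size_orthopoly n : size (P n) = n.+1.
Proof. by case: (orthopoly_monic_size n). Qed.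

Lemma orthopoly_parity n : has_parity n (P n).
Proof.
suff [] : has_parity n (P n) /\ has_parity n.+1 (P n.+1) by [].
elim: n => [|n [par_n par_n1]].
  by split; [have := @has_parityX 0|have := @has_parityX 1]; rewrite ?expr0 ?expr1.
split=> // i odd_i; rewrite orthopoly_rec coefB coefZ par_n; last first.
  by move: odd_i; rewrite !addnS /= negbK.
rewrite mulr0 subr0; apply: (has_parityM (m := 1) _ par_n1); last exact: odd_i.
by have := @has_parityX 1; rewrite expr1.
Qed.

Definition orthogonal_below n := forall k, (k < n)%N -> moment ('X^k * P n) = 0.

Lemma orthogonal_poly n p : orthogonal_below n -> (size p <= n)%N ->
  moment (p * P n) = 0.
Proof.
move=> orth_n le_pn; rewrite -[p]coefK poly_def mulr_suml linear_sum big1 // => i _.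
by rewrite -scalerAl linearZ /= orth_n ?mulr0 // (leq_trans (ltn_ord i)).
Qed.

Lemma orthogonal_monic n p : orthogonal_below n -> p \is monic ->
  size p = n.+1 -> moment (p * P n) = sqnorm n.
Proof.
move=> orth_n mon_p sz_p; apply/eqP; rewrite -subr_eq0 /sqnorm expr2 -linearB -mulrBl /=.
rewrite orthogonal_poly //; apply/leq_sizeP => i le_ni; rewrite coefB.
move: le_ni; rewrite leq_eqVlt => /orP[/eqP <-|lt_ni].
  have := monicP mon_p; have := monicP (orthopoly_monic n).
  by rewrite !lead_coefE sz_p size_orthopoly /= => -> ->; rewrite subrr.
by rewrite !nth_default ?subrr ?sz_p ?size_orthopoly.
Qed.

(** Against ['X^k] with [k < n] both terms vanish; for [k = n] the recurrence coefficient is chosen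
    so that they cancel; for [k = n.+1] both are moments of odd polynomials. *)
Lemma orthogonal_step n : orthogonal_below n -> orthogonal_below n.+1 ->
  sqnorm n \is a GRing.unit -> orthogonal_below n.+2.
Proof.
move=> orth_n orth_n1 unit_h k lt_k.
rewrite orthopoly_rec mulrBr mulrA -exprSr -scalerAr linearB linearZ /=.
have [lt_kn|le_nk] := ltnP k n.
  by rewrite orth_n1 // orth_n // mulr0 subrr.
have [lt_kn1|le_n1k] := ltnP k n.+1.
  have -> : k = n by lia.
  rewrite !orthogonal_monic ?monicXn ?size_polyXn //.
  by rewrite /= divrK ?subrr.
have -> : k = n.+1 by lia.
rewrite (@moment_parity (n.+2 + n.+1)) ?(@moment_parity (n.+1 + n)) ?mulr0 ?subrr //.
- by rewrite oddD /=; case: (odd n).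
- by apply: has_parityM; [apply: has_parityX|apply: orthopoly_parity].
- by rewrite oddD /=; case: (odd n).
- by apply: has_parityM; [apply: has_parityX|apply: orthopoly_parity].
Qed.

Section StringEquation.
Variable s : A.
Hypothesis mu_rec : forall n,
  mu n.+1 = n%:R * mu n.-1 + 6%:R * s * mu (n + 5)%N.

Lemma moment_by_parts p :
  moment p^`() = moment ('X * p) - 6%:R * s * moment ('X^5 * p).
Proof.
have distr q : q * p = \sum_(i < size p) p`_i *: (q * 'X^i).
  rewrite -{1}[p]coefK poly_def mulr_sumr.
  by apply: eq_bigr => i _; rewrite scalerAr.
rewrite !distr -{1}[p]coefK poly_def (raddf_sum (@deriv A)) !(raddf_sum moment) /=.
rewrite mulr_sumr -sumrB; apply: eq_bigr => i _.
rewrite derivZ !linearZ /= derivXn -exprS -exprD linearMn /= !momentXn.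
by rewrite mu_rec addnC -mulr_natl; ring.
Qed.

(** Integrate the derivative of P_n P_(n + 1) by parts. By orthogonality P_n' P_(n + 1) contributes
    nothing, P_n P_(n + 1)' contributes n + 1 times the norm of P_n, and x P_n P_(n + 1) the norm of
    P_(n + 1). *)
Lemma sqnorm_step n : orthogonal_below n -> orthogonal_below n.+1 ->
  sqnorm n.+1 = n.+1%:R * sqnorm n + 6%:R * s * moment ('X^5 * (P n * P n.+1)).
Proof.
move=> orth_n orth_n1; have := moment_by_parts (P n * P n.+1).
have monX : 'X * P n \is monic by rewrite monicMl ?monicX ?orthopoly_monic.
have szX : size ('X * P n) = n.+2.
  by rewrite mulrC size_mulX ?monic_neq0 ?orthopoly_monic // size_orthopoly.
rewrite mulrA orthogonal_monic // derivM linearD /=.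
rewrite [X in X + _ = _]orthogonal_poly //; last first.
  by rewrite ltnW // -(size_orthopoly n) lt_size_deriv ?monic_neq0 ?orthopoly_monic.
have -> : moment (P n * (P n.+1)^`()) = n.+1%:R * sqnorm n.
  apply/eqP; rewrite -subr_eq0 /sqnorm expr2 -linearZ -linearB /=.
  rewrite mulrC scalerAl -mulrBl orthogonal_poly //.
  apply/leq_sizeP => i le_ni; rewrite coefB coef_deriv coefZ.
  move: le_ni; rewrite leq_eqVlt => /orP[/eqP <-|lt_ni].
    have := monicP (orthopoly_monic n); have := monicP (orthopoly_monic n.+1).
    rewrite !lead_coefE !size_orthopoly /= => -> ->.
    by rewrite mulr1 subrr.
  by rewrite !nth_default ?size_orthopoly // mul0rn mulr0 subrr.
by rewrite add0r => ->; rewrite subrK.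
Qed.

(** Orthogonality at the next degree needs an invertible norm, and controlling the next norm needs
    orthogonality, so both are proved together. Under [ev] the s-term of [sqnorm_step] disappears,
    as for Hermite polynomials, and the norm is multiplied by n + 1. *)
Lemma sqnorm_unit_orthogonal (F : fieldType) (ev : {rmorphism A -> F}) n :
    (forall a : A, ev a != 0 -> a \is a GRing.unit) ->
    ev s = 0 -> ev (mu 0) != 0 -> (forall n, n.+1%:R != 0 :> F) ->
  orthogonal_below n /\ sqnorm n \is a GRing.unit.
Proof.
move=> unit_ev ev_s ev_mu0 char0.
have ev_step m : orthogonal_below m -> orthogonal_below m.+1 -> ev (sqnorm m) != 0 ->
    ev (sqnorm m.+1) != 0.
  move=> orth_m orth_m1 nz; rewrite sqnorm_step // rmorphD !rmorphM ev_s mulr0 !mul0r addr0.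
  by rewrite rmorph_nat mulf_neq0.
suff [orth_n _ nz _] : [/\ orthogonal_below n, orthogonal_below n.+1,
    ev (sqnorm n) != 0 & ev (sqnorm n.+1) != 0] by split=> //; exact: unit_ev.
elim: n => [|n [orth_n orth_n1 nz_n nz_n1]].
  have orth1 : orthogonal_below 1.
    move=> [|//] _; rewrite mul1r (_ : P 1 = 'X^1); last by rewrite expr1.
    by rewrite momentXn mu_odd.
  have nz0 : ev (sqnorm 0) != 0 by rewrite /sqnorm expr1n -(expr0 'X) momentXn.
  by split=> //; apply: ev_step.
have orth_n2 : orthogonal_below n.+2 by apply: orthogonal_step => //; apply: unit_ev.
by split=> //; apply: ev_step.
Qed.

Hypothesis orthoP : forall n, orthogonal_below n.
Hypothesis sqnorm_unit : forall n, sqnorm n \is a GRing.unit.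

Lemma moment_orthopolys i j : moment (P i * P j) = (i == j)%:R * sqnorm i.
Proof.
wlog le_ij : i j / (i <= j)%N => [hw|].
  have [/hw //|/ltnW /hw eq_ji] := leqP i j.
  by rewrite mulrC eq_ji eq_sym; case: eqP => [->|]; rewrite ?mul0r.
case: eqP => [->|/eqP neq_ij]; first by rewrite mul1r.
by rewrite mul0r orthogonal_poly ?size_orthopoly // ltn_neqAle neq_ij.
Qed.

Lemma sqnormS n : sqnorm n.+1 = recur n.+1 * sqnorm n.
Proof. by rewrite /= divrK. Qed.

(** This is [sqnorm_step] with the quintic moment evaluated by the three-term recurrence. Starting
    at index n + 3 keeps all recurrence coefficients that occur at positive indices. *)
Lemma freud_equation n (b := recur) :
  n.+3%:R = b n.+3 * (1 - 6%:R * s *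
    (b n.+1 * b n.+2 + b n.+2 * b n.+2 + 2%:R * (b n.+2 * b n.+3)
     + b n.+2 * b n.+4 + b n.+3 * b n.+3 + 2%:R * (b n.+3 * b n.+4)
     + b n.+4 * b n.+4 + b n.+4 * b n.+4.+1)).
Proof.
have X2 : 'X * ('X * P n.+2) = P n.+4 + (b n.+3 + b n.+2) *: P n.+2
    + (b n.+2 * b n.+1) *: P n.
  move: (orthopoly_rec0 n) (orthopoly_rec0 n.+1) (orthopoly_rec0 n.+2).
  rewrite -/b; move: (P n) (P n.+1) (P n.+2) (P n.+3) (P n.+4).
  move=> p0 p1 p2 p3 p4 r1 r2 r3.
  by rewrite r2 mulrDr -scalerAr r3 r1 -!mul_polyC; ring.
have X3 : 'X * ('X * ('X * P n.+3)) = P n.+4.+2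
    + (b n.+3 + b n.+4 + b n.+4.+1) *: P n.+4
    + (b n.+3 * (b n.+2 + b n.+3 + b n.+4)) *: P n.+2
    + (b n.+3 * b n.+2 * b n.+1) *: P n.
  rewrite (orthopoly_rec0 n.+2) (mulrDr 'X (P n.+4)) (mulrDr 'X ('X * P n.+4)).
  rewrite -!scalerAr X2.
  move: (orthopoly_rec0 n.+2) (orthopoly_rec0 n.+3) (orthopoly_rec0 n.+4).
  rewrite -/b; move: (P n) (P n.+2) (P n.+3) (P n.+4) (P n.+4.+1) (P n.+4.+2).
  move=> p0 p2 p3 p4 p5 p6 r3 r4 r5.
  by rewrite r4 mulrDr -scalerAr r5 r3 -!mul_polyC; ring.
have momE : moment ('X^5 * (P n.+2 * P n.+3)) = sqnorm n.+2 * (b n.+3 *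
    (b n.+1 * b n.+2 + b n.+2 * b n.+2 + 2%:R * (b n.+2 * b n.+3)
     + b n.+2 * b n.+4 + b n.+3 * b n.+3 + 2%:R * (b n.+3 * b n.+4)
     + b n.+4 * b n.+4 + b n.+4 * b n.+4.+1)).
  (* Splitting the power 5 as 2 + 3 makes both factors combinations of [P n], [P n.+2], [P n.+4] and
     [P n.+4.+2]; orthogonality leaves only the diagonal pairs. *)
  have -> : 'X^5 * (P n.+2 * P n.+3) =
      'X * ('X * P n.+2) * ('X * ('X * ('X * P n.+3))) by ring.
  rewrite X2 X3.
  have diff i j : i != j -> moment (P i * P j) = 0.
    by move=> neq_ij; rewrite moment_orthopolys (negPf neq_ij) mul0r.
  have same i : moment (P i * P i) = sqnorm i.
    by rewrite moment_orthopolys eqxx mul1r.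
  have neq i j : (i < j)%N -> i != j by move=> lt_ij; rewrite ltn_eqF.
  have neq' i j : (j < i)%N -> i != j by move=> lt_ij; rewrite gtn_eqF.
  have d46 : moment (P n.+4 * P n.+4.+2) = 0 by apply/diff/neq; lia.
  have d42 : moment (P n.+4 * P n.+2) = 0 by apply/diff/neq'; lia.
  have d40 : moment (P n.+4 * P n) = 0 by apply/diff/neq'; lia.
  have d26 : moment (P n.+2 * P n.+4.+2) = 0 by apply/diff/neq; lia.
  have d24 : moment (P n.+2 * P n.+4) = 0 by apply/diff/neq; lia.
  have d20 : moment (P n.+2 * P n) = 0 by apply/diff/neq'; lia.
  have d06 : moment (P n * P n.+4.+2) = 0 by apply/diff/neq; lia.
  have d04 : moment (P n * P n.+4) = 0 by apply/diff/neq; lia.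
  have d02 : moment (P n * P n.+2) = 0 by apply/diff/neq; lia.
  move: d46 d42 d40 d26 d24 d20 d06 d04 d02 (same n) (same n.+2) (same n.+4).
  clear X2 X3 diff same; move: (P n) (P n.+2) (P n.+4) (P n.+4.+2).
  move=> p0 p2 p4 p6 d46 d42 d40 d26 d24 d20 d06 d04 d02 d00 d22 d44.
  rewrite !mulrDl !mulrDr -!scalerAl -!scalerAr.
  have momZ a p : moment (a *: p) = a * moment p by rewrite linearZ.
  have momD p q : moment (p + q) = moment p + moment q by rewrite linearD.
  rewrite !momD !momZ.
  rewrite d46 d42 d40 d26 d24 d20 d06 d04 d02 d00 d22 d44.
  have sq4 : sqnorm n.+4 = b n.+4 * (b n.+3 * sqnorm n.+2) by rewrite !sqnormS.
  have sq2 : sqnorm n.+2 = b n.+2 * (b n.+1 * sqnorm n) by rewrite !sqnormS.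
  by rewrite sq4 sq2; ring.
have := sqnorm_step (@orthoP n.+2) (@orthoP n.+3); rewrite momE sqnormS -/b => step.
apply: (mulIr (sqnorm_unit n.+2)).
have -> : n.+3%:R * sqnorm n.+2 = b n.+3 * sqnorm n.+2 - 6%:R * s * (sqnorm n.+2 * (b n.+3 *
    (b n.+1 * b n.+2 + b n.+2 * b n.+2 + 2%:R * (b n.+2 * b n.+3)
     + b n.+2 * b n.+4 + b n.+3 * b n.+3 + 2%:R * (b n.+3 * b n.+4)
     + b n.+4 * b n.+4 + b n.+4 * b n.+4.+1))) by rewrite step addrK.
ring.
Qed.

End StringEquation.
End OrthogonalPolynomials.

(** * Hankel minors as products of norms, and the correlator of two legs *)

Section HankelDeterminants.
Variables (A : comUnitRingType) (mu : nat -> A) (s : A).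
Hypothesis double_inj : forall x : A, x + x = 0 -> x = 0.
Hypothesis mu_odd : forall n, odd n -> mu n = 0.
Hypothesis mu_rec : forall n,
  mu n.+1 = n%:R * mu n.-1 + 6%:R * s * mu (n + 5)%N.
Hypothesis orthoP : forall n, orthogonal_below mu n.
Hypothesis sqnorm_unit : forall n, sqnorm mu n \is a GRing.unit.

Local Notation P := (orthopoly mu).

(** When the polynomials of degrees [e i] involve only monomials of degrees [e j], a unitriangular
    change of basis turns the moment matrix into their Gram matrix, which is diagonal. *)
Lemma hankel_minor_orthopoly N (e : {ffun 'I_N -> nat}) :
    (forall i j : 'I_N, (i < j)%N -> (e i < e j)%N) ->
    (forall i k, (P (e i))`_k != 0 -> exists j, k = e j) ->
  hankel_minor mu e e = \prod_i sqnorm mu (e i).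
Proof.
move=> e_incr e_span; pose U := \matrix_(i, j) (P (e i))`_(e j).
have e_inj : injective e.
  move=> i j eq_ij; apply/eqP; rewrite -val_eqE /=.
  by case: ltngtP => // /e_incr; rewrite eq_ij ltnn.
have expandP i : P (e i) = \sum_j (P (e i))`_(e j) *: 'X^(e j).
  apply/polyP => k; rewrite coef_sum.
  have [[j ->]|no_j] := pselect (exists j, k = e j).
    rewrite (bigD1 j) //= coefZ coefXn eqxx mulr1 big1 ?addr0 // => l neq_lj.
    by rewrite coefZ coefXn (inj_eq e_inj) eq_sym (negPf neq_lj) mulr0.
  rewrite big1 => [|j _]; last first.
    by rewrite coefZ coefXn; case: eqP => [eq_k|]; rewrite ?mulr0 //; case: no_j; exists j.
  by have [/eqP //|/e_span] := boolP ((P (e i))`_k == 0).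
have detU : \det U = 1.
  rewrite det_trig => [|]; last first.
    apply/is_trig_mxP => i j lt_ij; rewrite mxE nth_default // size_orthopoly.
    exact: e_incr.
  rewrite big1 // => i _; rewrite mxE.
  by have := monicP (orthopoly_monic mu (e i)); rewrite lead_coefE size_orthopoly.
pose M := \matrix_(i < N, j < N) mu (e i + e j)%N.
have -> : hankel_minor mu e e = \det (U *m M *m U^T).
  by rewrite !det_mulmx det_tr detU mul1r mulr1.
have -> : U *m M *m U^T = diag_mx (\row_i sqnorm mu (e i)).
  apply/matrixP => i j; rewrite !mxE.
  transitivity (moment mu (P (e i) * P (e j))); last first.
    rewrite (moment_orthopolys orthoP) (inj_eq e_inj) mulr_natl.
    by case: eqP => [->|].
  have -> : P (e i) * P (e j) = (\sum_a (P (e i))`_(e a) *: 'X^(e a))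
      * (\sum_b (P (e j))`_(e b) *: 'X^(e b)) by rewrite -!expandP.
  rewrite mulr_suml (raddf_sum (moment mu)).
  under eq_bigr do rewrite mxE mulr_suml.
  rewrite exchange_big; apply: eq_bigr => a _ /=.
  rewrite mulr_sumr (raddf_sum (moment mu)); apply: eq_bigr => b _.
  have momZ c p : moment mu (c *: p) = c * moment mu p by rewrite linearZ.
  have -> : (P (e i))`_(e a) *: 'X^(e a) * ((P (e j))`_(e b) *: 'X^(e b))
      = ((P (e i))`_(e a) * (P (e j))`_(e b)) *: 'X^(e a + e b).
    by rewrite -scalerAl -scalerAr scalerA exprD.
  rewrite /= momZ momentXn !mxE.
  by rewrite mulrAC.
by rewrite det_diag; apply: eq_bigr => i _; rewrite mxE.
Qed.

Lemma correlator_nil N : correlator N mu [::] = \prod_(i < N) sqnorm mu i.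
Proof.
rewrite /correlator /= /hankel hankel_minor_orthopoly => [|i j|i k].
- by apply: eq_bigr => i _; rewrite ffunE.
- by rewrite !ffunE.
rewrite ffunE => nz; have lt_k : (k < N)%N.
  rewrite (leq_trans _ (ltn_ord i)) // ltnNge; apply: contraNN nz => lt_ik.
  by rewrite nth_default ?size_orthopoly.
by exists (Ordinal lt_k); rewrite ffunE.
Qed.

(** Raising any row but the last by one makes it collide with the next. *)
Lemma psum_staircase N (Phi : {ffun 'I_N.+1 -> nat} -> A) : alternates Phi ->
  psum_op 1 Phi (staircase N.+1) = Phi (shift_at (staircase N.+1) ord_max 1).
Proof.
move=> altPhi; rewrite /psum_op big_ord_recr /= big1 ?add0r // => i _.
have lt_i : (i.+1 < N.+1)%N by rewrite ltnS.
apply: (alternates_eq0 double_inj (i := widen_ord (leqnSn N) i) (j := Ordinal lt_i)) => //.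
  by rewrite -val_eqE /=; lia.
rewrite !ffunE eqxx -val_eqE /= ifN; lia.
Qed.

(** One of the two first power sums is let act on the rows and the other on the columns. Only the
    top exponent moves, so both index sets become 0, ..., N - 1, N + 1. *)
Lemma correlator11 N :
  correlator N.+1 mu [:: 1; 1]%N =
  (\prod_(i < N) sqnorm mu i) * sqnorm mu N.+1.
Proof.
have altD := hankel_minor_alternates mu.
rewrite /correlator /= psum_staircase; last exact/alternates_psum/altD.
rewrite -psum_hankel_minor psum_staircase; last first.
  move=> f i j neq_ij; rewrite ![hankel_minor mu (shift_at _ _ _) _]hankel_minor_sym.
  exact: altD.
set e := shift_at _ _ _.
have eE (i : 'I_N.+1) : e i = if i == ord_max then N.+1 else i.
  by rewrite ffunE ffunE; case: eqP => [->|] //=; rewrite addn1.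
rewrite hankel_minor_orthopoly => [|i j lt_ij|i k].
- rewrite big_ord_recr /= eE eqxx; congr (_ * _); apply: eq_bigr => i _.
  by rewrite eE -val_eqE /= ltn_eqF.
- rewrite !eE -!val_eqE /=; have := ltn_ord j; do !case: eqP; lia.
have [lt_kN|le_Nk] := ltnP k N.
  have lt_k : (k < N.+1)%N by lia.
  by move=> _; exists (Ordinal lt_k); rewrite eE -val_eqE /= ltn_eqF.
rewrite eE => nz.
have -> : k = N.+1; last by exists ord_max; rewrite eE eqxx.
move: nz; have [_ nz|neq_i] := eqVneq i ord_max.
  apply: contrapT => /eqP neq_k; move/eqP: nz; apply.
  (* The exponent N is missing from the index set; by parity it is also missing from the polynomial
     of degree N + 1. *)
  have [->|neq_kN] := eqVneq k N.
    by rewrite (@orthopoly_parity _ mu N.+1) // addnS addnn /= odd_double.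
  by rewrite nth_default // size_orthopoly; lia.
move=> /negP nz; case: nz; rewrite nth_default // size_orthopoly.
by move: neq_i; rewrite -val_eqE /=; have := ltn_ord i; lia.
Qed.

Definition expectation N (ks : seq nat) : A :=
  correlator N mu ks / correlator N mu [::].

Lemma correlator_unit N : correlator N mu [::] \is a GRing.unit.
Proof. by rewrite correlator_nil; apply: rpred_prod => i _. Qed.

Lemma expectation_nil N : expectation N [::] = 1.
Proof. by rewrite /expectation divrr // correlator_unit. Qed.

Lemma expectation_perm N ks ls : perm_eq ks ls -> expectation N ks = expectation N ls.
Proof. by move=> eq_kl; rewrite /expectation /correlator (psum_ops_perm _ eq_kl). Qed.

Lemma expectation_zero N ks : expectation N (0%N :: ks) = N%:R * expectation N ks.
Proof. by rewrite /expectation /correlator /= psum_op0 mulrA. Qed.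

Lemma expectation_loop N k ks : (0 < k)%N ->
  expectation N (k :: ks) =
    \sum_(0 <= a < k - 1) expectation N [:: a, (k - 2 - a)%N & ks]
    + \sum_(0 <= n < size ks) (nth 0%N ks n)%:R * expectation N (merge_at ks n k)
    + 6%:R * s * expectation N ((k + 4)%N :: ks).
Proof.
move=> k_gt0; rewrite /expectation (loop_equation N double_inj mu_rec) //.
move: (6%:R : A) => c; rewrite !mulrDl; congr (_ + _ + _).
- by rewrite mulr_suml.
- by rewrite mulr_suml; apply: eq_bigr => n _; rewrite mulrA.
- by rewrite mulrA.
Qed.

Lemma expectation11 N : expectation N.+1 [:: 1; 1]%N = recur mu N.+1.
Proof.
rewrite /expectation correlator11 correlator_nil big_ord_recr /=.
rewrite invrM; last first.
- exact: sqnorm_unit.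
- by apply: rpred_prod => i _.
rewrite [X in X * _]mulrC -mulrA; congr (_ * _).
by rewrite [X in _ * X]mulrC mulrA divrr ?mul1r //; apply: rpred_prod => i _.
Qed.

End HankelDeterminants.

(** * The formal moments of the sextic weight *)

Section SexticMoments.
Variable F : numFieldType.

Fixpoint gaussian_moment (n : nat) : F :=
  match n with
  | 0 => 1
  | 1 => 0
  | m.+2 => m.+1%:R * gaussian_moment m
  end.

(* The moments of [exp (- x ^ 2 / 2 + s x ^ 6)] as power series in [s]. *)
Definition sextic_moment n : fps F :=
  fun b => gaussian_moment (n + 6 * b) / b`!%:R.

Lemma gaussian_momentS n : gaussian_moment n.+1 = n%:R * gaussian_moment n.-1.
Proof. by case: n => [|n] //=; rewrite mul0r. Qed.

Lemma gaussian_moment_odd n : odd n -> gaussian_moment n = 0.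
Proof.
have [m] := ubnP n; elim: m n => // m IHm [|[|n]] //= lt_n.
by rewrite negbK => odd_n; rewrite IHm ?mulr0 //; lia.
Qed.

Lemma sextic_moment_odd n : odd n -> sextic_moment n = 0.
Proof.
move=> odd_n; apply/funext => b; rewrite /sextic_moment gaussian_moment_odd ?mul0r //.
by rewrite oddD oddM /= addbF.
Qed.

Lemma sextic_moment_rec n : sextic_moment n.+1 =
  n%:R * sextic_moment n.-1 + 6%:R * fpsX F * sextic_moment (n + 5)%N.
Proof.
apply/funext => b; rewrite fpsD -mulrA !fps_natM fpsXM /sextic_moment.
have fact_neq0 k : k`!%:R != 0 :> F by rewrite pnatr_eq0 -lt0n fact_gt0.
rewrite addSn gaussian_momentS; case: b => [|b].
  by rewrite muln0 !addn0 mulr0 addr0 mulrA.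
rewrite natrD mulrDl mulrDl; congr (_ + _).
  case: n => [|n]; first by rewrite !mul0r.
  by rewrite mulrA addSn.
have -> : (n + 6 * b.+1).-1 = (n + 5 + 6 * b)%N by lia.
rewrite factS !natrM; field.
by rewrite fact_neq0 addrC natr1 pnatr_eq0.
Qed.

Lemma fps_double_inj (f : fps F) : f + f = 0 -> f = 0.
Proof.
move=> ff0; apply/funext => n; have /(congr1 (@^~ n)) := ff0.
by rewrite fpsD -mulr2n => /eqP; rewrite mulrn_eq0 /= => /eqP ->.
Qed.

Definition fps_coef0 (f : fps F) : F := f 0%N.
HB.instance Definition _ :=
  GRing.isZmodMorphism.Build (fps F) F fps_coef0 (@fps_coef0_zmod F).
HB.instance Definition _ :=
  GRing.isMonoidMorphism.Build (fps F) F fps_coef0 (@fps_coef0_monoid F).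

Lemma sextic_orthogonal n :
  orthogonal_below sextic_moment n /\ sqnorm sextic_moment n \is a GRing.unit.
Proof.
apply: (sqnorm_unit_orthogonal sextic_moment_odd sextic_moment_rec (ev := fps_coef0)).
- by move=> f; apply: fps_unitE.
- by [].
- by rewrite /= /fps_coef0 /sextic_moment muln0 /= divr1 oner_eq0.
- by move=> k; rewrite pnatr_eq0.
Qed.

Definition freud_series n : fps F := recur sextic_moment n.

Lemma freud_series_string n (b := freud_series) :
  n.+3%:R = b n.+3 * (1 - 6%:R * fpsX F *
    (b n.+1 * b n.+2 + b n.+2 * b n.+2 + 2%:R * (b n.+2 * b n.+3)
     + b n.+2 * b n.+4 + b n.+3 * b n.+3 + 2%:R * (b n.+3 * b n.+4)
     + b n.+4 * b n.+4 + b n.+4 * b n.+4.+1)).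
Proof.
have orth m : orthogonal_below sextic_moment m by case: (sextic_orthogonal m).
have unit_h m : sqnorm sextic_moment m \is a GRing.unit.
  by case: (sextic_orthogonal m).
exact: (freud_equation sextic_moment_rec orth unit_h n).
Qed.

Lemma explored_sum_two_legs (H : finType) (rho : {perm H})
    (S K : {set H}) (n N : nat) :
    stable rho K ->
    (forall x, x \notin K -> x \in S /\ #|porbit rho x| = 6%N) ->
    #|~: K| = (6 * n)%N ->
    perm_eq (degrees S (cycles_in rho K)) [:: 1; 1]%N ->
  explored_sum (N.+1%:R : F) rho S K = n`!%:R * freud_series N.+1 n.
Proof.
move=> stK outK cardK degK; pose E := expectation sextic_moment N.+1.
have orth m : orthogonal_below sextic_moment m by case: (sextic_orthogonal m).
have unit_h m : sqnorm sextic_moment m \is a GRing.unit.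
  by case: (sextic_orthogonal m).
have E_perm ks ls : perm_eq ks ls -> E ks = E ls by apply: expectation_perm.
rewrite (@explored_sumE H F N.+1%:R E _ E_perm _ _ rho S K n) //.
- by rewrite (E_perm _ _ degK) /E (expectation11 fps_double_inj orth unit_h).
- exact: (expectation_nil orth unit_h).
- by move=> ks; rewrite /E expectation_zero rmorph_nat.
move=> k ks; apply: expectation_loop.
- exact: fps_double_inj.
- exact: sextic_moment_rec.
Qed.

End SexticMoments.

(** * Two-legged ribbon graphs and their face polynomials *)

Section RibbonGraphs.
Variable j : nat.
Local Notation edge := (half_edge 6 j).
Local Notation rot := (rotation 6 j).
Implicit Types (h k : edge) (m : {perm edge}) (C : {set edge}).

Lemma rotationE h : rot h = next_half_edge h. Proof. by rewrite permE. Qed.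

Lemma iter_rotation (v : 'I_j) (i : 'I_6) n :
  exists l : 'I_6, iter n rot (inl (v, i)) = inl (v, l) /\ val l = ((i + n) %% 6)%N.
Proof.
elim: n => [|n [l [IHn val_l]]].
  by exists i; rewrite addn0 modn_small.
exists (ordS l); rewrite /= IHn rotationE; split=> //=.
by rewrite val_l -addn1 modnDml addn1 addnS.
Qed.

Lemma porbit_rotation h : porbit rot h = [set k | vertex_of k == vertex_of h].
Proof.
apply/setP => k; rewrite inE; apply/idP/eqP => [/porbitP[n ->]|].
  rewrite permX; elim: n => //= n <-; rewrite rotationE.
  by case: (iter n _ _) => [[]|].
case: h k => [[v i]|l] [[w i']|l'] //= [->]; last exact: porbit_id.
have [l [iterE val_l]] := iter_rotation v i (i' + (6 - i)).
have -> : i' = l.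
  apply: val_inj; rewrite val_l addnCA subnKC 1?ltnW // modnDr modn_small //.
by rewrite -iterE mem_porbit_iter.
Qed.

Definition legs : {set edge} := [set h | if h is inr _ then true else false].

Lemma mem_legs (l : 'I_2) : (inr l : edge) \in legs. Proof. by rewrite inE. Qed.

Lemma stable_legs : stable rot legs.
Proof. by apply/stableP => -[[v i]|l]; rewrite !inE // rotationE. Qed.

Lemma card_legs : #|legs| = 2.
Proof.
have -> : legs = [set (inr l : edge) | l : 'I_2].
  apply/setP => -[[v i]|l]; rewrite inE; last by rewrite imset_f.
  by apply/esym/imsetP => -[].
by rewrite card_imset ?card_ord // => a b [].
Qed.

Lemma card_half_edge : #|edge| = (6 * j + 2)%N.
Proof. by rewrite card_sum card_prod !card_ord mulnC. Qed.

Lemma card_vertex_orbit (v : 'I_j) (i : 'I_6) : #|porbit rot (inl (v, i))| = 6%N.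
Proof.
have -> : porbit rot (inl (v, i)) = [set (inl (v, k) : edge) | k : 'I_6].
  rewrite porbit_rotation; apply/setP => -[[w k]|l]; rewrite inE /=.
    apply/eqP/imsetP => [[->]|[k' _ [-> _]] //]; by exists k.
  by apply/esym/imsetP => -[].
by rewrite card_imset ?card_ord // => a b [].
Qed.

Lemma porbit_leg (l : 'I_2) : porbit rot (inr l) = [set inr l].
Proof.
rewrite porbit_rotation; apply/setP => -[[w k]|l']; rewrite !inE //=.
Qed.

Lemma degrees_legs :
  perm_eq (degrees [set: edge] (cycles_in rot legs)) [:: 1; 1]%N.
Proof.
have -> : cycles_in rot legs = [set inr ord0] |: ([set inr ord_max] |: set0).
  apply/setP => c; apply/(cycles_inP _ stable_legs)/idP => [[[[v i]|l]]|].
  - by rewrite inE.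
  - move=> _ ->; rewrite porbit_leg !inE.
    by case: l => -[|[|]] // lt_l; apply/orP; [left|right; rewrite orbF];
       apply/eqP; congr [set inr _]; apply: val_inj.
  rewrite !inE orbF => /orP[] /eqP ->.
    by exists (inr ord0); rewrite ?mem_legs ?porbit_leg.
  by exists (inr ord_max); rewrite ?mem_legs ?porbit_leg.
apply: perm_trans (degrees_setU1 _ _) _; last first.
  rewrite setIT cards1 perm_cons; apply: perm_trans (degrees_setU1 _ _) _.
    by rewrite inE.
  by rewrite setIT cards1 /degrees enum_set0.
rewrite !inE orbF; apply/eqP => /setP/(_ (inr ord0)).
by rewrite !inE eqxx.
Qed.

Lemma is_matchingE m : is_matching m = (m \in pairings [set: edge]).
Proof.
rewrite inE; apply: eq_forallb => h; rewrite inE andbC; by case: (_ != _).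
Qed.

Lemma even_stable_involution (T : finType) (m : {perm T}) (C : {set T}) :
    (forall x, m (m x) = x) -> (forall x, x \in C -> m x != x) -> stable m C ->
  ~~ odd #|C|.
Proof.
move=> invol; have [n] := ubnP #|C|; elim: n C => // n IHn C ltC nofix stC.
have [->|[x xC]] := set_0Vmem C; first by rewrite cards0.
have mxC : m x \in C by apply: (stableP _ _ stC).
have cardC : #|C| = #|C :\ x :\ m x|.+2.
  by rewrite (cardsD1 x) xC (cardsD1 (m x) (C :\ x)) !inE nofix ?mxC.
rewrite cardC /= negbK; apply: IHn => [|y|].
- by move: ltC; rewrite cardC; lia.
- by rewrite !inE => /and3P[_ _ /nofix].
apply/stableP => y; rewrite !inE => /and3P[neq_ymx neq_yx yC].
rewrite (inj_eq perm_inj) neq_yx (stableP _ _ stC) // andbT.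
by rewrite -[X in _ != X](invol x) (inj_eq perm_inj).
Qed.

Lemma adjacentP m (u v : vertex j) :
  reflect (exists2 h, vertex_of h = u & vertex_of (m h) = v) (adjacent m u v).
Proof.
apply: (iffP existsP) => [[h /andP[/eqP ? /eqP ?]]|[h <- <-]]; first by exists h.
by exists h; rewrite !eqxx.
Qed.

Lemma vertex_of_onto (v : vertex j) : exists h : edge, vertex_of h = v.
Proof. by case: v => [v|l]; [exists (inl (v, ord0))|exists (inr l)]. Qed.

Lemma stable_rotation C h k : stable rot C -> h \in C ->
  vertex_of k = vertex_of h -> k \in C.
Proof.
move=> stC hC eq_v; apply: (subsetP (stable_porbit stC hC)).
by rewrite porbit_rotation inE eq_v.
Qed.

(** Each vertex in the set contributes six half-edges and exactly one leg contributes one. *)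
Lemma odd_component (D : {set edge}) (V : pred 'I_j) :
    (forall v i, (inl (v, i) \in D) = V v) ->
    inr ord0 \in D -> inr ord_max \notin D ->
  odd #|D|.
Proof.
move=> DV D0 D1; rewrite -sum1_card big_mkcond /= big_sumType /=.
rewrite big_ord_recl big_ord1 D0 ifN; last first.
  by rewrite (_ : lift ord0 ord0 = ord_max) //; apply: val_inj.
rewrite addn0 oddD addbT; have -> : (\sum_i (if inl i \in D then 1 else 0))%N =
    (\sum_(v < j) \sum_(i < 6) (if inl (v, i) \in D then 1 else 0))%N.
  by rewrite pair_bigA; apply: eq_bigr => -[].
under eq_bigr do under eq_bigr do rewrite DV.
under eq_bigr do rewrite sum_nat_const card_ord.
by rewrite -big_distrr oddM.
Qed.

(* Each component has an even number of half-edges, while the components of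
   the legs would have odd ones if the legs were not connected to each other. *)
Lemma connected_reaches m : m \in pairings [set: edge] ->
  connected_graph m = reaches rot m legs.
Proof.
move=> /pairingsP[invol supp].
have nofix h : m h != h by rewrite supp inE.
have adj_sym : symmetric (adjacent m).
  by move=> u v; apply/adjacentP/adjacentP => -[h <- <-]; exists (m h); rewrite ?invol.
have conn_sym : connect_sym (adjacent m) by apply: sym_connect_sym.
have adj_m h : adjacent m (vertex_of h) (vertex_of (m h)) by apply/adjacentP; exists h.
apply/forallP/forallP => [conn C|reach u].
  apply/implyP => /and3P[legsC strot stm].
  have closedD : closed (adjacent m) [pred v | [forall h, (vertex_of h == v) ==> (h \in C)]].
    apply: intro_closed => // u v /adjacentP[h <- <-]; rewrite !inE => /forallP hC.
    have /implyP/(_ (eqxx _)) hC' := hC h.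
    apply/forallP => k; apply/implyP => /eqP eq_k.
    by apply: stable_rotation strot _ eq_k; apply: (stableP _ _ stm).
  apply/eqP/setP => h; rewrite inE.
  have leg0 : inr ord0 \in [pred v : vertex j | [forall h, (vertex_of h == v) ==> (h \in C)]].
    rewrite inE; apply/forallP => k; apply/implyP => /eqP eq_k.
    have lC : (inr ord0 : edge) \in C by apply: (subsetP legsC); rewrite mem_legs.
    exact: stable_rotation strot lC eq_k.
  have /forallP/(_ (vertex_of h)) c0 := conn (inr ord0).
  move: leg0; rewrite (closed_connect closedD c0) inE => /forallP/(_ h).
  by rewrite eqxx.
pose D := [set h : edge | connect (adjacent m) (inr ord0) (vertex_of h)].
have strotD : stable rot D.
  apply/stableP => h; rewrite !inE rotationE.
  by have -> : vertex_of (next_half_edge h) = vertex_of h by case: h => [[]|].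
have stmD : stable m D.
  apply/stableP => h; rewrite !inE => /connect_trans; apply.
  exact/connect1/adj_m.
have D0 : inr ord0 \in D by rewrite inE connect0.
have D1 : inr ord_max \in D.
  apply: contraT => nD1; have := even_stable_involution invol (fun h _ => nofix h) stmD.
  rewrite (odd_component (V := fun v => connect (adjacent m) (inr ord0) (inl v))) //.
  by move=> v i; rewrite inE.
have legsD : legs \subset D.
  apply/subsetP => -[[v i]|l]; rewrite !inE // => _.
  case: l => -[|[|]] // lt_l.
    by rewrite (_ : Ordinal lt_l = ord0) ?connect0 //; apply: val_inj.
  by move: D1; rewrite inE (_ : Ordinal lt_l = ord_max) //; apply: val_inj.
have /implyP := reach D; rewrite legsD strotD stmD => /(_ isT)/eqP DT.
have conn0 v : connect (adjacent m) (inr ord0) v.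
  have [h <-] := vertex_of_onto v.
  have hD : h \in D by rewrite DT inE.
  by rewrite inE in hD.
by apply/forallP => v; rewrite (connect_trans _ (conn0 v)) // conn_sym.
Qed.

Definition faces m := #|porbits (m * rot)%g|.

Lemma card_porbits_matching m : m \in pairings [set: edge] ->
  #|porbits m| = (3 * j + 1)%N.
Proof.
move=> /pairingsP[invol supp].
have porbitE h : porbit m h = [set h; m h].
  apply/eqP; rewrite eqEsubset; apply/andP; split.
    apply: stable_porbit; last by rewrite !inE eqxx.
    by apply/stableP => k; rewrite !inE => /orP[] /eqP ->; rewrite ?invol eqxx ?orbT.
  by apply/subsetP => k; rewrite !inE => /orP[] /eqP ->; rewrite ?porbit_id //
    (mem_porbit_iter m h 1).
have : (\sum_(c in porbits m) #|c| = #|edge|)%N.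
  rewrite -sum1_card (partition_big (porbit m) [in porbits m]) => [|h _] /=; last first.
    exact: imset_f.
  apply: eq_bigr => c /imsetP[h _ ->]; rewrite -sum1_card; apply: eq_bigl => k.
  by rewrite /= eq_porbit_mem.
rewrite card_half_edge (eq_bigr (fun _ => 2%N)) => [|c /imsetP[h _ ->]].
  by rewrite sum_nat_const; lia.
by rewrite porbitE cards2 eq_sym supp inE.
Qed.

Lemma card_porbits_rotation : #|porbits rot| = (j + 2)%N.
Proof.
have -> : porbits rot = [set [set h : edge | vertex_of h == v] | v : vertex j].
  apply/setP => c; apply/imsetP/imsetP => [[h _ ->]|[v _ ->]].
    by exists (vertex_of h); rewrite ?porbit_rotation.
  by have [h <-] := vertex_of_onto v; exists h; rewrite ?porbit_rotation.
rewrite card_imset; first by rewrite card_sum !card_ord.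
move=> u v /setP eq_uv; have [h eq_h] := vertex_of_onto u.
by have := eq_uv h; rewrite !inE eq_h eqxx => /esym/eqP.
Qed.

(** Compare signs: a permutation has the parity of the number of points minus the number of cycles.
    The matching gives 3 j + 1 and the rotation 5 j, so their product is odd on 6 j + 2 points. *)
Lemma odd_faces m : m \in pairings [set: edge] -> odd (faces m).
Proof.
move=> pm; have := odd_permM m rot; rewrite /odd_perm /aperm /= -/(faces m).
rewrite card_porbits_matching // card_porbits_rotation card_half_edge.
lia.
Qed.

(** Euler's formula with j + 2 vertices and 3 j + 1 edges. *)
Lemma has_genusE m g : m \in pairings [set: edge] ->
  has_genus m g = (faces m + 2 * g == 2 * j + 1)%N.
Proof.
move=> pm; rewrite /has_genus /euler_char -/(faces m) card_porbits_matching //.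
by rewrite card_sum !card_ord; lia.
Qed.

Section FacePolynomial.
Variable F : numFieldType.

Definition face_poly : {poly F} := (j`!%:R)^-1 *:
  \sum_(m : {perm edge} | (m \in pairings setT) && reaches rot m legs) 'X^(faces m).

Lemma coef_face_poly i : face_poly`_i = (j`!%:R)^-1 *
  #|[set m : {perm edge} | [&& m \in pairings setT, reaches rot m legs
                             & faces m == i]]|%:R.
Proof.
rewrite coefZ coef_sum; congr (_ * _).
under eq_bigr do rewrite coefXn eq_sym.
rewrite -natr_sum -sum1_card -big_mkcondr /=; congr (_%:R).
by apply: eq_bigl => m; rewrite [RHS]in_set andbA.
Qed.

Lemma coef_face_poly_even i : ~~ odd i -> face_poly`_i = 0.
Proof.
move=> even_i; rewrite coef_face_poly eq_card0 ?mulr0 // => m; rewrite in_set.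
apply/negP => /and3P[pm _ /eqP eq_i].
by move: even_i; rewrite -eq_i odd_faces.
Qed.

Lemma fact_neq0 n : n`!%:R != 0 :> F.
Proof. by rewrite pnatr_eq0 -lt0n fact_gt0. Qed.

Lemma NgraphE g : (2 * g <= 2 * j + 1)%N ->
  (Ngraph g 6 j)%:R = j`!%:R * face_poly`_(2 * j + 1 - 2 * g).
Proof.
move=> le_g; rewrite coef_face_poly mulrA divff ?fact_neq0 // mul1r.
congr (_%:R); apply: eq_card => m; rewrite [LHS]in_set [RHS]in_set is_matchingE.
apply: andb_id2l => pm; rewrite connected_reaches // has_genusE //.
by congr (_ && _); apply/eqP/eqP; lia.
Qed.

Lemma Ngraph_eq0 g : (2 * j + 1 < 2 * g)%N -> Ngraph g 6 j = 0%N.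
Proof.
move=> lt_g; apply: eq_card0 => m; rewrite in_set is_matchingE.
by apply/negP => /and3P[pm _]; rewrite has_genusE // => /eqP; lia.
Qed.

(** Exploration starts at the legs, two explored vertices of degree 1; its factor j! cancels the one
    in [face_poly]. These values at all positive integers determine the polynomial. *)
Lemma horner_face_poly N : face_poly.[N.+1%:R] = freud_series F N.+1 j.
Proof.
have := @explored_sum_two_legs F edge rot setT legs j N stable_legs.
rewrite hornerZ horner_sum => sumE; apply: (mulfI (fact_neq0 j)).
rewrite mulrA divff ?fact_neq0 // mul1r -sumE.
- by apply: eq_bigr => m _; rewrite hornerXn.
- move=> [[v i]|l]; last by rewrite mem_legs.
  by rewrite inE card_vertex_orbit.
- have := cardsC legs; rewrite card_legs card_half_edge; lia.
exact: degrees_legs.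
Qed.

End FacePolynomial.
End RibbonGraphs.

(** * Solving the genus 1 and genus 2 equations over a differential ring *)

Section GenusSolution.
Variables (A : comNzRingType) (theta : A -> A) (x u v : A).
Hypothesis natI : forall k (a b : A), k.+1%:R * a = k.+1%:R * b -> a = b.
Hypothesis thetaD : forall a b, theta (a + b) = theta a + theta b.
Hypothesis thetaN : forall a, theta (- a) = - theta a.
Hypothesis thetaM : forall a b, theta (a * b) = theta a * b + a * theta b.
Hypothesis theta_nat : forall k, theta k%:R = 0.
Hypothesis theta_x : theta x = x.
Local Notation y := (1 + u).
Hypothesis u_eq : u = 60%:R * x * y ^+ 3.
Hypothesis v_inv : v * (1 - 2%:R * u) = 1.

Lemma theta_pow a n : theta (a ^+ n.+1) = n.+1%:R * a ^+ n * theta a.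
Proof.
elim: n => [|n IHn]; first by rewrite expr1 expr0 mulr1 mul1r.
by rewrite exprS thetaM IHn -[n.+2%:R]natr1 [a ^+ n.+1]exprS; ring.
Qed.

(** Brings all terms to one power of [v], after which an identity modulo [v_inv] becomes a
    polynomial identity in [u]. *)
Lemma v_pow k m : v ^+ k = v ^+ (k + m) * (1 - 2%:R * u) ^+ m.
Proof. by rewrite exprD -mulrA -exprMn v_inv expr1n mulr1. Qed.

(** Differentiating [u_eq] logarithmically gives (y - 3 u) theta u = u y, and y - 3 u = 1 - 2 u. *)
Lemma theta_u : theta u = u * y * v.
Proof.
have th : theta u = u + 180%:R * x * y ^+ 2 * theta u.
  rewrite {1}u_eq thetaM theta_pow thetaM theta_nat theta_x thetaD (theta_nat 1).
  transitivity (60%:R * x * y ^+ 3 + 180%:R * x * y ^+ 2 * theta u); first by ring.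
  by rewrite -u_eq.
have yth : y * theta u = y * u + 3%:R * u * theta u.
  rewrite {1}th.
  transitivity (y * u + 3%:R * (60%:R * x * y ^+ 3) * theta u); first by ring.
  by rewrite -u_eq.
rewrite -[LHS]mulr1 -[X in _ * X = _]v_inv.
have -> : theta u * (v * (1 - 2%:R * u)) = v * (y * theta u - 3%:R * u * theta u).
  by ring.
by rewrite yth; ring.
Qed.

Lemma theta_v : theta v = 2%:R * u * y * v ^+ 3.
Proof.
have : theta (v * (1 - 2%:R * u)) = 0 by rewrite v_inv (theta_nat 1).
rewrite thetaM thetaD thetaN thetaM (theta_nat 1) theta_nat theta_u => eq0.
have -> : theta v = v * (theta v * (1 - 2%:R * u)).
  by rewrite mulrCA v_inv mulr1.
have -> : theta v * (1 - 2%:R * u) = 2%:R * v * (u * y * v).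
  by apply/eqP; rewrite -subr_eq0 -{}[X in _ == X]eq0; apply/eqP; ring.
by ring.
Qed.

Lemma theta_y : theta y = u * y * v.
Proof. by rewrite thetaD (theta_nat 1) add0r theta_u. Qed.

Variables (D1 D2 D3 D4 y1 Z1 Z2 y2 : A).
Hypothesis D1_eq : D1 = 2%:R * theta y + y.
Hypothesis D2_eq : D2 = theta D1.
Hypothesis D3_eq : 3%:R * D3 = 2%:R * theta D2 - D2.
Hypothesis D4_eq : 2%:R * D4 = theta D3 - D3.
Hypothesis Z1_eq : Z1 = 2%:R * theta y1 - y1.
Hypothesis Z2_eq : Z2 = theta Z1 - Z1.
Hypothesis y1_eq : y1 = 6%:R * x *
  (y * (20%:R * y * D2 + 20%:R * y * y1 + 5%:R * D1 ^+ 2)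
   + y1 * (10%:R * y ^+ 2)).
Hypothesis y2_eq : y2 = 6%:R * x *
  (y * (44%:R * y * D4 + 20%:R * y * Z2 + 20%:R * y * y2 + 22%:R * D1 * D3
   + 10%:R * D1 * Z1 + 11%:R * D2 ^+ 2 + 20%:R * D2 * y1 + 10%:R * y1 ^+ 2)
   + y1 * (20%:R * y * D2 + 20%:R * y * y1 + 5%:R * D1 ^+ 2)
   + y2 * (10%:R * y ^+ 2)).

Lemma D1E : D1 = y * v.
Proof.
have -> : v = v * (1 - 2%:R * u) + 2%:R * u * v by ring.
by rewrite v_inv D1_eq theta_y; ring.
Qed.

Lemma D2E : D2 = 3%:R * y * u * v ^+ 3.
Proof.
rewrite D2_eq D1E thetaM theta_y theta_v.
have -> : u * y * v * v = u * y * v ^+ 2 by ring.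
by rewrite (v_pow 2 1); ring.
Qed.

Lemma D3E : D3 = y * u * (1 + 16%:R * u) * v ^+ 5.
Proof.
apply: (natI (k := 2)); rewrite D3_eq D2E thetaM theta_pow !thetaM theta_nat.
rewrite theta_y theta_u theta_v.
transitivity (6%:R * y * u ^+ 2 * v ^+ 4 + 6%:R * y ^+ 2 * u * v ^+ 4
  + 36%:R * y ^+ 2 * u ^+ 2 * v ^+ 5 - 3%:R * y * u * v ^+ 3); first by ring.
by rewrite (v_pow 4 1) (v_pow 3 2); ring.
Qed.

Lemma D4E : D4 = 15%:R * y * u ^+ 2 * (1 + 7%:R * u) * v ^+ 7.
Proof.
apply: (natI (k := 1)); rewrite D4_eq D3E thetaM theta_pow !thetaM.
rewrite [theta (1 + _ * _)]thetaD thetaM theta_nat.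
rewrite (theta_nat 1) theta_y theta_u theta_v.
transitivity (y * u ^+ 2 * (1 + 16%:R * u) * v ^+ 6
  + y ^+ 2 * u * (1 + 16%:R * u) * v ^+ 6 + 16%:R * y ^+ 2 * u ^+ 2 * v ^+ 6
  + 10%:R * y ^+ 2 * u ^+ 2 * (1 + 16%:R * u) * v ^+ 7
  - y * u * (1 + 16%:R * u) * v ^+ 5); first by ring.
by rewrite (v_pow 6 1) (v_pow 5 2); ring.
Qed.

(** The equation is linear in [y1], with total coefficient 180 x y ^ 2 on the right. After
    multiplication by y this is 3 u, so [y1] is the remaining source term divided by y - 3 u = 1 - 2
    u. *)
Lemma y1E : 2%:R * y1 = y * (u + 10%:R * u ^+ 2) * v ^+ 4.
Proof.
have step : 20%:R * y * y1 =
    60%:R * x * y ^+ 3 * (y * (120%:R * u * v ^+ 3 + 10%:R * v ^+ 2) + 60%:R * y1).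
  by rewrite {1}y1_eq D1E D2E; ring.
apply: (natI (k := 9)); rewrite -u_eq in step.
rewrite -[LHS]mulr1 -[X in _ * X = _]v_inv.
have -> : 10%:R * (2%:R * y1) * (v * (1 - 2%:R * u)) =
  v * (20%:R * y * y1 - 60%:R * u * y1) by ring.
rewrite step.
transitivity (u * y * (120%:R * u * v ^+ 4 + 10%:R * v ^+ 3)); first by ring.
by rewrite (v_pow 3 1); ring.
Qed.

Lemma Z1E : 2%:R * Z1 = y * u * (1 + 50%:R * u + 184%:R * u ^+ 2) * v ^+ 6.
Proof.
have th1 : theta (2%:R * y1) = 2%:R * theta y1.
  by rewrite thetaM theta_nat mul0r add0r.
have -> : 2%:R * Z1 = 2%:R * theta (2%:R * y1) - 2%:R * y1 by rewrite Z1_eq th1; ring.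
rewrite y1E thetaM theta_pow thetaM [theta (u + _)]thetaD thetaM theta_pow.
rewrite theta_nat theta_y theta_u theta_v.
transitivity (2%:R * y * u * (u + 10%:R * u ^+ 2) * v ^+ 5
  + 2%:R * y ^+ 2 * (u + 20%:R * u ^+ 2) * v ^+ 5
  + 16%:R * u * y ^+ 2 * (u + 10%:R * u ^+ 2) * v ^+ 6
  - y * (u + 10%:R * u ^+ 2) * v ^+ 4); first by ring.
by rewrite (v_pow 5 1) (v_pow 4 2); ring.
Qed.

Lemma Z2E : Z2 = 3%:R * y * u ^+ 2 * (11%:R + 187%:R * u + 446%:R * u ^+ 2) * v ^+ 8.
Proof.
have th1 : theta (2%:R * Z1) = 2%:R * theta Z1.
  by rewrite thetaM theta_nat mul0r add0r.
apply: (natI (k := 1)).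
have -> : 2%:R * Z2 = theta (2%:R * Z1) - 2%:R * Z1 by rewrite Z2_eq th1; ring.
rewrite Z1E thetaM theta_pow !thetaM [theta (_ + _ + _)]thetaD thetaM theta_pow.
rewrite [theta (1 + _ * _)]thetaD thetaM !theta_nat (theta_nat 1) theta_y theta_u theta_v.
transitivity (y * u ^+ 2 * (1 + 50%:R * u + 184%:R * u ^+ 2) * v ^+ 7
  + y ^+ 2 * u * (1 + 50%:R * u + 184%:R * u ^+ 2) * v ^+ 7
  + y ^+ 2 * u * (50%:R * u + 368%:R * u ^+ 2) * v ^+ 7
  + 12%:R * y ^+ 2 * u ^+ 2 * (1 + 50%:R * u + 184%:R * u ^+ 2) * v ^+ 8
  - y * u * (1 + 50%:R * u + 184%:R * u ^+ 2) * v ^+ 6); first by ring.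
by rewrite (v_pow 7 1) (v_pow 6 2); ring.
Qed.

(** Linear in [y2] with the same coefficient 1 - 2 u as for [y1]; the four integers are the
    coefficients of the numerator once the source is reduced to a single power of [v]. *)
Lemma y2E : 20%:R * y2 = y * (59%:R * u ^+ 2 + 4011%:R * u ^+ 3
  + 27528%:R * u ^+ 4 + 34268%:R * u ^+ 5) * v ^+ 9.
Proof.
(* The factor 4 clears the halves in the closed forms of [y1] and [Z1]. *)
have four_y2 : 4%:R * y2 = 6%:R * x * (y * (176%:R * y * D4 + 80%:R * y * Z2
    + 80%:R * y * y2 + 88%:R * D1 * D3 + 20%:R * D1 * (2%:R * Z1)
    + 44%:R * D2 ^+ 2 + 40%:R * D2 * (2%:R * y1) + 10%:R * (2%:R * y1) ^+ 2)
    + (2%:R * y1) * (40%:R * y * D2 + 20%:R * y * (2%:R * y1) + 10%:R * D1 ^+ 2)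
    + y2 * (40%:R * y ^+ 2)).
  by rewrite {1}y2_eq; ring.
(* [y ^+ 3 * T] is the part of the bracket in [four_y2] free of [y2], with the closed forms
   inserted. *)
pose T := 176%:R * (15%:R * u ^+ 2 * (1 + 7%:R * u) * v ^+ 7)
  + 80%:R * (3%:R * u ^+ 2 * (11%:R + 187%:R * u + 446%:R * u ^+ 2) * v ^+ 8)
  + 88%:R * (u * (1 + 16%:R * u) * v ^+ 6)
  + 20%:R * (u * (1 + 50%:R * u + 184%:R * u ^+ 2) * v ^+ 7)
  + 396%:R * (u ^+ 2 * v ^+ 6)
  + 240%:R * (u * (u + 10%:R * u ^+ 2) * v ^+ 7)
  + 30%:R * ((u + 10%:R * u ^+ 2) ^+ 2 * v ^+ 8)
  + 10%:R * ((u + 10%:R * u ^+ 2) * v ^+ 6).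
have step : 40%:R * y * y2 = 60%:R * x * y ^+ 3 * (y * T + 120%:R * y2).
  have -> : 40%:R * y * y2 = 10%:R * y * (4%:R * y2) by ring.
  by rewrite four_y2 D4E Z2E D1E D3E D2E Z1E y1E /T; ring.
rewrite -u_eq in step; apply: (natI (k := 1)).
rewrite -[LHS]mulr1 -[X in _ * X = _]v_inv.
have -> : 2%:R * (20%:R * y2) * (v * (1 - 2%:R * u)) =
  v * (40%:R * y * y2 - 120%:R * u * y2) by ring.
rewrite step (_ : v * _ = u * y * v * T); last by ring.
by rewrite /T (v_pow 7 1) (v_pow 6 2); ring.
Qed.

End GenusSolution.

(** * Maps of power series, and polynomials vanishing at infinitely many points *)

Section MapSeries.
Variables (R S : comNzRingType) (phi : {rmorphism R -> S}).

Definition map_fps (f : fps R) : fps S := fun n => phi (f n).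

Fact map_fps_zmod : zmod_morphism map_fps.
Proof. by move=> f g; apply/funext => n; rewrite /map_fps !fpsB rmorphB. Qed.

Fact map_fps_monoid : monoid_morphism map_fps.
Proof.
split=> [|f g]; apply/funext => n; first by rewrite /map_fps !fps1 rmorph_nat.
rewrite /map_fps !fpsM rmorph_sum; apply: eq_bigr => i _.
by rewrite rmorphM.
Qed.

HB.instance Definition _ := GRing.isZmodMorphism.Build _ _ map_fps map_fps_zmod.
HB.instance Definition _ := GRing.isMonoidMorphism.Build _ _ map_fps map_fps_monoid.

Lemma map_fpsX : map_fps (fpsX R) = fpsX S.
Proof. by apply/funext => n; rewrite /map_fps /fpsX rmorph_nat. Qed.

Lemma map_fpsC c : map_fps (fpsC c) = fpsC (phi c).
Proof. by apply/funext => n; rewrite /map_fps /fpsC rmorphM rmorph_nat. Qed.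

End MapSeries.

Section ScaleVariable.
Variables (R : comNzRingType) (c : R).

Definition fps_dilate (f : fps R) : fps R := fun n => c ^+ n * f n.

Fact fps_dilate_zmod : zmod_morphism fps_dilate.
Proof. by move=> f g; apply/funext => n; rewrite /fps_dilate !fpsB mulrBr. Qed.

Fact fps_dilate_monoid : monoid_morphism fps_dilate.
Proof.
split=> [|f g]; apply/funext => n.
  by rewrite /fps_dilate fps1; case: n => [|n]; rewrite ?mul1r ?mulr0.
rewrite /fps_dilate !fpsM mulr_sumr; apply: eq_bigr => i _.
by rewrite mulrACA -exprD subnKC // -ltnS.
Qed.

HB.instance Definition _ :=
  GRing.isZmodMorphism.Build _ _ fps_dilate fps_dilate_zmod.
HB.instance Definition _ :=
  GRing.isMonoidMorphism.Build _ _ fps_dilate fps_dilate_monoid.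

Lemma fps_dilateX : fps_dilate (fpsX R) = fpsC c * fpsX R.
Proof.
apply/funext => n; rewrite fpsCM /fps_dilate /fpsX.
by case: n => [|[|n]]; rewrite ?mulr0 // expr1.
Qed.

End ScaleVariable.

Lemma poly_eq0_inj (F : idomainType) (p : {poly F}) (x : nat -> F) :
  injective x -> (forall n, p.[x n] = 0) -> p = 0.
Proof.
move=> injx px0; apply/eqP; apply: contraT => nz_p.
have := max_poly_roots (rs := [seq x i | i <- iota 0 (size p)]) nz_p.
rewrite size_map size_iota ltnn; apply.
  by apply/allP => _ /mapP[i _ ->]; apply/eqP.
by rewrite map_inj_uniq ?iota_uniq.
Qed.

Lemma natr_inj (F : numFieldType) k : injective (fun n => (n + k)%:R : F).
Proof. by move=> m n /eqP; rewrite eqr_nat eqn_add2r => /eqP. Qed.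

(** * Expansion of the string equation in powers of 1 / N *)

Section GenusExpansion.
Variables (F : numFieldType) (f : nat -> {poly F}).
Hypothesis horner_f : forall N n, (f n).[N.+1%:R] = freud_series F N.+1 n.
Hypothesis f_even : forall n i, ~~ odd i -> (f n)`_i = 0.

(* The ten products occurring in the string equation, shifted by
   [-2], [-1], [0], [1], [2] from the centre. *)
Definition freud_sum (A : comNzRingType) (a b c d e : A) : A :=
  a * b + b * b + 2%:R * (b * c) + b * d + c * c + 2%:R * (c * d) + d * d + d * e.

Lemma rmorph_freud_sum (A B : comNzRingType) (phi : {rmorphism A -> B}) a b c d e :
  phi (freud_sum a b c d e) =
  freud_sum (phi a) (phi b) (phi c) (phi d) (phi e).
Proof. by rewrite /freud_sum !rmorphD !rmorphM !rmorph_nat. Qed.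

Lemma freud_sum_center (A : comNzRingType) (t x b q : A) :
  t = b * (1 - 6%:R * x * q) -> b = t + 6%:R * x * (b * q).
Proof. by move=> ->; ring. Qed.

Lemma freud_series_center n : freud_series F n.+3 =
  fpsC n.+3%:R + 6%:R * fpsX F * (freud_series F n.+3 *
    freud_sum (freud_series F n.+1) (freud_series F n.+2) (freud_series F n.+3)
              (freud_series F n.+4) (freud_series F n.+4.+1)).
Proof.
rewrite (rmorph_nat (@fpsC F)); apply: freud_sum_center.
exact: (freud_series_string F n).
Qed.

Definition shifted_series (p : F) : fps {poly F} := fun n => f n \Po ('X + p%:P).

Lemma eval_shifted p n m : n.+3%:R + p = m.+1%:R ->
  map_fps (horner_eval n.+3%:R) (shifted_series p) = freud_series F m.+1.
Proof.
move=> eq_m; apply/funext => k; rewrite /map_fps /= /horner_eval /shifted_series.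
by rewrite horner_comp !hornerE eq_m horner_f.
Qed.

Local Notation G := shifted_series.

(** Evaluated at n + 3, coefficient by coefficient, this is Freud's equation, with shifts that stay
    at positive indices; infinitely many evaluations determine a polynomial. *)
Lemma shifted_series_string :
  G 0 = fpsC 'X + 6%:R * fpsX {poly F} *
          (G 0 * freud_sum (G (- 2)) (G (- 1)) (G 0) (G 1) (G 2)).
Proof.
apply/eqP; rewrite -subr_eq0; apply/eqP; set lhs := LHS.
apply/funext => k; apply: (poly_eq0_inj (natr_inj (F := F) (k := 3))) => n.
rewrite addn3.
have : map_fps (horner_eval (n.+3%:R : F)) lhs = 0.
  have s0 : n.+3%:R + 0 = n.+3%:R :> F by rewrite addr0.
  have s1 : n.+3%:R + 1 = n.+4%:R :> F by rewrite natr1.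
  have s2 : n.+3%:R + 2 = n.+4.+1%:R :> F by rewrite -natrD addn2.
  have sm1 : n.+3%:R - 1 = n.+2%:R :> F by rewrite -natr1 addrK.
  have sm2 : n.+3%:R - 2 = n.+1%:R :> F by rewrite -(addn2 n.+1) natrD addrK.
  rewrite rmorphB rmorphD !rmorphM !rmorph_nat rmorph_freud_sum /=.
  rewrite map_fpsX map_fpsC (eval_shifted s0) (eval_shifted s1) (eval_shifted s2).
  rewrite (eval_shifted sm1) (eval_shifted sm2) /= /horner_eval hornerX.
  by rewrite [X in X - _]freud_series_center subrr.
by move/(congr1 (@^~ k)).
Qed.

Lemma size_coef_mul (A B : fps {poly F}) a b n :
    (forall i, (i <= n)%N -> (size (A i) <= 2 * i + a.+1)%N) ->
    (forall i, (i <= n)%N -> (size (B i) <= 2 * i + b.+1)%N) ->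
  forall i, (i <= n)%N -> (size ((A * B)%R i) <= 2 * i + (a + b).+1)%N.
Proof.
move=> szA szB i le_in; rewrite fpsM; apply: (leq_trans (size_sum _ _ _)).
apply/bigmax_leqP => k _; apply: (leq_trans (size_polyMleq _ _)).
have le_ki := leq_ord k; have := szA _ (leq_trans le_ki le_in).
have := szB _ (leq_trans (leq_subr k i) le_in).
by move: (size _) (size _) => sA sB; lia.
Qed.

Lemma size_shifted p n : size (G p n) = size (f n).
Proof. by rewrite /shifted_series size_comp_poly2 // size_XaddC. Qed.

Lemma f0E : f 0 = 'X.
Proof.
have := congr1 (@^~ 0%N) shifted_series_string; rewrite fpsD -mulrA fps_natM fpsXM mulr0.
rewrite addr0 /fpsC mul1r => <-.
by rewrite /shifted_series addr0 comp_polyXr.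
Qed.

(** By the string equation, coefficient n + 1 is a combination of triple products of total index n,
    each of degree at most 2 n + 3 = 2 (n + 1) + 1. *)
Lemma size_f n : (size (f n) <= 2 * n + 2)%N.
Proof.
suff : forall i, (i <= n)%N -> (size (f i) <= 2 * i + 2)%N by apply.
elim: n => [|n IHn] i.
  by rewrite leqn0 => /eqP ->; rewrite f0E size_polyX.
rewrite leq_eqVlt => /orP[/eqP -> {i}|]; last exact: IHn.
have szG p i : (i <= n)%N -> (size (G p i) <= 2 * i + 2)%N.
  by rewrite size_shifted; apply: IHn.
have szGG p q i : (i <= n)%N -> (size ((G p * G q)%R i) <= 2 * i + 3)%N.
  exact: (@size_coef_mul _ _ 1 1 n (szG p) (szG q) i).
have szD (A B : fps {poly F}) : (forall i, (i <= n)%N -> (size (A i) <= 2 * i + 3)%N) ->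
    (forall i, (i <= n)%N -> (size (B i) <= 2 * i + 3)%N) ->
    forall i, (i <= n)%N -> (size ((A + B)%R i) <= 2 * i + 3)%N.
  move=> szA szB i le_in; rewrite fpsD (leq_trans (size_polyD _ _)) //.
  by rewrite geq_max szA ?szB.
have sz2 p q i : (i <= n)%N -> (size ((2%:R * (G p * G q))%R i) <= 2 * i + 3)%N.
  rewrite mulr_natl mulr2n; exact: (szD _ _ (szGG p q) (szGG p q)).
have szS : forall i, (i <= n)%N ->
    (size (freud_sum (G (- 2)) (G (- 1)) (G 0) (G 1) (G 2) i) <= 2 * i + 3)%N.
  rewrite /freud_sum.
  exact: (szD _ _ (szD _ _ (szD _ _ (szD _ _ (szD _ _ (szD _ _ (szD _ _
    (szGG _ _) (szGG _ _)) (sz2 _ _)) (szGG _ _)) (szGG _ _)) (sz2 _ _))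
    (szGG _ _)) (szGG _ _)).
have := congr1 (@^~ n.+1) shifted_series_string.
rewrite fpsD -mulrA fps_natM fpsXM /fpsC mul0r add0r => eq_f.
rewrite -(size_shifted 0) eq_f -(rmorph_nat (@polyC F)) mul_polyC.
rewrite (leq_trans (size_scale_leq _ _)) //.
by apply: leq_trans (@size_coef_mul _ _ 1 2 n (szG 0) szS n (leqnn _)) _; lia.
Qed.

(* With [x = 1 / t], the series [reversed_series p] collects
   [t ^ (2 n + 1) * (f n).[x + p]]. *)
Definition reversed_series (p : F) : fps {poly F} := fun n =>
  \sum_(l < 2 * n + 2)
    (f n)`_(2 * n + 1 - l) *: ('X^l * (1 + p *: 'X) ^+ (2 * n + 1 - l)).

Local Notation R_ := reversed_series.

Lemma eval_reversed p k m : k.+3%:R + p = m.+1%:R ->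
  map_fps (horner_eval (k.+3%:R^-1)) (R_ p) =
  fpsC (k.+3%:R^-1) * fps_dilate (k.+3%:R ^- 2) (freud_series F m.+1).
Proof.
move=> eq_m; have x_neq0 : k.+3%:R != 0 :> F by rewrite pnatr_eq0.
apply/funext => n; rewrite fpsCM /fps_dilate -horner_f /map_fps /= /horner_eval.
set x : F := k.+3%:R in eq_m x_neq0 *.
rewrite [in RHS](horner_coef_wide _ (size_f n)) -eq_m !mulr_sumr horner_sum.
rewrite (reindex_inj rev_ord_inj); apply: eq_bigr => l _ /=.
have lt_l := ltn_ord l; have -> : (2 * n + 1 - (2 * n + 2 - l.+1) = l)%N by lia.
rewrite !hornerE.
have -> : (2 * n + 2 - l.+1 = 2 * n + 1 - l)%N by lia.
have -> : 1 + p / x = (x + p) / x by rewrite mulrDl divff.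
rewrite /= expr_div_n -!exprVn -exprM -exprS.
have eX : x^-1 ^+ (2 * n + 1 - l) * x^-1 ^+ l = x^-1 ^+ (2 * n).+1.
  by rewrite -exprD subnK ?addn1 //; lia.
by rewrite -eX; ring.
Qed.

Lemma freud_sum_scale (A : comNzRingType) (c a1 a2 a3 a4 a5 : A) :
  freud_sum (c * a1) (c * a2) (c * a3) (c * a4) (c * a5) =
  c * c * freud_sum a1 a2 a3 a4 a5.
Proof. by rewrite /freud_sum; ring. Qed.

(** At x = 1 / N the series [R_ p] is beta_(N + p) with s replaced by s / N ^ 2, divided by N. This
    scaling turns the term N of the string equation into 1 and preserves the cubic term. *)
Lemma reversed_series_string :
  R_ 0 = 1 + 6%:R * fpsX {poly F} *
          (R_ 0 * freud_sum (R_ (- 2)) (R_ (- 1)) (R_ 0) (R_ 1) (R_ 2)).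
Proof.
apply/eqP; rewrite -subr_eq0; apply/eqP; set lhs := LHS.
have inj_inv : injective (fun n => n.+3%:R^-1 : F).
  by move=> m n /invr_inj /eqP; rewrite eqr_nat !eqSS => /eqP.
apply/funext => k; apply: (poly_eq0_inj inj_inv) => n.
have : map_fps (horner_eval (n.+3%:R^-1 : F)) lhs = 0.
  have s0 : n.+3%:R + 0 = n.+3%:R :> F by rewrite addr0.
  have s1 : n.+3%:R + 1 = n.+4%:R :> F by rewrite natr1.
  have s2 : n.+3%:R + 2 = n.+4.+1%:R :> F by rewrite -natrD addn2.
  have sm1 : n.+3%:R - 1 = n.+2%:R :> F by rewrite -natr1 addrK.
  have sm2 : n.+3%:R - 2 = n.+1%:R :> F by rewrite -(addn2 n.+1) natrD addrK.
  rewrite rmorphB rmorphD !rmorphM !rmorph_nat rmorph_freud_sum rmorph1 /=.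
  rewrite map_fpsX (eval_reversed s0) (eval_reversed s1) (eval_reversed s2).
  rewrite (eval_reversed sm1) (eval_reversed sm2).
  have x_neq0 : n.+3%:R != 0 :> F by rewrite pnatr_eq0.
  have cx : fpsC (n.+3%:R^-1) * n.+3%:R = 1 :> fps F.
    by rewrite -(rmorph_nat (@fpsC F)) -rmorphM mulVf ?rmorph1.
  have cc : fpsC (n.+3%:R ^- 2) = fpsC (n.+3%:R^-1) * fpsC (n.+3%:R^-1) :> fps F.
    by rewrite -rmorphM expr2 invfM.
  have := freud_series_center n; move: (freud_series F n.+1) (freud_series F n.+2).
  move: (freud_series F n.+3) (freud_series F n.+4) (freud_series F n.+4.+1).
  move=> b3 b4 b5 b1 b2 /(congr1 (fps_dilate (n.+3%:R ^- 2))).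
  rewrite rmorphD !rmorphM !rmorph_nat rmorph_freud_sum /= fps_dilateX cc.
  rewrite freud_sum_scale; set q := freud_sum _ _ _ _ _.
  move: q (fps_dilate _ b3) => q b.
  move: cx; move: (fpsC n.+3%:R^-1) (n.+3%:R : fps F) (fpsX F) => c x t cx.
  by move=> eq_b; rewrite {1}eq_b mulrDr cx; ring.
by move/(congr1 (@^~ k)).
Qed.

Definition coef_fps i (A : fps {poly F}) : fps F := fun n => (A n)`_i.

Lemma coef_fpsD i A B : coef_fps i (A + B) = coef_fps i A + coef_fps i B.
Proof. by apply/funext => n; rewrite /coef_fps fpsD coefD. Qed.

Lemma coef_fpsM i A B : coef_fps i (A * B) =
  \sum_(a < i.+1) coef_fps a A * coef_fps (i - a) B.
Proof.
apply/funext => n; rewrite /coef_fps fps_sum fpsM coef_sum.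
under eq_bigr do rewrite coefM.
by rewrite exchange_big; apply: eq_bigr => a _; rewrite fpsM.
Qed.

Lemma coef_fps_nat i k A : coef_fps i (k%:R * A) = k%:R * coef_fps i A.
Proof.
apply/funext => n; rewrite fps_natM /coef_fps fps_natM.
by rewrite !mulr_natl coefMn.
Qed.

Lemma coef_fpsX i A : coef_fps i (fpsX {poly F} * A) = fpsX F * coef_fps i A.
Proof.
by apply/funext => n; rewrite fpsXM /coef_fps fpsXM; case: n; rewrite ?coef0.
Qed.

Lemma coef_fps1 i : coef_fps i 1 = (i == 0)%:R.
Proof.
apply/funext => n; rewrite /coef_fps fps1 fps_nat.
by case: n => [|n]; rewrite ?coef1 ?mul1r // coef0 mul0r.
Qed.

(* The indices [2 n + 1 - 2 g] are truncated at [0], where the coefficient of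
   the odd polynomial [f n] vanishes anyway. *)
Definition genus_series g : fps F := fun n => (f n)`_(2 * n + 1 - 2 * g).

(** The k-th Taylor coefficient in the shift p of the genus g monomial (N + p) ^ (2 n + 1 - 2 g),
    stripped of its power of N. *)
Definition binomial_series g k : fps F :=
  fun n => 'C(2 * n + 1 - 2 * g, k)%:R * genus_series g n.

Lemma coef_linear_pow (p : F) n k : ((1 + p *: 'X) ^+ n)`_k = 'C(n, k)%:R * p ^+ k.
Proof.
rewrite exprDn coef_sum.
under eq_bigr do rewrite expr1n mul1r exprZn coefMn coefZ coefXn.
have [lt_kn|le_nk] := ltnP k n.+1.
  rewrite (bigD1 (Ordinal lt_kn)) //= eqxx mulr1 mulr_natl big1 ?addr0 // => i ne_i.
  by move: ne_i; rewrite -val_eqE /= eq_sym => /negPf ->; rewrite mulr0 mul0rn.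
rewrite bin_small // mul0r big1 // => i _.
by rewrite gtn_eqF ?mulr0 ?mul0rn // (leq_trans (ltn_ord i)).
Qed.

(** The order i splits as l from the genus l / 2 and i - l from the expansion in the shift; odd l
    drop out because [f n] is odd. *)
Lemma coef_reversed p i : coef_fps i (R_ p) =
  \sum_(l < i.+1 | ~~ odd l) fpsC (p ^+ (i - l)) * binomial_series l./2 (i - l).
Proof.
apply/funext => n; rewrite fps_sum /coef_fps /R_ coef_sum.
pose T l := (f n)`_(2 * n + 1 - l) * (if (i < l)%N then 0 else
  'C(2 * n + 1 - l, i - l)%:R * p ^+ (i - l)).
transitivity (\sum_(l < 2 * n + 2) T l).
  by apply: eq_bigr => l _; rewrite coefZ coefXnM coef_linear_pow.
transitivity (\sum_(l < maxn (2 * n + 2) i.+1) T l).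
  rewrite (big_ord_widen _ T (leq_maxl _ i.+1)) big_mkcond; apply: eq_bigr => l _.
  case: ltnP => // le_l; rewrite /T (_ : 2 * n + 1 - l = 0)%N; last by lia.
  by rewrite f_even ?mul0r.
rewrite [RHS]big_mkcond /=; pose T' l := if ~~ odd l then
  (fpsC (p ^+ (i - l)) * binomial_series l./2 (i - l)) n else 0.
rewrite -[RHS]/(\sum_(l < i.+1) T' l).
rewrite [RHS](eq_bigr (fun l : 'I_i.+1 => T l)); last first.
  move=> l _; rewrite /T' /T ltnNge leq_ord /= fpsCM /binomial_series /genus_series.
  case: ifP => odd_l.
    have -> : (2 * l./2 = l)%N by lia.
    by rewrite mulrC -mulrA mulrCA.
  by rewrite f_even ?mul0r //; lia.
rewrite [RHS](big_ord_widen _ T (leq_maxr (2 * n + 2) i.+1)) [in RHS]big_mkcond.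
apply: eq_bigr => l _; case: ltnP => // lt_il.
by rewrite /T lt_il mulr0.
Qed.

Local Notation y := (genus_series 0).
Local Notation y1 := (genus_series 1).
Local Notation y2 := (genus_series 2).
Local Notation D := (binomial_series 0).
Local Notation Z := (binomial_series 1).

Lemma binomial_series0 g : binomial_series g 0 = genus_series g.
Proof. by apply/funext => n; rewrite /binomial_series bin0 mul1r. Qed.

Lemma coef0_reversed p : coef_fps 0 (R_ p) = y.
Proof.
rewrite coef_reversed big_mkcond !big_ord_recl big_ord0 /= !subnn.
by rewrite binomial_series0 expr0 rmorph1 mul1r addr0.
Qed.

Lemma coef1_reversed p : coef_fps 1 (R_ p) = fpsC p * D 1.
Proof.
rewrite coef_reversed big_mkcond !big_ord_recl big_ord0 /= subn0.
by rewrite expr1 !addr0.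
Qed.

Lemma coef2_reversed p : coef_fps 2 (R_ p) = fpsC p ^+ 2 * D 2 + y1.
Proof.
rewrite coef_reversed big_mkcond !big_ord_recl big_ord0 /= subn0 subnn.
by rewrite rmorphXn binomial_series0 expr0 rmorph1 mul1r addr0 add0r.
Qed.

Lemma coef3_reversed p : coef_fps 3 (R_ p) = fpsC p ^+ 3 * D 3 + fpsC p * Z 1.
Proof.
rewrite coef_reversed big_mkcond !big_ord_recl big_ord0 /= subn0.
by rewrite rmorphXn !addr0 add0r.
Qed.

Lemma coef4_reversed p : coef_fps 4 (R_ p) =
  fpsC p ^+ 4 * D 4 + fpsC p ^+ 2 * Z 2 + y2.
Proof.
rewrite coef_reversed big_mkcond !big_ord_recl big_ord0 /= /bump /= ?(subSS, subn0).
by rewrite !rmorphXn binomial_series0 expr0 mul1r addr0 !add0r addrA.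
Qed.

Definition coef_reversedE := (coef0_reversed, coef1_reversed, coef2_reversed,
  coef3_reversed, coef4_reversed).

Lemma coef_freud_sum i (a b c d e : fps {poly F}) :
  let T u v := \sum_(k < i.+1) coef_fps k u * coef_fps (i - k) v in
  coef_fps i (freud_sum a b c d e) =
  T a b + T b b + 2%:R * T b c + T b d + T c c + 2%:R * T c d + T d d + T d e.
Proof. by rewrite /freud_sum !coef_fpsD !coef_fps_nat !coef_fpsM. Qed.

Local Notation S_ i :=
  (coef_fps i (freud_sum (R_ (- 2)) (R_ (- 1)) (R_ 0) (R_ 1) (R_ 2))).

Lemma coef0_freud_sum : S_ 0 = 10%:R * y ^+ 2.
Proof.
by rewrite coef_freud_sum /= !big_ord_recl !big_ord0 /= !coef_reversedE; ring.
Qed.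

(** The coefficients are moments of the ten pairs (p, q) of shifts: p ^ 2 + q ^ 2 sums to 20 and p q
    to 5. Likewise at order 4, p ^ 4 + q ^ 4 sums to 44, p q ^ 3 + p ^ 3 q to 22 and p ^ 2 q ^ 2 to
    11. *)
Lemma coef2_freud_sum :
  S_ 2 = 20%:R * y * D 2 + 20%:R * y * y1 + 5%:R * D 1 ^+ 2.
Proof.
rewrite coef_freud_sum /= !big_ord_recl !big_ord0 /= /bump /=.
rewrite ?(subSS, subn0) !coef_reversedE !rmorphN ?rmorph_nat ?rmorph0 ?rmorph1.
by ring.
Qed.

Lemma coef4_freud_sum :
  S_ 4 = 44%:R * y * D 4 + 20%:R * y * Z 2 + 20%:R * y * y2 + 22%:R * D 1 * D 3
   + 10%:R * D 1 * Z 1 + 11%:R * D 2 ^+ 2 + 20%:R * D 2 * y1 + 10%:R * y1 ^+ 2.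
Proof.
rewrite coef_freud_sum /= !big_ord_recl !big_ord0 /= /bump /=.
rewrite ?(subSS, subn0) !coef_reversedE !rmorphN ?rmorph_nat ?rmorph0 ?rmorph1.
by ring.
Qed.

(** At leading order the shifts are invisible, so each of the ten products is y ^ 2, and 6 * 10 =
    60. *)
Lemma genus0_equation : y = 1 + 60%:R * fpsX F * y ^+ 3.
Proof.
have := congr1 (coef_fps 0) reversed_series_string.
rewrite coef_fpsD coef_fps1 -mulrA coef_fps_nat coef_fpsX coef_fpsM big_ord1.
by rewrite coef0_freud_sum coef_reversedE eqxx mulr1n => {1}->; ring.
Qed.

Lemma genus1_equation : y1 = 6%:R * fpsX F *
  (y * (20%:R * y * D 2 + 20%:R * y * y1 + 5%:R * D 1 ^+ 2)
   + y1 * (10%:R * y ^+ 2)).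
Proof.
have := congr1 (coef_fps 2) reversed_series_string.
rewrite coef_fpsD coef_fps1 -mulrA coef_fps_nat coef_fpsX coef_fpsM.
rewrite !big_ord_recl big_ord0 /= /bump /= ?(subSS, subn0) coef0_freud_sum.
rewrite coef2_freud_sum !coef_reversedE rmorph0 expr0n !mul0r !add0r.
by move=> {1}->; ring.
Qed.

Lemma genus2_equation : y2 = 6%:R * fpsX F *
  (y * (44%:R * y * D 4 + 20%:R * y * Z 2 + 20%:R * y * y2 + 22%:R * D 1 * D 3
   + 10%:R * D 1 * Z 1 + 11%:R * D 2 ^+ 2 + 20%:R * D 2 * y1 + 10%:R * y1 ^+ 2)
   + y1 * (20%:R * y * D 2 + 20%:R * y * y1 + 5%:R * D 1 ^+ 2)
   + y2 * (10%:R * y ^+ 2)).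
Proof.
have := congr1 (coef_fps 4) reversed_series_string.
rewrite coef_fpsD coef_fps1 -mulrA coef_fps_nat coef_fpsX coef_fpsM.
rewrite !big_ord_recl big_ord0 /= /bump /= ?(subSS, subn0) coef0_freud_sum.
rewrite coef2_freud_sum coef4_freud_sum !coef_reversedE rmorph0 !expr0n /=.
rewrite !mul0r !add0r.
by move=> {1}->; ring.
Qed.

Lemma genus_series0 : y 0%N = 1.
Proof. by rewrite /genus_series f0E coefX. Qed.

Lemma genus_series1_0 : y1 0%N = 0.
Proof. by rewrite /genus_series f_even. Qed.

(** This and the next five lemmas express k C(m, k) = (m - k + 1) C(m, k - 1), for m = 2 n + 1 in
    genus 0 and m = 2 n - 1 in genus 1, with multiplication by n read as [euler]. *)
Lemma euler_binomial1 : D 1 = 2%:R * euler y + y.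
Proof.
apply/funext => n; rewrite fpsD fps_natM /euler /binomial_series bin1 subn0.
by rewrite natrD natrM; ring.
Qed.

Lemma euler_binomial2 : D 2 = euler (D 1).
Proof.
apply/funext => n; rewrite /euler /binomial_series mulrA -natrM.
have := mul_bin_left (2 * n + 1 - 2 * 0) 1; rewrite subn0 addnK => eq_bin.
by congr (_%:R * _); lia.
Qed.

Lemma euler_binomial3 : 3%:R * D 3 = 2%:R * euler (D 2) - D 2.
Proof.
apply/funext => n; rewrite fpsB !fps_natM /euler /binomial_series !subn0.
rewrite [LHS]mulrA -(natrM _ 3) (mul_bin_left (2 * n + 1) 2).
case: n => [|n]; first by rewrite muln0 bin_small // !muln0; ring.
rewrite (_ : 2 * n.+1 + 1 - 2 = 2 * n + 1)%N; last by lia.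
by move: 'C(_, _) => c; rewrite natrM natrD natrM -(natr1 n); ring.
Qed.

Lemma euler_binomial4 : 2%:R * D 4 = euler (D 3) - D 3.
Proof.
apply/funext => n; rewrite fpsB fps_natM /euler /binomial_series !subn0.
have := mul_bin_left (2 * n + 1) 3.
case: n => [|n]; first by rewrite muln0 !bin_small // => _; ring.
rewrite (_ : 2 * n.+1 + 1 - 3 = 2 * n)%N; last by lia.
move: 'C(_, 4) 'C(_, 3) => c4 c3 eq_c; rewrite [LHS]mulrA -(natrM _ 2).
have -> : (2 * c4 = n * c3)%N by lia.
by rewrite natrM -(natr1 n); ring.
Qed.

Lemma euler_binomial1_genus1 : Z 1 = 2%:R * euler y1 - y1.
Proof.
apply/funext => n; rewrite fpsB fps_natM /euler /binomial_series bin1.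
case: n => [|n]; first by rewrite genus_series1_0; ring.
rewrite (_ : 2 * n.+1 + 1 - 2 * 1 = 2 * n + 1)%N; last by lia.
by rewrite natrD natrM -(natr1 n); ring.
Qed.

Lemma euler_binomial2_genus1 : Z 2 = euler (Z 1) - Z 1.
Proof.
apply/funext => n; rewrite fpsB /euler /binomial_series.
case: n => [|n]; first by rewrite genus_series1_0; ring.
rewrite (_ : 2 * n.+1 + 1 - 2 * 1 = 2 * n + 1)%N; last by lia.
have := mul_bin_left (2 * n + 1) 1; rewrite addnK bin1 => eq_bin.
have -> : 'C(2 * n + 1, 2) = (n * (2 * n + 1))%N by lia.
by rewrite natrM -(natr1 n); ring.
Qed.

Local Notation u := (y - 1).
Local Notation v := ((1 - 2%:R * (y - 1))^-1).

Lemma one_plus_u : 1 + u = y. Proof. by rewrite addrC subrK. Qed.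

Lemma planar_equation : u = 60%:R * fpsX F * (1 + u) ^+ 3.
Proof. by rewrite one_plus_u {1}genus0_equation addrAC subrr add0r. Qed.

Lemma planar_singularity_unit : (1 - 2%:R * u)^-1 * (1 - 2%:R * u) = 1.
Proof.
rewrite mulVr //; apply: fps_unitE.
rewrite fpsB fps_natM fpsB genus_series0 fps1 subrr mulr0 subr0.
exact: oner_neq0.
Qed.

Lemma fps_natI k (a b : fps F) : k.+1%:R * a = k.+1%:R * b -> a = b.
Proof.
move=> eq_ab; apply/funext => n; have := congr1 (@^~ n) eq_ab.
by rewrite !fps_natM => /mulfI; apply; rewrite pnatr_eq0.
Qed.

Lemma genus1_closed_form :
  2%:R * y1 = (1 + u) * (u + 10%:R * u ^+ 2) * v ^+ 4.
Proof.
apply: (y1E (x := fpsX F) fps_natI (@eulerD F) (@eulerN F) (@eulerM F)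
  (@euler_nat F) (@eulerX F) planar_equation planar_singularity_unit
  (D1 := D 1) (D2 := D 2)); rewrite ?one_plus_u.
- exact: euler_binomial1.
- exact: euler_binomial2.
exact: genus1_equation.
Qed.

Lemma genus2_closed_form :
  20%:R * y2 = (1 + u) * (59%:R * u ^+ 2 + 4011%:R * u ^+ 3
    + 27528%:R * u ^+ 4 + 34268%:R * u ^+ 5) * v ^+ 9.
Proof.
apply: (y2E (x := fpsX F) fps_natI (@eulerD F) (@eulerN F) (@eulerM F)
  (@euler_nat F) (@eulerX F) planar_equation planar_singularity_unit
  (D1 := D 1) (D2 := D 2) (D3 := D 3) (D4 := D 4) (y1 := y1)
  (Z1 := Z 1) (Z2 := Z 2)); rewrite ?one_plus_u.
- exact: euler_binomial1.
- exact: euler_binomial2.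
- exact: euler_binomial3.
- exact: euler_binomial4.
- exact: euler_binomial1_genus1.
- exact: euler_binomial2_genus1.
- exact: genus1_equation.
exact: genus2_equation.
Qed.

End GenusExpansion.

(** * Lagrange inversion for u = 60 w (1 + u) ^ 3 *)

Section LagrangeInversion.
Variables (F : numFieldType) (U v : fps F).
Local Notation X := (fpsX F).
Hypothesis U_eq : U = 60%:R * X * (1 + U) ^+ 3.
Hypothesis v_inv : v * (1 - 2%:R * U) = 1.
Implicit Types G H : fps F.

(* By Lagrange inversion [lagrange_series G] is [G(U) (1 + U) / (1 - 2 U)], as
   [U = w phi(U)] for [w = 60 X] and [phi(t) = (1 + t) ^ 3]. *)
Definition lagrange_series G : fps F :=
  fun n => 60%:R ^+ n * ((1 + X) ^+ (3 * n) * G) n.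

Local Notation T := lagrange_series.

Lemma lagrangeD G H : T (G + H) = T G + T H.
Proof. by apply/funext => n; rewrite /T mulrDr !fpsD mulrDr. Qed.

Lemma lagrange_nat k G : T (k%:R * G) = k%:R * T G.
Proof. by apply/funext => n; rewrite fps_natM /T mulrCA fps_natM mulrCA. Qed.

Lemma lagrangeX G : T (X * G) = 60%:R * (X * T ((1 + X) ^+ 3 * G)).
Proof.
apply/funext => n; rewrite fps_natM fpsXM /T.
rewrite mulrCA fpsXM; case: n => [|n]; first by rewrite !mulr0.
rewrite [60%:R ^+ n.+1]exprS -mulrA mulnS (exprD _ 3); congr (_ * (_ * _ n)).
by rewrite -mulrA mulrCA.
Qed.

Definition vanishes_below n G := forall i, (i < n)%N -> G i = 0.

Lemma vanishes_belowD n G H :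
  vanishes_below n G -> vanishes_below n H -> vanishes_below n (G + H).
Proof. by move=> G0 H0 i lt_in; rewrite fpsD G0 ?H0 ?addr0. Qed.

Lemma vanishes_belowM n G H : vanishes_below n H -> vanishes_below n (G * H).
Proof.
move=> H0 i lt_in; rewrite fpsM big1 // => k _.
by rewrite H0 ?mulr0 // (leq_ltn_trans (leq_subr _ _)).
Qed.

Lemma vanishes_belowX n H : vanishes_below n H -> vanishes_below n.+1 (X * H).
Proof. by move=> H0 [|i] lt_in; rewrite fpsXM // H0. Qed.

(** The defect [err] satisfies a homogeneous linear identity in which everything on the right
    carries a factor X, so it vanishes to every order. Multiplication by X inside [T] thus becomes
    multiplication by [U]. *)
Lemma lagrange_mulX G : T (X * G) = U * T G.
Proof.
pose err H := T (X * H) - U * T H.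
have errE H : err H = 60%:R * (X * ((3%:R + 3%:R * U + U ^+ 2) * err H
    + (3%:R + U) * err (X * H) + err (X * (X * H)))).
  rewrite {1}/err lagrangeX {1}U_eq /err.
  have -> : (1 + X) ^+ 3 * H =
      H + 3%:R * (X * H) + 3%:R * (X * (X * H)) + X * (X * (X * H)) by ring.
  by rewrite !lagrangeD !lagrange_nat; ring.
have err0 n H : vanishes_below n (err H).
  elim: n H => [|n IHn] H //; rewrite errE; apply/vanishes_belowM/vanishes_belowX.
  apply: vanishes_belowD; last exact: IHn.
  by apply: vanishes_belowD; apply: vanishes_belowM; apply: IHn.
apply/eqP; rewrite -subr_eq0; apply/eqP/funext => n.
exact: (err0 n.+1 G n (leqnn _)).
Qed.

Lemma lagrange_mulXn k G : T (X ^+ k * G) = U ^+ k * T G.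
Proof.
elim: k => [|k IHk]; first by rewrite !expr0 !mul1r.
by rewrite !exprS -!mulrA lagrange_mulX IHk.
Qed.

Lemma lagrange_singular G : T ((1 - 2%:R * X) * G) = (1 - 2%:R * U) * T G.
Proof.
have -> : (1 - 2%:R * X) * G = G + - (2%:R * (X * G)) by ring.
have TN H : T (- H) = - T H.
  by apply/funext => n; rewrite fpsN /T mulrN fpsN mulrN.
by rewrite lagrangeD TN lagrange_nat lagrange_mulX; ring.
Qed.

Lemma coef_one_plusX m k : ((1 + X) ^+ m) k = 'C(m, k)%:R.
Proof.
elim: m k => [|m IHm] k; first by rewrite expr0 fps1; case: k.
rewrite exprS mulrDl mul1r fpsD fpsXM IHm.
case: k => [|k]; last by rewrite IHm binS natrD.
by rewrite !bin0 addr0.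
Qed.

(** For phi(t) = (1 + t) ^ 3 the series is 1 - t phi'(t) / phi(t) = (1 - 2 t) / (1 + t). Its image
    is 1 because C(3 n + 2, n + 1) = 2 C(3 n + 2, n). *)
Lemma lagrange_unit : exists G0, [/\ (1 + X) * G0 = 1 - 2%:R * X, T G0 = 1 &
  forall m, (1 + X) ^+ m.+1 * G0 = (1 + X) ^+ m * (1 - 2%:R * X)].
Proof.
have unit1X : (1 + X) \is a GRing.unit.
  by apply: fps_unitE; rewrite fpsD fps1 addr0 oner_eq0.
exists ((1 + X)^-1 * (1 - 2%:R * X)).
have mulG0 m : (1 + X) ^+ m.+1 * ((1 + X)^-1 * (1 - 2%:R * X))
    = (1 + X) ^+ m * (1 - 2%:R * X) by rewrite exprSr -!mulrA (mulrA (1 + X)) mulrV ?mul1r.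
split=> //; first by rewrite mulrA mulrV ?mul1r.
apply/funext => -[|n].
  rewrite /T muln0 !expr0 !mul1r fpsM0 fps1.
  have := congr1 (@^~ 0%N) (mulrV unit1X); rewrite fpsM0 fpsD fps1 addr0 mul1r => ->.
  by rewrite fpsB fps1 fps_natM mulr0 subr0 mulr1.
rewrite /T fps1 /= mulnS mulG0 mulrBr mulr1 fpsB mulrCA fps_natM [_ * X]mulrC.
rewrite fpsXM !coef_one_plusX.
have := mul_bin_left (3 * n).+2 n.
rewrite (_ : (3 * n).+2 - n = n.+1 * 2)%N; last by lia.
rewrite -mulnA => /eqP; rewrite eqn_pmul2l // => /eqP ->.
by rewrite natrM subrr mulr0.
Qed.

Lemma lagrange1 : T 1 = (1 + U) * v.
Proof.
have [G0 [eq_G0 T_G0 _]] := lagrange_unit.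
have := lagrangeD G0 (X * G0); rewrite lagrange_mulX T_G0 mulr1.
have -> : G0 + X * G0 = (1 - 2%:R * X) * 1 by rewrite mulr1 -eq_G0; ring.
rewrite lagrange_singular => <-.
by rewrite mulrAC [(1 - _) * v]mulrC v_inv mul1r.
Qed.

Lemma lagrange_coef_U n : U n.+1 =
  60%:R ^+ n.+1 * ('C((3 * n).+2, n)%:R - 2%:R * (if n is k.+1 then 'C((3 * n).+2, k)%:R else 0)).
Proof.
have [G0 [_ T_G0 powG0]] := lagrange_unit.
rewrite -[U]mulr1 -T_G0 -lagrange_mulX /T mulrCA fpsXM mulnS powG0 mulrBr mulr1.
rewrite fpsB mulrCA fps_natM [_ * X]mulrC fpsXM coef_one_plusX.
by case: n => // n; rewrite coef_one_plusX.
Qed.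

(* The expansion of [(1 - 2 t) ^- (c + 1)]. *)
Definition singular_series c : fps F := fun n => 'C(n + c, c)%:R * 2%:R ^+ n.

Lemma singular_seriesS c :
  (1 - 2%:R * X) * singular_series c.+1 = singular_series c.
Proof.
apply/funext => n; rewrite mulrBl mul1r fpsB -mulrA fps_natM fpsXM /singular_series.
case: n => [|n]; first by rewrite !add0n !binn mulr0 subr0.
by rewrite addnS binS natrD exprS addnS addSn; ring.
Qed.

Lemma singular_series0 : (1 - 2%:R * X) * singular_series 0 = 1.
Proof.
apply/funext => n; rewrite mulrBl mul1r fpsB -mulrA fps_natM fpsXM /singular_series.
case: n => [|n]; first by rewrite !bin0 mulr0 subr0 mulr1.
by rewrite !bin0 !mul1r exprS subrr.
Qed.

Lemma lagrange_singular_series c G :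
  T (singular_series c * G) = T G * v ^+ c.+1.
Proof.
have divv a b : a = (1 - 2%:R * U) * b -> b = a * v.
  by move=> ->; rewrite mulrAC [(1 - _) * v]mulrC v_inv mul1r.
elim: c => [|c IHc].
  rewrite expr1; apply: divv; rewrite -lagrange_singular mulrA singular_series0.
  by rewrite mul1r.
rewrite exprSr mulrA -IHc; apply: divv.
by rewrite -lagrange_singular mulrA singular_seriesS.
Qed.

Lemma lagrange_monomial c k :
  T (X ^+ k * singular_series c) = U ^+ k * (1 + U) * v ^+ c.+2.
Proof.
rewrite lagrange_mulXn -[singular_series c]mulr1 lagrange_singular_series lagrange1.
by rewrite [v ^+ c.+2]exprS; ring.
Qed.

Lemma coef_Xn_mul k G n : (X ^+ k * G) n = if (k <= n)%N then G (n - k)%N else 0.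
Proof.
elim: k n => [|k IHk] n; first by rewrite expr0 mul1r subn0.
by rewrite exprS -mulrA fpsXM; case: n.
Qed.

Lemma lagrange_coef c k n : (U ^+ k * (1 + U) * v ^+ c.+2) n =
  if (k <= n)%N then 60%:R ^+ n * \sum_(i < (n - k).+1)
    'C(3 * n, n - k - i)%:R * ('C(i + c, c)%:R * 2%:R ^+ i) else 0.
Proof.
rewrite -lagrange_monomial /T mulrCA coef_Xn_mul; case: ifP => _; last by rewrite mulr0.
rewrite [(1 + X) ^+ _ * _]mulrC fpsM; congr (_ * _); apply: eq_bigr => i _.
by rewrite coef_one_plusX mulrC.
Qed.

End LagrangeInversion.
From mathcomp Require Import all_classical all_reals all_analysis.

Import Order.TTheory GRing.Theory Num.Theory.
Import numFieldNormedType.Exports.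

(** * Terminating hypergeometric sums at - 2 *)

Section TerminatingHypergeometric.
Variable R : realType.

Lemma pochhammerS (a : R) k : pochhammer a k.+1 = pochhammer a k * (a + k%:R).
Proof. by rewrite /pochhammer big_nat_recr. Qed.

Lemma pochhammer0 (a : R) : pochhammer a 0 = 1.
Proof. by rewrite /pochhammer big_geq. Qed.

Lemma pochhammer_neg M k : (M < k)%N -> pochhammer (- M%:R : R) k = 0.
Proof.
elim: k => // k IHk; rewrite ltnS leq_eqVlt pochhammerS => /orP[/eqP ->|/IHk ->].
  by rewrite addNr mulr0.
by rewrite mul0r.
Qed.

Lemma pochhammer_pos m k : pochhammer (m.+1%:R : R) k != 0.
Proof.
elim: k => [|k IHk]; first by rewrite pochhammer0 oner_eq0.
by rewrite pochhammerS mulf_neq0 // -natrD pnatr_eq0.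
Qed.

Lemma pochhammer_fact c k : pochhammer (c.+1%:R : R) k = 'C(k + c, c)%:R * k`!%:R.
Proof.
elim: k => [|k IHk]; first by rewrite pochhammer0 add0n binn mulr1.
rewrite pochhammerS IHk -natrD -!natrM; congr (_%:R).
have eq_bin : (k.+1 * 'C(k.+1 + c, c) = (c.+1 + k) * 'C(k + c, c))%N.
  have binC m : 'C(m + c, c) = 'C(m + c, m).
    by rewrite -(bin_sub (leq_addr c m)) addKn.
  by rewrite !binC addSn -mul_bin_diag addnC addSn.
by rewrite factS mulnA -[('C(k.+1 + c, c) * _)%N]mulnC eq_bin mulnC mulnA.
Qed.

Lemma pochhammer_bin M N k : (M <= N)%N -> (k <= M)%N ->
  'C(N, M)%:R * pochhammer (- M%:R : R) k =
  (-1) ^+ k * 'C(N, M - k)%:R * pochhammer ((N - M).+1%:R : R) k.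
Proof.
move=> le_MN; elim: k => [|k IHk] lt_kM.
  by rewrite !pochhammer0 subn0 expr0 mul1r.
rewrite !pochhammerS mulrA IHk 1?ltnW //.
have := mul_bin_left N (M - k.+1); rewrite (_ : (M - k.+1).+1 = M - k)%N; last by lia.
move=> eq_bin; have eqR : (M - k)%:R * 'C(N, M - k)%:R =
    ((N - M).+1%:R + k%:R) * 'C(N, M - k.+1)%:R :> R.
  by rewrite -natrM eq_bin natrM -natrD; congr (_%:R * _); lia.
rewrite natrB in eqR; last exact: ltnW.
rewrite exprS; set p := pochhammer _ _; set b := 'C(N, M - k)%:R in eqR *.
set b' := 'C(N, M - k.+1)%:R in eqR *.
have -> : (-1) ^+ k * b * p * (- M%:R + k%:R) = - (-1) ^+ k * p * ((M%:R - k%:R) * b) by ring.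
by rewrite eqR; ring.
Qed.

(** With M = n - k, the second parameter - M ends the series after M + 1 terms. The first parameter
    over i! gives C(i + c, c); the other two turn C(3 n, M) into C(3 n, M - i) with the sign (- 1) ^
    i, which cancels that of (- 2) ^ i. *)
Lemma hyp2F1_terminating c k n : (k <= n)%N ->
  'C(3 * n, n - k)%:R *
    hyp2F1 (c.+1%:R : R) (k%:R - n%:R) (k.+1%:R + 2 * n%:R) (- 2) =
  \sum_(i < (n - k).+1) 'C(3 * n, n - k - i)%:R * ('C(i + c, c)%:R * 2 ^+ i).
Proof.
move=> le_kn; set M := (n - k)%N.
have -> : k%:R - n%:R = - M%:R :> R by rewrite natrB // opprB.
have -> : k.+1%:R + 2 * n%:R = (3 * n - M).+1%:R :> R.
  by rewrite -natrM -natrD; congr (_%:R); rewrite /M; lia.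
rewrite /hyp2F1; set t := (fun k => _).
have -> : limn (series t) = \sum_(i < M.+1) t i.
  (* Partial sums are constant from M + 1 terms on, so the limit is a finite sum. *)
  apply: cvg_lim => //; apply: cvg_near_cst; near=> m.
  have lt_Mm : (M < m)%N by near: m; exists M.+1.
  rewrite /series /= big_mkord (big_ord_widen m t lt_Mm) [in RHS]big_mkcond.
  apply: eq_bigr => i _ /=; case: ltnP => // lt_Mi; rewrite /t pochhammer_neg //.
  by rewrite mulr0 !mul0r.
rewrite mulr_sumr; apply: eq_bigr => i _; rewrite /t.
have := @pochhammer_bin M (3 * n) i; rewrite leq_ord.
have -> : (M <= 3 * n)%N by rewrite /M; lia.
move=> /(_ isT isT) eq_bin; have nz := pochhammer_pos (3 * n - M) i.
have nzf : i`!%:R != 0 :> R by rewrite pnatr_eq0 -lt0n fact_gt0.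
rewrite pochhammer_fact.
transitivity (('C(3 * n, M)%:R * pochhammer (- M%:R : R) i) * 'C(i + c, c)%:R
   / pochhammer ((3 * n - M).+1%:R : R) i * (- 2) ^+ i).
  by field; rewrite nz nzf.
rewrite eq_bin -[in (- 2) ^+ i]mulN1r exprMn.
have sq : (-1) ^+ i * (-1) ^+ i = 1 :> R by rewrite -exprMn mulrNN mulr1 expr1n.
transitivity (((-1) ^+ i * (-1) ^+ i : R) * 'C(3 * n, M - i)%:R * ('C(i + c, c)%:R * 2 ^+ i)).
  by field.
by rewrite sq mul1r.
Unshelve. all: by end_near. Qed.

End TerminatingHypergeometric.

(** * The formulas and the small values *)

Section Counting.
Variable R : realType.

Local Notation f := (fun n => face_poly n R).
Local Notation y := (genus_series f 0).
Local Notation u := (y - 1).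
Local Notation v := ((1 - 2%:R * (y - 1))^-1).

Let horner_f N n : (f n).[N.+1%:R] = freud_series R N.+1 n.
Proof. exact: horner_face_poly. Qed.

Let f_even n i : ~~ odd i -> (f n)`_i = 0.
Proof. exact: coef_face_poly_even. Qed.

Let u_eq := planar_equation horner_f f_even.
Let v_inv := planar_singularity_unit horner_f.

(** The offset 2 makes [c.+1] the first hypergeometric parameter: Lagrange inversion absorbs one
    power of [v]. The powers 4 and 9 in the closed forms thus give the parameters 3 and 8. *)
Definition lagrange_term c k : fps R := u ^+ k * (1 + u) * v ^+ c.+2.

Lemma lagrange_term_coef c k n : (k <= n)%N -> lagrange_term c k n =
  60 ^+ n * \sum_(i < (n - k).+1) 'C(3 * n, n - k - i)%:R * ('C(i + c, c)%:R * 2 ^+ i).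
Proof. by move=> le_kn; rewrite /lagrange_term (lagrange_coef u_eq v_inv) le_kn. Qed.

Lemma lagrange_term_small c k n : (n < k)%N -> lagrange_term c k n = 0.
Proof.
by move=> lt_nk; rewrite /lagrange_term (lagrange_coef u_eq v_inv) leqNgt lt_nk.
Qed.

Lemma lagrange_term_hyp c k n : (k <= n)%N -> lagrange_term c k n =
  60 ^+ n * ('C(3 * n, n - k)%:R *
    hyp2F1 (c.+1%:R : R) (k%:R - n%:R) (k.+1%:R + 2 * n%:R) (- 2)).
Proof. by move=> le_kn; rewrite lagrange_term_coef // hyp2F1_terminating. Qed.

Lemma Ngraph_genus g n : (2 * g <= 2 * n + 1)%N ->
  (Ngraph g 6 n)%:R = n`!%:R * genus_series f g n.
Proof. by move=> le_g; rewrite (NgraphE R le_g). Qed.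

Lemma Ngraph0_formula n : (1 <= n)%N ->
  (Ngraph 0 6 n)%:R = 60 ^+ n * ((3 * n)`!%:R / (2 * n + 1)`!%:R) :> R.
Proof.
case: n => // n _; rewrite Ngraph_genus //.
have -> : genus_series f 0 n.+1 = u n.+1 by rewrite fpsB fps1 subr0.
rewrite (lagrange_coef_U u_eq).
have fact_nz m : m`!%:R != 0 :> R by rewrite pnatr_eq0 -lt0n fact_gt0.
(* From n C(3 n + 2, n) = (2 n + 3) C(3 n + 2, n - 1), the difference of binomials is 3 / (2 n + 3)
   times the first one. *)
have bin_diff : (2 * n + 3)%:R * ('C((3 * n).+2, n)%:R
    - 2 * (if n is k.+1 then 'C((3 * n).+2, k)%:R else 0)) =
    3 * 'C((3 * n).+2, n)%:R :> R.
  case: n => [|k]; first by rewrite !muln0 !bin0; ring.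
  have := mul_bin_left (3 * k.+1).+2 k.
  rewrite (_ : (3 * k.+1).+2 - k = 2 * k.+1 + 3)%N; last by lia.
  move: 'C(_, k.+1) 'C(_, k) => b b' eq_b.
  have eqR : k.+1%:R * b%:R = (2 * k.+1 + 3)%:R * b'%:R :> R by rewrite -!natrM eq_b.
  rewrite mulrBr [_ * (2 * _)]mulrCA -eqR natrD natrM; ring.
have bin_f := bin_fact (leq_trans (leq_pmull n (isT : 0 < 3)%N)
  (leq_trans (leqnSn _) (leqnSn _)) : (n <= (3 * n).+2)%N).
have eqC : 'C((3 * n).+2, n)%:R * (n`!%:R * (2 * n + 2)`!%:R) = ((3 * n).+2)`!%:R :> R.
  rewrite -!natrM; congr (_%:R); rewrite -bin_f; congr (_ * (_ * _`!))%N; lia.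
have -> : (3 * n.+1)`! = ((3 * n).+3 * (3 * n).+2`!)%N by rewrite mulnS add3n factS.
have -> : (2 * n.+1 + 1)`! = ((2 * n + 3) * (2 * n + 2)`!)%N.
  by rewrite (_ : 2 * n.+1 + 1 = (2 * n + 2).+1)%N ?factS; [congr (_ * _)%N|]; lia.
rewrite factS mulrCA; congr (_ * _).
rewrite [((3 * n).+3 * _)%:R]natrM -eqC [(_ * (2 * n + 2)`!)%:R]natrM.
have nz3 : (2 * n + 3)%:R != 0 :> R by rewrite pnatr_eq0 addnS.
set d := (_ - _) in bin_diff *; apply: (mulfI nz3).
rewrite mulrCA bin_diff natrM (_ : (3 * n).+3%:R = 3 * n.+1%:R :> R); last first.
  by rewrite -natrM; congr (_%:R); lia.
by field; rewrite fact_nz -natrM -natrD.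
Qed.

Lemma genus_series1E n : 2 * genus_series f 1 n =
  lagrange_term 2 1 n + 10 * lagrange_term 2 2 n.
Proof.
have := congr1 (@^~ n) (genus1_closed_form horner_f f_even).
rewrite fps_natM => ->.
transitivity ((lagrange_term 2 1 + 10%:R * lagrange_term 2 2) n); last first.
  by rewrite fpsD fps_natM.
have alg (A : comNzRingType) (a b : A) : (1 + a) * (a + 10%:R * a ^+ 2) * b ^+ 4 =
    a ^+ 1 * (1 + a) * b ^+ 4 + 10%:R * (a ^+ 2 * (1 + a) * b ^+ 4) by ring.
by rewrite /lagrange_term -alg.
Qed.

Lemma coef_nat_combination (k1 k2 k3 k4 : nat) (g1 g2 g3 g4 : fps R) n :
  (k1%:R * g1 + k2%:R * g2 + k3%:R * g3 + k4%:R * g4) n =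
  k1%:R * g1 n + k2%:R * g2 n + k3%:R * g3 n + k4%:R * g4 n.
Proof. by rewrite !fpsD !fps_natM. Qed.

Lemma genus_series2E n : 20 * genus_series f 2 n =
  59 * lagrange_term 7 2 n + 4011%:R * lagrange_term 7 3 n
  + 27528%:R * lagrange_term 7 4 n + 34268%:R * lagrange_term 7 5 n.
Proof.
have := congr1 (@^~ n) (genus2_closed_form horner_f f_even).
rewrite fps_natM => ->.
transitivity ((59%:R * lagrange_term 7 2 + 4011%:R * lagrange_term 7 3
  + 27528%:R * lagrange_term 7 4 + 34268%:R * lagrange_term 7 5) n); last first.
  exact: coef_nat_combination.
have alg (A : comNzRingType) (a b : A) : (1 + a) * (59%:R * a ^+ 2
      + 4011%:R * a ^+ 3 + 27528%:R * a ^+ 4 + 34268%:R * a ^+ 5) * b ^+ 9 =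
    59%:R * (a ^+ 2 * (1 + a) * b ^+ 9) + 4011%:R * (a ^+ 3 * (1 + a) * b ^+ 9)
    + 27528%:R * (a ^+ 4 * (1 + a) * b ^+ 9) + 34268%:R * (a ^+ 5 * (1 + a) * b ^+ 9).
  by ring.
by rewrite /lagrange_term -alg.
Qed.

Lemma Ngraph1_formula n : (2 <= n)%N ->
  (Ngraph 1 6 n)%:R = n`!%:R * 60 ^+ n / 2 *
    (10 * 'C(3 * n, n - 2)%:R * hyp2F1 3 (2 - n%:R) (3 + 2 * n%:R) (- 2)
     + 'C(3 * n, n - 1)%:R * hyp2F1 3 (1 - n%:R) (2 + 2 * n%:R) (- 2)) :> R.
Proof.
move=> le2n; rewrite Ngraph_genus; last by lia.
have -> : genus_series f 1 n = (2 * genus_series f 1 n) / 2 by field.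
rewrite genus_series1E !lagrange_term_hyp //; last by lia.
by rewrite -[1%:R]/(1 : R); move: (hyp2F1 _ _ _ _) (hyp2F1 _ _ _ _) => h1 h2; field.
Qed.

Lemma Ngraph2_formula n : (5 <= n)%N ->
  (Ngraph 2 6 n)%:R = n`!%:R * 60 ^+ n / 20 *
    (59 * 'C(3 * n, n - 2)%:R * hyp2F1 8 (2 - n%:R) (3 + 2 * n%:R) (- 2)
     + 4011%:R * 'C(3 * n, n - 3)%:R * hyp2F1 8 (3 - n%:R) (4 + 2 * n%:R) (- 2)
     + 27528%:R * 'C(3 * n, n - 4)%:R * hyp2F1 8 (4 - n%:R) (5 + 2 * n%:R) (- 2)
     + 34268%:R * 'C(3 * n, n - 5)%:R * hyp2F1 8 (5 - n%:R) (6 + 2 * n%:R) (- 2)) :> R.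
Proof.
move=> le5n; rewrite Ngraph_genus; last by lia.
have -> : genus_series f 2 n = (20 * genus_series f 2 n) / 20 by field.
rewrite genus_series2E !lagrange_term_hyp //; try lia.
by field.
Qed.

Lemma lagrange_term_nat c k n N : (k <= n)%N ->
  (\sum_(i < (n - k).+1) 'C(3 * n, n - k - i) * ('C(i + c, c) * 2 ^ i))%N = N ->
  lagrange_term c k n = 60 ^+ n * N%:R.
Proof.
move=> le_kn <-; rewrite lagrange_term_coef // natr_sum; congr (_ * _).
by apply: eq_bigr => i _; rewrite !natrM natrX.
Qed.

(* Keeps large numerals out of the reach of unification, which would unfold
   them into unary numbers. *)
Lemma nat_of_real_eq (m n : nat) (x : R) : m%:R = x -> n%:R = x -> m = n.
Proof. by move=> eq_m eq_n; apply/eqP; rewrite -(eqr_nat R) eq_m eq_n. Qed.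

Lemma natrM_exp (m a b : nat) : (m * a ^ b)%:R = m%:R * a%:R ^+ b :> R.
Proof. by rewrite natrM natrX. Qed.

(** For n < k the term in u ^ k contributes 0, while the binomial with truncated lower index n - k
    would be 1. This is why the small cases are computed from [lagrange_term_small]. *)
Lemma Ngraph1_1 : Ngraph 1 6 1 = 30%N.
Proof.
have t1 : lagrange_term 2 1 1 = 60 ^+ 1 * 1%:R.
  by apply: lagrange_term_nat => //; rewrite big_ord1.
apply/eqP; rewrite -(eqr_nat R) Ngraph_genus //.
have -> : genus_series f 1 1 = (2 * genus_series f 1 1) / 2 by field.
by rewrite genus_series1E t1 lagrange_term_small // (_ : 1`! = 1)%N //; apply/eqP; field.
Qed.

Lemma Ngraph2_1 : Ngraph 2 6 1 = 0%N.
Proof. exact: Ngraph_eq0. Qed.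

Lemma Ngraph2_2 : Ngraph 2 6 2 = 21240%N.
Proof.
have t2 : lagrange_term 7 2 2 = 60 ^+ 2 * 1%:R.
  by apply: lagrange_term_nat => //; rewrite big_ord1.
apply/eqP; rewrite -(eqr_nat R) Ngraph_genus //.
have -> : genus_series f 2 2 = (20 * genus_series f 2 2) / 20 by field.
rewrite genus_series2E t2 !lagrange_term_small // (_ : 2`! = 2)%N //.
by apply/eqP; field.
Qed.

Lemma Ngraph2_3 : Ngraph 2 6 3 = 355492800%N.
Proof.
(* 25 = C(9, 1) + 8 * 2. *)
have t2 : lagrange_term 7 2 3 = 60 ^+ 3 * 25%:R.
  by apply: lagrange_term_nat => //; rewrite !big_ord_recl big_ord0.
have t3 : lagrange_term 7 3 3 = 60 ^+ 3 * 1%:R.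
  by apply: lagrange_term_nat => //; rewrite big_ord1.
have eqR : (Ngraph 2 6 3)%:R = 6 * 60 ^+ 3 * (59 * 25 + 4011%:R) / 20 :> R.
  rewrite Ngraph_genus //.
  have -> : genus_series f 2 3 = (20 * genus_series f 2 3) / 20 by field.
  rewrite genus_series2E t2 t3 (@lagrange_term_small 7 4 3) //.
  rewrite (@lagrange_term_small 7 5 3) // (_ : 3`! = 6)%N //.
  by field.
by apply: (nat_of_real_eq eqR); field.
Qed.

Lemma Ngraph2_4 : Ngraph 2 6 4 = (2543591808 * 10 ^ 3)%N.
Proof.
(* 402 = C(12, 2) + 12 * 8 * 2 + C(9, 7) * 4, and below 28 = 12 + 8 * 2. *)
have t2 : lagrange_term 7 2 4 = 60 ^+ 4 * 402%:R.
  by apply: lagrange_term_nat => //; rewrite !big_ord_recl big_ord0.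
have t3 : lagrange_term 7 3 4 = 60 ^+ 4 * 28%:R.
  by apply: lagrange_term_nat => //; rewrite !big_ord_recl big_ord0.
have t4 : lagrange_term 7 4 4 = 60 ^+ 4 * 1%:R.
  by apply: lagrange_term_nat => //; rewrite big_ord1.
have eqR : (Ngraph 2 6 4)%:R =
    24 * 60 ^+ 4 * (59 * 402 + 4011%:R * 28 + 27528%:R) / 20 :> R.
  rewrite Ngraph_genus //.
  have -> : genus_series f 2 4 = (20 * genus_series f 2 4) / 20 by field.
  rewrite genus_series2E t2 t3 t4 (@lagrange_term_small 7 5 4); last by [].
  rewrite (_ : 4`! = 24)%N; last by [].
  by field.
apply: (nat_of_real_eq eqR).
transitivity (2543591808%N%:R * 10%:R ^+ 3 : R); first exact: natrM_exp.
by field.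
Qed.

End Counting.

Theorem theoremA6 (R : realType) :
  [/\ (forall j : nat, (1 <= j)%N ->
        (Ngraph 0 6 j)%:R = 60 ^+ j * ((3 * j)`!%:R / (2 * j + 1)`!%:R) :> R),
      (forall j : nat, (2 <= j)%N ->
        (Ngraph 1 6 j)%:R =
          j`!%:R * 60 ^+ j / 2 *
          (10 * 'C(3 * j, j - 2)%:R
             * hyp2F1 3 (2 - j%:R) (3 + 2 * j%:R) (- 2)
           + 'C(3 * j, j - 1)%:R
             * hyp2F1 3 (1 - j%:R) (2 + 2 * j%:R) (- 2)) :> R)
      /\ Ngraph 1 6 1 = 30%N,
      (forall j : nat, (5 <= j)%N ->
        (Ngraph 2 6 j)%:R =
          j`!%:R * 60 ^+ j / 20 *
          (59 * 'C(3 * j, j - 2)%:R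
             * hyp2F1 8 (2 - j%:R) (3 + 2 * j%:R) (- 2)
           + 4011%:R * 'C(3 * j, j - 3)%:R
             * hyp2F1 8 (3 - j%:R) (4 + 2 * j%:R) (- 2)
           + 27528%:R * 'C(3 * j, j - 4)%:R
             * hyp2F1 8 (4 - j%:R) (5 + 2 * j%:R) (- 2)
           + 34268%:R * 'C(3 * j, j - 5)%:R
             * hyp2F1 8 (5 - j%:R) (6 + 2 * j%:R) (- 2)) :> R)
    & [/\ Ngraph 2 6 1 = 0%N,
          Ngraph 2 6 2 = 21240%N,
          Ngraph 2 6 3 = 355492800%N
        & Ngraph 2 6 4 = (2543591808 * 10 ^ 3)%N]].
Proof.
split.
- exact: Ngraph0_formula.
- by split; [exact: Ngraph1_formula | exact: (Ngraph1_1 R)].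
- exact: Ngraph2_formula.
split; first exact: Ngraph2_1.
- exact: (Ngraph2_2 R).
- exact: (Ngraph2_3 R).
exact: (Ngraph2_4 R).
Qed.
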